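(* Let $O_1,\dots,O_n$ be i.i.d. copies of $O=(X,A,Y)\sim P$ with $A\in\{-1,1\}$, and let the value of a policy $\pi$ be the median reward $\mathcal V(\pi)=\inf\{m\in\mathbb R:1/2\le F_\pi(m)\}$, where $F_\pi(m)=\mathbb E[P(Y\le m\mid A=\pi(X),X)]$. Suppose there is $c>0$ such that for each $\pi\in\overline\Pi$, $F_\pi$ is continuously differentiable on $[\mathcal V(\pi)-c,\mathcal V(\pi)+c]$ with derivative $\dot F_\pi$, and $$0<\inf_{\pi\in\overline\Pi}\ \inf_{|m-\mathcal V(\pi)|\le c}\dot F_\pi(m)\le\sup_{\pi\in\overline\Pi}\ \sup_{|m-\mathcal V(\pi)|\le c}\dot F_\pi(m)<\infty ,$$ and that there is a function $\omega:[0,\infty)\to[0,\infty)$ with $\lim_{m\downarrow0}\omega(m)=\omega(0)=0$ such that $$\sup_{\pi\in\overline\Pi}\ \sup_{|k|\le c}\left[\left|\dot F_\pi(\mathcal V(\pi)+k)-\dot F_\pi(\mathcal V(\pi))\right|-\omega(|k|)\right]\le 0 .$$ For $\pi\in\overline\Pi$ let $$f_\pi(o)=-\frac{\mathbf 1\{a=\pi(x)\}}{P(A=a\mid X=x)\,\dot F_\pi(\mathcal V(\pi))}\Bigl[\mathbf 1\{y\le\mathcal V(\pi)\}-P\{Y\le\mathcal V(\pi)\mid A=a,X=x\}\Bigr]-\frac{P\{Y\le\mathcal V(\pi)\mid A=\pi(x),X=x\}-1/2}{\dot F_\pi(\mathcal V(\pi))}.$$ Let $\{\widehat{\mathcal V}(\pi):\pi\in\Pi\}$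 be an estimator of $\{\mathcal V(\pi):\pi\in\Pi\}$ based on $O_1,\dots,O_n$ such that $$\sup_{\pi\in\Pi}\left|n^{1/2}\bigl(\widehat{\mathcal V}(\pi)-\mathcal V(\pi)\bigr)-\widetilde{\mathbb G}_nf_\pi\right|=o_P(1),\qquad \widetilde{\mathbb G}_n=n^{1/2}(P_n-P),$$ and let $\widehat\pi\in\Pi$ be a data-dependent policy with $\widehat{\mathcal V}(\widehat\pi)\ge\sup_{\pi\in\Pi}\widehat{\mathcal V}(\pi)-o_P(n^{-1/2})$. If $\Pi$ is $P$-Donsker and $\pi\mapsto f_\pi$ is uniformly continuous from $\overline\Pi$ to $L^2(P)$ (both equipped with the $L^2(P)$ norm), then $\mathcal R(\widehat\pi)=o_P(n^{-1/2})$.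
   Context: $X\in\mathcal X$ is a covariate vector and $Y$ a real reward. Standing assumptions: $Y$ is uniformly bounded under $P$ and there is $\delta\in(0,1/2)$ with $P(A=1\mid X)\in[\delta,1-\delta]$ with probability one. $\mathbb E$ is expectation under $P$ and $P_n$ is the empirical measure of $O_1,\dots,O_n$. $\Pi$ is a class of policies, i.e., maps $\mathcal X\to\{-1,1\}$, and $\overline\Pi$ is its $L^2(P)$ closure. The regret is $\mathcal R(\pi)=\sup_{\pi'\in\Pi}\mathcal V(\pi')-\mathcal V(\pi)$. Measurability issues are disregarded. *)

(* Defs.v *)
From HB Require Import structures.
From mathcomp Require Import all_boot all_order all_algebra.
From mathcomp Require Import all_classical all_reals all_analysis.

Set Implicit Arguments.
Unset Strict Implicit.
Unset Printing Implicit Defensive.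

Import Order.TTheory GRing.Theory Num.Theory numFieldNormedType.Exports.

Local Open Scope classical_set_scope.
Local Open Scope ring_scope.

(* The sample (O_1, ..., O_n) is modelled as the coordinates of [n.-tuple T]
   under the product law P^n, as is customary when outer probabilities are
   used: on an arbitrary probability space carrying i.i.d. variables, outer
   probabilities of non-measurable events need not be determined by P. *)
Section sample.
Context d (T : measurableType d) (R : realType).

Definition tcons n (z : T * n.-tuple T) : n.+1.-tuple T :=
  [the n.+1.-tuple T of z.1 :: z.2].

Let measurable_tcons n : measurable_fun [set: T * n.-tuple T] (@tcons n).
Proof. exact: measurable_cons. Qed.

HB.instance Definition _ n :=
  isMeasurableFun.Build _ _ _ _ (@tcons n) (@measurable_tcons n).

Fixpoint iid_law (P : probability T R) n : probability (n.-tuple T) R :=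
  match n with
  | 0 => dirac [tuple]
  | m.+1 => distribution (P \x iid_law P m)%E (@tcons m)
  end.

Lemma iid_lawE (P : probability T R) n (A : 'I_n -> set T) :
  (forall i, measurable (A i)) ->
  iid_law P n [set s | forall i, A i (tnth s i)] = (\prod_(i < n) P (A i))%E.
Proof.
elim: n A => [|n IHn] A mA.
  by rewrite big_ord0 /= diracE mem_set//= => -[].
rewrite big_ord_recl -IHn; last by move=> i; exact: mA.
rewrite /= /distribution /pushforward.
set B := [set s : n.-tuple T | _].
have -> : @tcons n @^-1` [set s | forall i, A i (tnth s i)] = A ord0 `*` B.
  apply/seteqP; split=> -[x s] /=.
    move=> As; split=> /=; first exact: (As ord0).
    by move=> i /=; have := As (lift ord0 i); rewrite tnthS.
  move=> [Ax Bs] i; case: (unliftP ord0 i) => [j ->|->] //=.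
  by rewrite tnthS; exact: Bs.
apply: product_measure1E; first exact: mA.
have -> : B = \bigcap_(i in [set: 'I_n]) ((fun s => tnth s i) @^-1` A (lift ord0 i)).
  by apply/seteqP; split=> s /= Bs i => [_|]; exact: Bs.
apply: fin_bigcap_measurable; first exact: finite_finset.
by move=> i _; rewrite -[X in measurable X]setTI; exact: measurable_tnth.
Qed.

Implicit Type P : probability T R.

(* Z_n = o_P(rate_n), with P^* the outer probability; Z_n may be infinite. *)
Definition littleo_P P (rate : nat -> R) (Z : forall n, n.-tuple T -> \bar R) :=
  forall e : R, 0 < e ->
    ((iid_law P n)^*%mu [set s | ((e * rate n)%:E < `|Z n s|)%E]
       @[n --> \oo] --> 0)%E.

Definition emp_process P n (s : n.-tuple T) (f : T -> R) : R :=
  Num.sqrt n%:R *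
    (n%:R^-1 * (\sum_(i < n) f (tnth s i)) - \int[P]_x f x).

End sample.

(* For a functional bounded from below, restricting to integrable majorants
   (rather than all those whose expectation exists) does not change the
   infimum. *)
Definition outer_expectation d (T : measurableType d) (R : realType)
    (mu : probability T R) (Z : T -> R) : \bar R :=
  ereal_inf [set (\int[mu]_x U x)%E | U in
    [set U : T -> \bar R | mu.-integrable setT U /\
                           forall x, ((Z x)%:E <= U x)%E]].

Section donsker.
Context d (T : measurableType d) (R : realType).
Implicit Types (P : probability T R) (F : set (T -> R)).

(* l^oo(F), with the topology of the supremum distance. *)
Definition linfty F : set {uniform F -> R} :=
  [set z : {uniform F -> R} | bounded_fun (z : F -> R)].
Arguments linfty F _ : clear implicits.

Definition borel F := g_sigma_algebraType (@open {uniform F -> R}).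

Definition emp_path P F n (s : n.-tuple T) : {uniform F -> R} :=
  fun f => emp_process P s (val f).
Arguments emp_path P F {n} s.

Definition tight F (L : probability (borel F) R) :=
  forall e : R, 0 < e -> exists K : set {uniform F -> R},
    [/\ compact K, K `<=` linfty F & ((1 - e)%:E <= L K)%E].

(* F is P-Donsker: the empirical process, indexed by F, converges weakly in
   l^oo(F), in the sense of outer expectations, to a tight Borel law L. *)
Definition donsker P F :=
  [/\ forall f, F f -> measurable_fun setT f /\
        P.-integrable setT (fun x => (f x ^+ 2)%:E),
      forall n (s : n.-tuple T), linfty F (emp_path P F s)
    & exists2 L : probability (borel F) R, tight L &
        forall h : {uniform F -> R} -> R,
          {within linfty F, continuous h} ->
          [bounded h z | z in linfty F] ->
          outer_expectation (iid_law P n)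
              (fun s : n.-tuple T => h (emp_path P F s))
            @[n --> \oo] --> (\int[L]_(z in linfty F) (h z)%:E)%E].

End donsker.
Arguments linfty {d T R} F.
Arguments emp_path {d T R} P F {n} s.

(* k is a regular conditional law of V given U. *)
Definition cond_law d d1 d2 (T : measurableType d) (S : measurableType d1)
    (W : measurableType d2) (R : realType) (P : probability T R)
    (U : T -> S) (V : T -> W) (k : R.-pker S ~> W) :=
  forall B C, measurable B -> measurable C ->
    P (U @^-1` B `&` V @^-1` C) = (\int[P]_(o in U @^-1` B) k (U o) C)%E.

(* One-sided at the end points of [a, b]. *)
Definition derivative_on (R : realType) (f f' : R -> R) (a b : R) :=
  forall m, m \in `[a, b] ->
    (f x - f m) / (x - m) @[x --> within `[a, b]%classic m^'] --> f' m.

Section policy_learning.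
Context dX (X : measurableType dX) (R : realType).

(* An observation o = (x, a, y) is encoded as ((x, a), y); the actions 1 and -1
   are encoded as true and false. *)
Local Notation obs := (X * bool * R)%type.

Definition covariate (o : obs) : X := o.1.1.
Definition action (o : obs) : bool := o.1.2.
Definition reward (o : obs) : R := o.2.

Definition act (a : bool) : R := if a then 1 else -1.

Definition policy := {mfun X >-> bool}.

Implicit Types (P : probability obs R) (Pi : set policy) (pi : policy).

Definition policy_fun pi : obs -> R := fun o => act (pi (covariate o)).
Arguments policy_fun pi _ : clear implicits.

Definition L2dist P (f g : obs -> R) : \bar R :=
  'N[P]_2%:E[EFin \o (f \- g)%R]%E.

(* The L^2(P) closure of Pi; every element of the closure is a.s. equal to a
   {-1, 1}-valued function, hence represented by a policy. *)
Definition policy_closure P Pi : set policy :=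
  [set pi | forall e : R, 0 < e -> exists2 pi', Pi pi' &
     (L2dist P (policy_fun pi) (policy_fun pi') < e%:E)%E].

Variables (P : probability obs R).
(* conditional laws of A given X and of Y given (X, A) *)
Variables (pA : R.-pker X ~> bool) (pY : R.-pker (X * bool) ~> R).

(* P(A = a | X = x) *)
Definition propensity (a : bool) (x : X) : R := fine (pA x [set a]).

(* P(Y <= m | A = a, X = x) *)
Definition cond_cdf (m : R) (a : bool) (x : X) : R :=
  fine (pY (x, a) `]-oo, m]%classic).

Definition policy_cdf pi (m : R) : R :=
  \int[P]_o cond_cdf m (pi (covariate o)) (covariate o).

Definition median_value pi : R := inf [set m | 2^-1 <= policy_cdf pi m].

Definition regret Pi pi : R :=
  sup [set median_value pi' | pi' in Pi] - median_value pi.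

Definition influence (Fdot : policy -> R -> R) pi (o : obs) : R :=
  let v := median_value pi in
  let x := covariate o in
  let a := action o in
  - ((a == pi x)%:R / (propensity a x * Fdot pi v))
      * ((reward o <= v)%R%:R - cond_cdf v a x)
  - (cond_cdf v (pi x) x - 2^-1) / Fdot pi v.

End policy_learning.
Arguments covariate {dX X R}.
Arguments action {dX X R}.
Arguments reward {dX X R}.
Arguments policy_fun {dX X R} pi _.

(* Main.v *)
From HB Require Import structures.
From mathcomp Require Import all_boot all_order all_algebra.
From mathcomp Require Import all_classical all_reals all_analysis.
From mathcomp Require Import measurable_realfun zify ring lra.
Require Import Defs.

(* Almost surely, f_pi = - psi(pi, V(pi)) / F_pi'(V(pi)), where psi(pi, v) is
   assembled from products of pi with weights W_v(o), namely indicators of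
   y <= v and conditional distribution functions, which take values in [0, 1]
   and are nondecreasing in v. The key fact is that the empirical process of
   W_v * pi is asymptotically equicontinuous in pi, uniformly in v. Without the
   weights this is the Donsker property. To insert them, pass to random signs,
   write W_v as an average of indicators of W_v > k / n, whose supports form
   chains as v varies, and bound sign sums over chains of index sets by the
   inequalities of Levy and Hoffmann-Jorgensen.

   Hence Pi splits into finitely many cells within which the empirical process
   of psi(pi, v) hardly depends on pi, uniformly in v. With high probability the
   learned policy is nearly optimal, so it lies in a cell containing policies
   of value arbitrarily close to the supremum v*; compare it with such a policy.
   The difference of the two empirical processes is estimated at one fixed policy
   of the cell, where moving v within a short window below v* changes psi(pi, v)
   by little in L^2, as F_pi is Lipschitz there. *)

Set Implicit Arguments.
Unset Strict Implicit.
Unset Printing Implicit Defensive.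

Import Order.TTheory GRing.Theory Num.Theory numFieldNormedType.Exports.

Local Open Scope ring_scope.

(** * Sign sums over chains of index sets *)

(** The learned policy is evaluated at its own median, so policy and threshold are random together
    and a bound for all pi and v at once is required. A monotone weight meets a sample only in
    nested level sets, and over nested sets a reflection of signs bounds the maximum at the cost of
    a factor 2; this replaces entropy bounds for the weights. Suprema over Pi need not be
    measurable. Signs are therefore not random variables: they range over a finite set, their
    probabilities are cardinalities, one good sign vector is selected by averaging over finitely
    many measurable events, and symmetrization is carried out for that fixed vector. Symmetrization
    also asks for small second moments within a cell. Tightness of the limit yields cells that are
    not described by L^2 distance, so the moments are recovered from the sign sums themselves. The
    influence function carries the further factor 1 / F_pi'(V(pi)); it is bounded on Pi, so the
    cells can be cut once more to make it nearly constant on each. *)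

Section signs.
Variables (R : realType) (n : nat).
Local Notation sign := {ffun 'I_n -> bool}.
Local Notation fullI := (finset.setTfor 'I_n).
Implicit Types (s r : sign) (J K : {set 'I_n}) (b l : R)
  (ch : {set {set 'I_n}}) (g : 'I_n -> R) (G : set ('I_n -> R)).

Definition rsum s J g : R := \sum_(i in J) (-1) ^+ s i * g i.

Definition splice J s r : sign := [ffun i => if i \in J then s i else r i].

(** The signs outside [J] are reversed, those on [J] are kept, so that averaging the full sums of
    [s] and [flip J s] leaves the sum over [J]. *)
Definition flip J s : sign := splice J s [ffun i => ~~ s i].

Definition hit G l J s : bool := `[< exists2 g, G g & l < `|rsum s J g| >].

Definition hits G l (ch : {set {set 'I_n}}) : {set sign} :=
  [set s | [exists J in ch, hit G l J s]].

Lemma rsum_agree s r J g : {in J, s =1 r} -> rsum s J g = rsum r J g.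
Proof. by move=> sr; apply: eq_bigr => i iJ; rewrite sr. Qed.

Lemma hit_agree G l J s r : {in J, s =1 r} -> hit G l J s = hit G l J r.
Proof.
move=> sr; apply/asboolP/asboolP => -[g Gg]; exists g => //.
  by rewrite -(rsum_agree _ sr).
by rewrite (rsum_agree _ sr).
Qed.

Lemma rsum_flip s J g :
  rsum s J g = 2^-1 * (rsum s fullI g + rsum (flip J s) fullI g).
Proof.
rewrite /rsum -big_split /= big_distrr /= big_mkcond /=.
rewrite [RHS]big_mkcond; apply: eq_bigr => i _; rewrite !inE !ffunE.
case: ifP => iJ; first by field.
by case: (s i) => /=; rewrite ?expr0 ?expr1; field.
Qed.

Lemma hit_flip G l J s :
  hit G l J s -> hit G l fullI s || hit G l fullI (flip J s).
Proof.
move=> /asboolP[g Gg]; rewrite rsum_flip => lg.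
apply/orP; have [h|h] := ltP l `|rsum s fullI g|; [left|right];
  apply/asboolP; exists g => //.
rewrite ltNge; apply/negP => h2; move: lg; rewrite ltNge => /negP; apply.
rewrite normrM ger0_norm ?invr_ge0//.
have := ler_normD (rsum s fullI g) (rsum (flip J s) fullI g).
lra.
Qed.

Lemma flipK J : involutive (flip J).
Proof.
by move=> s; apply/ffunP => i; rewrite !ffunE; case: (i \in J) => //=; exact: negbK.
Qed.

Lemma flip_agree J s : {in J, flip J s =1 s}.
Proof. by move=> i iJ; rewrite ffunE iJ. Qed.

(* Levy's maximal inequality: reflecting the signs outside the smallest index
   set of the chain that is hit preserves that set. *)
Lemma card_hits_chain G l (ch : {set {set 'I_n}}) :
  {in ch &, forall J K, (J \subset K) || (K \subset J)} ->
  (#|hits G l ch| <= 2 * #|hits G l [set fullI]|)%N.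
Proof.
move=> chain.
pose Q s J := (J \in ch) && hit G l J s.
pose m s := odflt fullI
  [pick K | Q s K && [forall J, Q s J ==> (#|K| <= #|J|)%N]].
have mP s : s \in hits G l ch -> Q s (m s) /\ forall J, Q s J -> (#|m s| <= #|J|)%N.
  rewrite inE => /existsP[J QJ]; rewrite /m; case: pickP => [K /andP[QK /forallP Kmin]|no].
    by split=> // J' QJ'; exact: (implyP (Kmin J')).
  exfalso; case: (@arg_minnP _ J (Q s) (fun K => #|K|) QJ) => K QK Kmin.
  have := no K; rewrite QK /= => /negP; apply.
  by apply/forallP => J'; apply/implyP => /Kmin.
pose f s := flip (m s) s.
(* The signs on [m s] do not change, so [m s] is still hit. The smallest set hit after the flip lies
   inside it and was therefore hit before; equal cardinalities then force equality. *)
have fin s : s \in hits G l ch -> f s \in hits G l ch /\ m (f s) = m s.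
  move=> sh; have [/andP[msch hs] msmin] := mP _ sh.
  have Qf : Q (f s) (m s) by rewrite /Q msch (hit_agree G l (flip_agree s)).
  have fh : f s \in hits G l ch by rewrite inE; apply/existsP; exists (m s).
  split=> //; have [/andP[mfch hf] mfmin] := mP _ fh.
  have sub : m (f s) \subset m s.
    have /orP[//|sub] := chain _ _ mfch msch.
    have /eqP -> : m s == m (f s) by rewrite eqEcard sub mfmin.
    exact: subxx.
  apply/eqP; rewrite eqEcard sub msmin// /Q mfch.
  rewrite (hit_agree _ _ (r := f s)) //.
  by move=> i /(fintype.subsetP sub) im; rewrite flip_agree.
have finj : {in hits G l ch &, injective f}.
  move=> s r sh rh fsr; have := (fin _ sh).2; rewrite fsr (fin _ rh).2 => mrs.
  by rewrite -[s](flipK (m s)) -[r](flipK (m r)) mrs; congr flip; move: fsr; rewrite /f mrs.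
have sub : hits G l ch \subset
    hits G l [set fullI] :|: [set s in hits G l ch | f s \in hits G l [set fullI]].
  apply/fintype.subsetP => s sh; have [/andP[_ /hit_flip hh] _] := mP _ sh.
  rewrite !inE; case/orP: hh => hh; apply/orP; [left|right].
    by apply/existsP; exists fullI; rewrite inE eqxx.
  rewrite inE in sh; rewrite sh /=; apply/existsP; exists fullI.
  by rewrite inE eqxx.
apply: (leq_trans (subset_leq_card sub)); rewrite mul2n -addnn.
apply: (leq_trans (leq_card_setU _ _)); rewrite leq_add2l.
rewrite -(card_in_imset (f := f)).
  by apply: subset_leq_card; apply/fintype.subsetP => _ /imsetP[s + ->]; rewrite inE => /andP[].
by move=> s r; rewrite !inE => /andP[sh _] /andP[rh _]; apply: finj; rewrite inE.
Qed.

(** Independence of events that depend on complementary coordinates, in counting form: exchanging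
    the coordinates of two sign vectors outside [J] embeds pairs with first entry in both events
    into pairs with one entry in each. *)
Lemma card_splice (A B : {set sign}) J :
  (forall s r, {in J, s =1 r} -> s \in A -> r \in A) ->
  (forall s r, {in ~: J, s =1 r} -> s \in B -> r \in B) ->
  (#|A :&: B| * 2 ^ n <= #|A| * #|B|)%N.
Proof.
move=> hA hB.
have <- : #|[set: sign]| = (2 ^ n)%N by rewrite cardsT card_ffun card_bool card_ord.
rewrite -!cardsX.
pose f (z : sign * sign) := (splice J z.1 z.2, splice J z.2 z.1).
rewrite -(card_imset _ (f := f)).
  apply: subset_leq_card; apply/fintype.subsetP => _ /imsetP[[s r] + ->].
  rewrite !inE /= andbT => /andP[sA sB]; apply/andP; split.
    by apply: hA sA => i iJ; rewrite ffunE iJ.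
  by apply: hB sB => i; rewrite inE => /negbTE iJ; rewrite ffunE iJ.
move=> [s r] [s' r'] [/ffunP e1 /ffunP e2].
by congr pair; apply/ffunP => i; move: (e1 i) (e2 i); rewrite !ffunE; case: ifP.
Qed.

(* Hoffmann-Jorgensen's inequality. *)
Lemma card_hits3 G b l : 0 <= b <= l ->
  (forall g, G g -> forall i, `|g i| <= b) ->
  (#|hits G (3 * l) [set fullI]| * 2 ^ n <= 4 * #|hits G l [set fullI]| ^ 2)%N.
Proof.
move=> /andP[b0 bl] Gb.
pose J (k : 'I_n.+1) : {set 'I_n} := [set i : 'I_n | (i < k)%N].
(* [A k] says that [k] is the first time at which an initial segment is hit; [B k] depends only on
   the remaining signs. *)
pose A k : {set sign} := [set s | hit G l (J k) s & [forall j : 'I_n.+1, (j < k)%N ==> ~~ hit G l (J j) s]].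
pose B k : {set sign} := hits G l [set ~: J k].
have JK (k j : 'I_n.+1) : (k <= j)%N -> J k \subset J j.
  by move=> kj; apply/fintype.subsetP => i; rewrite !inE => /leq_trans; exact.
have sub : hits G (3 * l) [set fullI] \subset \bigcup_k (A k :&: B k).
  apply/fintype.subsetP => s; rewrite inE => /existsP[_ /andP[/set1P -> /asboolP[g Gg lg]]].
  have l0 : 0 <= l by exact: le_trans bl.
  have JT : J ord_max = fullI by apply/setP => i; rewrite !inE ltn_ord.
  have hT : hit G l (J ord_max) s.
    by rewrite JT; apply/asboolP; exists g => //; apply: le_lt_trans lg; lra.
  case: (@arg_minnP _ ord_max (fun k => hit G l (J k) s) (fun k : 'I_n.+1 => nat_of_ord k) hT) => k hk kmin.
  have k0 : (0 < k)%N.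
    rewrite lt0n; apply/negP => /eqP k0; move: hk => /asboolP[g' _].
    rewrite /rsum big1 ?normr0; first by rewrite ltNge l0.
    by move=> i; rewrite inE k0.
  have km : forall j : 'I_n.+1, (j < k)%N -> ~~ hit G l (J j) s.
    by move=> j jk; apply/negP => /kmin; rewrite leqNgt jk.
  apply/bigcupP; exists k => //; rewrite !inE hk /=; apply/andP; split.
    by apply/forallP => j; apply/implyP/km.
  apply/existsP; exists (~: J k); rewrite inE eqxx /=; apply/asboolP; exists g => //.
  have kn : (k.-1 < n)%N by have := ltn_ord k; lia.
  pose i0 := Ordinal kn; pose j := inord k.-1 : 'I_n.+1.
  have jE : j = k.-1 :> nat by rewrite inordK//; have := ltn_ord k; lia.
  (* Before time [k] the partial sum is at most [l], and the term that completes the segment is at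
     most [b <= l]; of a total above [3 * l], more than [l] is left for the tail. *)
  have eT : rsum s fullI g = rsum s (J j) g + (-1) ^+ s i0 * g i0 + rsum s (~: J k) g.
    have Jk : J k = i0 |: J j by apply/setP => i; rewrite !inE jE -val_eqE /=; lia.
    rewrite /rsum (bigID (fun i => i \in J k)) /=; congr (_ + _); last first.
      by apply: eq_bigl => i; rewrite !inE.
    have -> : \sum_(i in fullI | i \in J k) (-1) ^+ s i * g i = \sum_(i in J k) (-1) ^+ s i * g i.
      by apply: eq_bigl => i; rewrite !inE.
    by rewrite Jk big_setU1 ?inE ?jE ?ltnn//= addrC.
  have hj : `|rsum s (J j) g| <= l.
    rewrite leNgt; apply/negP => h; have /km/negP : (j < k)%N by rewrite jE; lia.
    by apply; apply/asboolP; exists g.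
  have hi : `|(-1) ^+ s i0 * g i0| <= l.
    by rewrite normrMsign; apply: le_trans bl; exact: Gb.
  rewrite ltNge; apply/negP => hB; move: lg; rewrite eT ltNge => /negP; apply.
  have := ler_normD (rsum s (J j) g + (-1) ^+ s i0 * g i0) (rsum s (~: J k) g).
  have := ler_normD (rsum s (J j) g) ((-1) ^+ s i0 * g i0).
  lra.
have cB k : (#|B k| <= 2 * #|hits G l [set fullI]|)%N.
  by apply: card_hits_chain => K L /set1P -> /set1P ->; rewrite subxx.
have cAB k : (#|A k :&: B k| * 2 ^ n <= #|A k| * #|B k|)%N.
  apply: (card_splice (J := J k)) => s r sr; rewrite !inE.
    move=> /andP[hs /forallP ns]; apply/andP; split.
      by rewrite -(hit_agree _ _ sr).
    apply/forallP => j; apply/implyP => jk.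
    rewrite -(hit_agree _ _ (s := s)); first by apply: (implyP (ns j)).
    by move=> i /(fintype.subsetP (JK _ _ (ltnW jk))); exact: sr.
  move=> /existsP[K /andP[/set1P -> hs]]; apply/existsP; exists (~: J k).
  by rewrite inE eqxx /= -(hit_agree _ _ sr).
have cA : (\sum_k #|A k| <= 2 * #|hits G l [set fullI]|)%N.
  have chain : {in [set J k | k in 'I_n.+1] &, forall J K, (J \subset K) || (K \subset J)}.
    move=> _ _ /imsetP[j _ ->] /imsetP[k _ ->].
    by case/orP: (leq_total j k) => h; apply/orP; [left|right]; exact: JK.
  apply: (leq_trans _ (card_hits_chain G l chain)).
  have -> : (\sum_k #|A k|)%N = (\sum_k \sum_(s in hits G l [set J k | k in 'I_n.+1]) (s \in A k))%N.
    apply: eq_bigr => k _; rewrite -sum1_card [RHS]big_mkcond [LHS]big_mkcond /=.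
    apply: eq_bigr => s _; case: ifPn => sA; case: ifPn => // sh; exfalso.
    move: sA; rewrite inE => /andP[hs _]; move/negP: sh; apply.
    rewrite inE; apply/existsP; exists (J k); rewrite hs andbT.
    by apply/imsetP; exists k.
  rewrite exchange_big /= -sum1_card; apply: leq_sum => s _.
  have [[k sk]|no] := pselect (exists k, s \in A k).
    rewrite (bigD1 k)//= sk big1 ?addn0// => j jk.
    apply/eqP; rewrite eqb0; apply/negP => sj; move: sk sj; rewrite !inE.
    move=> /andP[hk /forallP nk] /andP[hj /forallP nj].
    move: jk; rewrite neq_ltn => /orP[jk|kj].
      by have := implyP (nk j) jk; rewrite hj.
    by have := implyP (nj k) kj; rewrite hk.
  rewrite big1// => k _; apply/eqP; rewrite eqb0; apply/negP => sk; apply: no; by exists k.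
apply: (@leq_trans (\sum_k (#|A k :&: B k| * 2 ^ n))%N).
  rewrite -big_distrl leq_mul2r; apply/orP; right.
  apply: (leq_trans (subset_leq_card sub)).
  elim/big_rec2: _ => [|k m C _ IH]; first by rewrite cards0.
  exact: leq_trans (leq_card_setU _ _) (leq_add (leqnn _) IH).
apply: (@leq_trans (\sum_k (#|A k| * (2 * #|hits G l [set fullI]|)))%N).
  by apply: leq_sum => k _; apply: (leq_trans (cAB k)); rewrite leq_mul2l cB orbT.
rewrite -big_distrl /=; apply: (leq_trans (leq_mul cA (leqnn _))).
by rewrite -mulnn mulnACA.
Qed.

(* The weights 8 * 9 ^ j sum to 9 ^ m - 1, so that a sum of size y between
   3 ^ (m - 1) * l and 3 ^ m * l is charged 9 ^ m, which dominates both y / l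
   and (y / l) ^ 2; by Hoffmann-Jorgensen's inequality the total charge stays
   proportional to the number of signs. *)
Definition weight G l ch s : nat :=
  (1 + \sum_(j < n) 8 * 9 ^ j * (s \in hits G (3 ^+ j * l)%R ch))%N.

(** A crude bound from n < 3 ^ n; it is the reason why [n] levels suffice in [weight]. *)
Lemma rsum_bound G b l J s g : 0 <= b <= l ->
  (forall g, G g -> forall i, `|g i| <= b) -> G g ->
  `|rsum s J g| <= 3 ^+ n * l.
Proof.
move=> /andP[b0 bl] Gb Gg.
apply: (le_trans (ler_norm_sum _ _ _)).
apply: (@le_trans _ _ (\sum_(i in J) l)).
  by apply: ler_sum => i _; rewrite normrMsign (le_trans _ bl)// Gb.
rewrite sumr_const -[l *+ _]mulr_natl ler_wpM2r ?(le_trans b0)//.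
rewrite -natrX ler_nat; apply: (leq_trans (max_card _)); rewrite card_ord.
by apply/ltnW/ltn_expl.
Qed.

Lemma level_sum (y l : R) m : 0 <= l -> 0 <= y <= 3 ^+ m * l ->
  y <= l * (1 + \sum_(j < m) 8 * 9 ^ j * (3 ^+ j * l < y)%R)%N%:R /\
  y ^+ 2 <= l ^+ 2 * (1 + \sum_(j < m) 8 * 9 ^ j * (3 ^+ j * l < y)%R)%N%:R.
Proof.
move=> l0; elim: m => [|m IH] /andP[y0 ym].
  rewrite big_ord0 addn0 mulr1 mulr1; rewrite expr0 mul1r in ym; split=> //.
  by rewrite ler_sqr.
have [h|h] := leP y (3 ^+ m * l).
  rewrite big_ord_recr /=; case: ltP => [h'|_]; first by have := lt_le_trans h' h; rewrite ltxx.
  by rewrite muln0 addn0; apply: IH; rewrite y0.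
have -> : (1 + \sum_(j < m.+1) 8 * 9 ^ j * (3 ^+ j * l < y)%R)%N = (9 ^ m.+1)%N.
  have -> : (\sum_(j < m.+1) 8 * 9 ^ j * (3 ^+ j * l < y)%R)%N = (\sum_(j < m.+1) 8 * 9 ^ j)%N.
    apply: eq_bigr => j _; suff -> : 3 ^+ j * l < y by rewrite muln1.
    apply: le_lt_trans h; rewrite ler_wpM2r// ler_weXn2l ?ler1n// -ltnS; exact: ltn_ord.
  rewrite -big_distrr /=; elim: (m.+1) => [|k IHk]; first by rewrite big_ord0.
  by rewrite big_ord_recr /= expnS; lia.
have e : (9 ^ m.+1)%N%:R = (3 ^+ m.+1) ^+ 2 :> R.
  by rewrite natrX exprAC; congr (_ ^+ _); rewrite -natrX.
split.
  apply: (le_trans ym); rewrite e mulrC ler_wpM2l// expr2 ler_peMr ?exprn_ge0//.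
  by apply: exprn_ege1; rewrite ler1n.
by rewrite e -exprMn ler_sqr ?nnegrE ?mulr_ge0 ?exprn_ge0// mulrC.
Qed.

Lemma weight_bound G b l ch J s g : 0 <= b <= l ->
  (forall g, G g -> forall i, `|g i| <= b) -> G g -> J \in ch ->
  `|rsum s J g| <= l * (weight G l ch s)%:R /\
  rsum s J g ^+ 2 <= l ^+ 2 * (weight G l ch s)%:R.
Proof.
move=> bl Gb Gg Jch; have /andP[b0 bl'] := bl; have l0 := le_trans b0 bl'.
have [|h1 h2] := @level_sum `|rsum s J g| l n l0.
  by rewrite normr_ge0; apply: rsum_bound bl Gb Gg.
have h : (1 + \sum_(j < n) 8 * 9 ^ j * (3 ^+ j * l < `|rsum s J g|)%R <= weight G l ch s)%N.
  rewrite leq_add2l; apply: leq_sum => j _; rewrite leq_mul2l; apply/orP; right.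
  case: (ltP _ `|_|) => [h|//]; rewrite inE lt0b; apply/existsP; exists J.
  by rewrite Jch; apply/asboolP; exists g.
move: h; rewrite -(ler_nat R) => h; split.
  by apply: (le_trans h1); rewrite ler_wpM2l.
rewrite -real_normK ?num_real//; apply: (le_trans h2); rewrite ler_wpM2l//.
exact: exprn_ge0.
Qed.

Lemma sum_weight G b l ch : 0 <= b <= l ->
  (forall g, G g -> forall i, `|g i| <= b) ->
  (64 * #|hits G l [set fullI]| <= 2 ^ n)%N ->
  {in ch &, forall J K, (J \subset K) || (K \subset J)} ->
  (\sum_s weight G l ch s <= 2 * 2 ^ n)%N.
Proof.
move=> bl Gb h0 chain; have /andP[b0 bl'] := bl; have l0 := le_trans b0 bl'.
(* From a frequency p <= 1/64, Hoffmann-Jorgensen's inequality gives 4 p ^ 2 <= p / 16 at the next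
   level. The decay by 16 outweighs the growth by 9 of the charges. *)
have hj j : (64 * 16 ^ j * #|hits G (3 ^+ j * l)%R [set fullI]| <= 2 ^ n)%N.
  elim: j => [|j IH]; first by rewrite expn0 muln1 expr0 mul1r.
  rewrite exprS -mulrA.
  have bj : 0 <= b <= 3 ^+ j * l.
    by rewrite b0 (le_trans bl')// ler_peMl// exprn_ege1// ler1n.
  have := card_hits3 bj Gb.
  set c := #|_| in IH *; set c' := #|_|; set N := (2 ^ n)%N in IH *.
  move=> h; have N0 : (0 < N)%N by rewrite expn_gt0.
  rewrite -(leq_pmul2r N0) expnS.
  set t := (16 ^ j)%N in IH *; have t0 : (0 < t)%N by rewrite expn_gt0.
  have IH2 : (64 * c <= N)%N by apply: leq_trans IH; rewrite -mulnA; nia.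
  have : (64 * (16 * t) * (c' * N) <= 64 * (16 * t) * (4 * c ^ 2))%N by rewrite leq_mul2l h orbT.
  have : ((64 * t * c) * (64 * c) <= N * N)%N by exact: leq_mul.
  by rewrite expnS expn1; lia.
rewrite /weight big_split /= sum1_card card_ffun card_bool card_ord mul2n -addnn leq_add2l.
rewrite exchange_big /=.
have hb j : (\sum_s 8 * 9 ^ j * (s \in hits G (3 ^+ j * l)%R ch) = 8 * 9 ^ j * #|hits G (3 ^+ j * l)%R ch|)%N.
  by rewrite -big_distrr /= -sum1_card [in RHS]big_mkcond /=; congr muln; apply: eq_bigr => s _; case: (_ \in _).
rewrite (eq_bigr _ (fun j _ => hb (nat_of_ord j))).
have key j : (4 * 16 ^ j * (8 * 9 ^ j * #|hits G (3 ^+ j * l)%R ch|) <= 9 ^ j * 2 ^ n)%N.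
  have := card_hits_chain G (3 ^+ j * l) chain; have := hj j.
  set c := #|_|; set c' := #|hits _ _ ch|; set t := (16 ^ j)%N; set w := (9 ^ j)%N => h1 h2.
  have : (w * (64 * t * c) <= w * 2 ^ n)%N by rewrite leq_mul2l h1 orbT.
  have : (32 * t * w * c' <= 32 * t * w * (2 * c))%N by rewrite leq_mul2l h2 orbT.
  lia.
(* After division, the partial sums of the geometric series with first term 1/4 and ratio 9/16; its
   total 4/7 is below 1. *)
suff : forall m, (7 * 16 ^ m * \sum_(j < m) 8 * 9 ^ j * #|hits G (3 ^+ j * l)%R ch| + 4 * 9 ^ m * 2 ^ n <= 4 * 16 ^ m * 2 ^ n)%N.
  move=> /(_ n) h; have u0 : (0 < 16 ^ n)%N by rewrite expn_gt0.
  rewrite -(leq_pmul2l u0); move: h.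
  set a := (\sum_(_ < _) _)%N; set u := (16 ^ n)%N; set N := (2 ^ n)%N; lia.
elim=> [|m IH]; first by rewrite big_ord0 muln0 add0n.
rewrite big_ord_recr /= !expnS; have := key m; move: IH.
set a := (\sum_(_ < _) _)%N; set x := (8 * _ * _)%N; set u := (16 ^ m)%N; set w := (9 ^ m)%N.
set N := (2 ^ n)%N.
nia.
Qed.

End signs.

Local Open Scope classical_set_scope.
Local Open Scope ring_scope.

(** * Outer probability and i.i.d. samples *)

Section small.
Context d (T : measurableType d) (R : realType) (mu : probability T R).
Implicit Types (E F : set T) (q : R).

(** Outer probability at most [q], witnessed by a measurable cover: the events below are unions over
    uncountably many policies and thresholds. *)
Definition small E q := exists D, [/\ measurable D, E `<=` D & (mu D <= q%:E)%E].

Lemma small_sub E F q : E `<=` F -> small F q -> small E q.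
Proof. by move=> EF [D [mD FD muD]]; exists D; split=> //; apply: subset_trans FD. Qed.

Lemma small_le E q r : q <= r -> small E q -> small E r.
Proof. by move=> qr [D [mD ED muD]]; exists D; split=> //; apply: (le_trans muD); rewrite lee_fin. Qed.

Lemma small0 q : 0 <= q -> small set0 q.
Proof. by move=> q0; exists set0; split=> //; rewrite measure0 lee_fin. Qed.

Lemma smallU E F q r : small E q -> small F r -> small (E `|` F) (q + r).
Proof.
move=> [A [mA EA muA]] [B [mB FB muB]]; exists (A `|` B); split.
- exact: measurableU.
- exact: setUSS.
- by apply: (le_trans (measureU2 _ mA mB)); rewrite EFinD leeD.
Qed.

Lemma small_bigU (I : finType) (E : I -> set T) (q : I -> R) :
  (forall i, small (E i) (q i)) -> small [set x | exists i, E i x] (\sum_i q i).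
Proof.
move=> sE; have : small (\big[setU/set0]_(i : I) E i) (\sum_i q i).
  elim/big_rec2: _ => [|i r F _ IH]; first exact: small0.
  exact: smallU.
by apply: small_sub => x [i Eix]; rewrite -bigcup_seq; exists i => //=; rewrite mem_index_enum.
Qed.

Lemma small_outer E q : (mu^*%mu E < q%:E)%E -> small E q.
Proof.
move=> /ereal_inf_lt[_ [A [mA EA] <-] Aq].
exists (\bigcup_k A k); split => //; first by apply: bigcupT_measurable.
apply: (le_trans _ (ltW Aq)); apply: measure_sigma_subadditive => //.
by apply: bigcupT_measurable.
Qed.

Lemma outer_small E q : small E q -> (mu^*%mu E <= q%:E)%E.
Proof.
move=> [D [mD ED muD]]; apply: le_trans muD.
apply: (le_trans (le_mu_ext mu ED)).
by rewrite measurable_mu_extE.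
Qed.

End small.

(** Bounded measurable functions form an algebra on which all integrals under a probability exist,
    so linearity and Fubini carry no integrability conditions. *)
Definition bm d (T : measurableType d) (R : realType) (f : T -> R) :=
  measurable_fun setT f /\ exists M, forall x, `|f x| <= M.

Section bounded_measurable.
Context d (T : measurableType d) (R : realType).
Implicit Types f g : T -> R.

Lemma bm_cst (r : R) : bm (fun _ : T => r).
Proof. by split; [exact: measurable_cst|exists `|r|]. Qed.

Lemma bmD f g : bm f -> bm g -> bm (fun x => f x + g x).
Proof.
move=> [mf [M fM]] [mg [N gN]]; split; first exact: measurable_funD.
by exists (M + N) => x; apply: (le_trans (ler_normD _ _)); exact: lerD.
Qed.

Lemma bmM f g : bm f -> bm g -> bm (fun x => f x * g x).
Proof.
move=> [mf [M fM]] [mg [N gN]]; split; first exact: measurable_funM.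
by exists (M * N) => x; rewrite normrM ler_pM.
Qed.

Lemma bmN f : bm f -> bm (fun x => - f x).
Proof.
move=> [mf [M fM]]; split; first exact: measurableT_comp.
by exists M => x; rewrite normrN.
Qed.

Lemma bmB f g : bm f -> bm g -> bm (fun x => f x - g x).
Proof. by move=> bf bg; apply: bmD => //; exact: bmN. Qed.

Lemma bm_sum (I : finType) (f : I -> T -> R) : (forall i, bm (f i)) -> bm (fun x => \sum_i f i x).
Proof.
move=> bf; have h : forall s : seq I, bm (fun x => \sum_(i <- s) f i x); last exact: h.
elim=> [|i s IH].
  by rewrite (_ : (fun x => _) = fun=> 0); [exact: bm_cst|apply/funext => x; rewrite big_nil].
rewrite (_ : (fun x => _) = fun x => f i x + \sum_(j <- s) f j x); first exact: bmD.
by apply/funext => x; rewrite big_cons.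
Qed.

Lemma bm_comp d' (U : measurableType d') (h : U -> T) f :
  measurable_fun setT h -> bm f -> bm (fun u => f (h u)).
Proof.
move=> mh [mf [M fM]]; split; first exact: (measurableT_comp mf mh).
by exists M => x.
Qed.

Variable mu : probability T R.

Lemma bm_integrable f : bm f -> mu.-integrable setT (EFin \o f).
Proof.
move=> [mf [M fM]]; apply: measurable_bounded_integrable => //.
  by rewrite ltey_eq fin_num_measure.
exists M; split; first by rewrite num_real.
by move=> x Mx y _; apply: le_trans (fM y) (ltW Mx).
Qed.

Lemma bm_integralD f g : bm f -> bm g ->
  \int[mu]_x (f x + g x) = \int[mu]_x f x + \int[mu]_x g x.
Proof. by move=> bf bg; apply: RintegralD => //; exact: bm_integrable. Qed.

Lemma bm_integralZ r f : bm f -> \int[mu]_x (r * f x) = r * \int[mu]_x f x.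
Proof. by move=> bf; apply: RintegralZl => //; exact: bm_integrable. Qed.

Lemma bm_integral_cst r : \int[mu]_x r = r.
Proof. by rewrite Rintegral_cst//= probability_setT /= mulr1. Qed.

Lemma bm_integralB f g : bm f -> bm g ->
  \int[mu]_x (f x - g x) = \int[mu]_x f x - \int[mu]_x g x.
Proof. by move=> bf bg; apply: RintegralB => //; exact: bm_integrable. Qed.

Lemma bm_integral_sum (I : finType) (f : I -> T -> R) : (forall i, bm (f i)) ->
  \int[mu]_x (\sum_i f i x) = \sum_i \int[mu]_x f i x.
Proof.
move=> bf.
have h : forall s : seq I, bm (fun x => \sum_(i <- s) f i x) /\ \int[mu]_x (\sum_(i <- s) f i x) = \sum_(i <- s) \int[mu]_x f i x; last exact: (h _).2.
elim=> [|i s [b IH]].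
  split; first by rewrite (_ : (fun x => _) = fun=> 0); [exact: bm_cst|apply/funext => x; rewrite big_nil].
  by under eq_Rintegral do rewrite big_nil; rewrite bm_integral_cst big_nil.
split.
  rewrite (_ : (fun x => _) = fun x => f i x + \sum_(j <- s) f j x); first exact: bmD.
  by apply/funext => x; rewrite big_cons.
under eq_Rintegral do rewrite big_cons.
by rewrite bm_integralD// big_cons IH.
Qed.

Lemma bm_integral_le f g : bm f -> bm g -> (forall x, f x <= g x) ->
  \int[mu]_x f x <= \int[mu]_x g x.
Proof. by move=> bf bg fg; apply: le_Rintegral => //; exact: bm_integrable. Qed.

Lemma bm_integral_indic (A : set T) : measurable A -> \int[mu]_x (\1_A x : R) = fine (mu A).
Proof. by move=> mA; rewrite /Rintegral integral_indic// setIT. Qed.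

Lemma bm_indic (A : set T) : measurable A -> bm (\1_A : T -> R).
Proof.
move=> mA; split; first exact: measurable_indic.
by exists 1 => x; rewrite indicE; case: (_ \in _); rewrite ?normr1 ?normr0 ?ler01.
Qed.

Lemma bm_markov f (r : R) : bm f -> (forall x, 0 <= f x) -> 0 < r ->
  (mu [set x | (r < f x)%R] <= (\int[mu]_x f x / r)%:E)%E.
Proof.
move=> bf f0 r0.
have mA : measurable [set x | r < f x].
  rewrite -[X in measurable X]setTI; have := bf.1 measurableT `]r, +oo[%classic (measurable_itv _).
  by rewrite set_itvE.
have -> : mu [set x | r < f x] = (fine (mu [set x | r < f x]))%:E.
  by rewrite fineK// fin_num_measure.
rewrite lee_fin ler_pdivlMr// mulrC -bm_integral_indic//.
rewrite -(bm_integralZ r (bm_indic mA)).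
apply: bm_integral_le => //; first by apply: bmM; [exact: bm_cst|exact: bm_indic].
move=> x; rewrite indicE; case: (boolP (x \in _)) => /=; rewrite ?mulr1 ?mulr0//.
by rewrite inE /= => /ltW.
Qed.

End bounded_measurable.

Section transfer.
Context d1 d2 (T1 : measurableType d1) (T2 : measurableType d2) (R : realType).
Context (m1 : probability T1 R) (m2 : probability T2 R).

Lemma bm_integral_push (h : T1 -> T2) (f : T2 -> R) : measurable_fun setT h ->
  (forall A, measurable A -> m1 (h @^-1` A) = m2 A) -> bm f ->
  \int[m1]_x f (h x) = \int[m2]_y f y.
Proof.
move=> mh hA bf; pose h' : {mfun T1 >-> T2} := HB.pack h (isMeasurableFun.Build _ _ _ _ h mh).
rewrite /Rintegral; congr fine.
rewrite [RHS](eq_measure_integral (distribution m1 h')); last by move=> A mA _; apply/esym; exact: hA.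
rewrite integral_distribution//; first by apply/measurable_EFinP; case: bf.
by apply: bm_integrable; exact: bm_comp.
Qed.

Lemma bm_Fubini (f : T1 * T2 -> R) : bm f ->
  [/\ forall x, bm (fun y => f (x, y)), bm (fun x => \int[m2]_y f (x, y)) &
  \int[(m1 \x m2)%E]_z f z = \int[m1]_x \int[m2]_y f (x, y)].
Proof.
move=> bf; have [mf [M fM]] := bf.
have imf : (m1 \x m2)%E.-integrable setT (EFin \o f) by exact: bm_integrable.
have bx x : bm (fun y => f (x, y)).
  by split; [exact: measurable_fun_pair2|exists M].
split=> //.
  split; last first.
    exists M => x; apply: (le_trans (le_normr_Rintegral _ _)) => //.
      exact: bm_integrable.
    rewrite -[leRHS](bm_integral_cst m2); apply: bm_integral_le => //; last exact: bm_cst.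
    split; last by exists M => y; rewrite normr_id.
    by apply: measurableT_comp => //; exact: (bx x).1.
  apply: (measurableT_comp (fine_measurable measurableT)).
  exact: measurable_fubini_F imf.
rewrite [LHS]/Rintegral -integral12_prod_meas1//.
rewrite [RHS]/Rintegral; congr fine; apply: eq_integral => x _.
rewrite /fubini_F /Rintegral fineK//.
by apply: integrable_fin_num => //; exact: bm_integrable.
Qed.

End transfer.

Section counting.
Context d (T : measurableType d) (R : realType) (mu : probability T R).
Variables (I : finType) (D : I -> set T).
Hypothesis mD : forall i, measurable (D i).

Lemma count_integral : \int[mu]_x (\sum_i \1_(D i) x : R) = \sum_i fine (mu (D i)).
Proof.
rewrite bm_integral_sum; last by move=> i; exact: bm_indic.
by apply: eq_bigr => i _; exact: bm_integral_indic.
Qed.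

Lemma count_le (c : R) : (forall x, \sum_i \1_(D i) x <= c) ->
  \sum_i fine (mu (D i)) <= c.
Proof.
move=> Dc; rewrite -count_integral -[leRHS](bm_integral_cst mu).
apply: bm_integral_le => //; last exact: bm_cst.
by apply: bm_sum => i; exact: bm_indic.
Qed.

Lemma count_markov (c : R) : 0 < c ->
  small mu [set x | c < \sum_i \1_(D i) x] (\sum_i fine (mu (D i)) / c).
Proof.
move=> c0; have bD : bm (fun x => \sum_i \1_(D i) x : R).
  by apply: bm_sum => i; exact: bm_indic.
exists [set x | c < \sum_i \1_(D i) x]; split=> //.
  rewrite -[X in measurable X]setTI; have := bD.1 measurableT `]c, +oo[%classic (measurable_itv _).
  by rewrite set_itvE.
rewrite -big_distrl -count_integral; apply: bm_markov => // x.
by apply: sumr_ge0 => i _.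
Qed.

Lemma count_min (i0 : I) (c : R) : \sum_i fine (mu (D i)) <= #|I|%:R * c ->
  exists i, fine (mu (D i)) <= c.
Proof.
move=> h; apply/not_existsP => no; move: h; rewrite leNgt => /negP; apply.
rewrite mulr_natl -sumr_const big_mkcond; apply: ltr_sum.
  by apply/hasP; exists i0.
by move=> i _; rewrite ltNge; apply/negP; exact: no.
Qed.

End counting.

Section iid.
Context d (T : measurableType d) (R : realType) (P : probability T R).

(** Rectangles generate the sigma-algebra and are stable under intersection, so a law that agrees
    with the product law on them equals it. This covers exchanges between two samples and the
    selection of a subsample. *)
Lemma iid_push d' (U : measurableType d') (Q : probability U R) n
    (h : U -> n.-tuple T) : measurable_fun setT h ->
  (forall A : 'I_n -> set T, (forall i, measurable (A i)) ->
     Q (h @^-1` [set s | forall i, A i (tnth s i)]) = (\prod_(i < n) P (A i))%E) ->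
  forall D, measurable D -> Q (h @^-1` D) = iid_law P n D.
Proof.
move=> mh hA.
pose h' : {mfun U >-> n.-tuple T} := HB.pack h (isMeasurableFun.Build _ _ _ _ h mh).
pose G := [set [set s : n.-tuple T | forall i, A i (tnth s i)] | A in
   [set A : 'I_n -> set T | forall i, measurable (A i)]].
have GT : G setT by exists (fun=> setT) => //; apply/seteqP; split.
have mG : G `<=` measurable.
  move=> _ [A mA <-].
  have -> : [set s : n.-tuple T | forall i, A i (tnth s i)] =
      \bigcap_(i in [set: 'I_n]) ((fun s => tnth s i) @^-1` A i).
    by apply/seteqP; split=> s /= As i => [_|]; exact: As.
  apply: fin_bigcap_measurable; first exact: finite_finset.
  by move=> i _; rewrite -[X in measurable X]setTI; exact: measurable_tnth.
move=> D mD.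
have -> : Q (h @^-1` D) = distribution Q h' D by [].
apply: (@measure_unique _ R _ G (fun=> setT)) => //.
- apply/seteqP; split; last first.
    by apply: smallest_sub mG; exact: sigma_algebra_measurable.
  apply: sub_smallest2r; last first.
    move=> A; rewrite -bigcup_seq => -[i _] [B mB <-]; rewrite setTI.
    exists (fun j => if j == i then B else setT).
      by move=> j; case: ifP.
    apply/seteqP; split=> s /=; first by move/(_ i); rewrite eqxx.
    by move=> Bs j; case: eqP => // ->.
  exact: smallest_sigma_algebra.
- move=> _ _ [A mA <-] [B mB <-]; exists (fun i => A i `&` B i).
    by move=> i; exact: measurableI.
  apply/seteqP; split=> s /=.
    by move=> h1; split=> i; case: (h1 i).
  by move=> [h1 h2] i; split.
- by apply/seteqP; split=> // x _; exists 0%N.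
- by move=> _ [A mA <-]; rewrite [RHS](iid_lawE P mA); exact: hA.
- by move=> k; rewrite ltey_eq fin_num_measure.
Qed.

Lemma iid_law_tnth n (i : 'I_n) A : measurable A ->
  iid_law P n ((fun s => tnth s i) @^-1` A) = P A.
Proof.
move=> mA; pose B j := if j == i then A else setT.
have -> : (fun s : n.-tuple T => tnth s i) @^-1` A = [set s | forall j, B j (tnth s j)].
  apply/seteqP; split=> s /=; rewrite /B; last by move/(_ i); rewrite eqxx.
  by move=> As j; case: eqP => // ->.
rewrite iid_lawE; last by move=> j; rewrite /B; case: ifP.
rewrite (bigD1 i)//= big1 ?mule1 /B ?eqxx// => j /negbTE ->.
exact: probability_setT.
Qed.

Lemma iid_integral_tnth n (i : 'I_n) (f : T -> R) : bm f ->
  \int[iid_law P n]_s f (tnth s i) = \int[P]_x f x.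
Proof.
move=> bf; apply: (bm_integral_push (h := fun s => tnth s i)) => //.
  exact: measurable_tnth.
by move=> A mA; exact: iid_law_tnth.
Qed.

Lemma bm_tnth n (i : 'I_n) (f : T -> R) : bm f -> bm (fun s : n.-tuple T => f (tnth s i)).
Proof. by apply: (@bm_comp _ _ _ _ _ (fun s => tnth s i)); exact: measurable_tnth. Qed.

Lemma iid_second_moment n (k : T -> R) : bm k -> \int[P]_x k x = 0 ->
  \int[iid_law P n]_s (\sum_(i < n) k (tnth s i)) ^+ 2 = n%:R * \int[P]_x (k x ^+ 2).
Proof.
move=> bk k0.
have bS m : bm (fun s : m.-tuple T => \sum_(i < m) k (tnth s i)).
  by apply: bm_sum => i; exact: bm_tnth.
have bS2 m : bm (fun s : m.-tuple T => (\sum_(i < m) k (tnth s i)) ^+ 2).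
  by under eq_fun do rewrite expr2; exact: bmM.
have bk2 : bm (fun x => k x ^+ 2) by under eq_fun do rewrite expr2; exact: bmM.
have S0 m : \int[iid_law P m]_s (\sum_(i < m) k (tnth s i)) = 0.
  rewrite bm_integral_sum; last by move=> i; exact: bm_tnth.
  by rewrite big1// => i _; rewrite iid_integral_tnth.
elim: n => [|n IH].
  rewrite mul0r; under eq_Rintegral do rewrite big_ord0 expr0n /=.
  exact: bm_integral_cst.
pose f (s : n.+1.-tuple T) := (\sum_(i < n.+1) k (tnth s i)) ^+ 2.
have mtc : measurable_fun setT (@tcons _ T n) by exact: measurable_funP.
have bF : bm (fun z => f (tcons z)) by exact: bm_comp (bS2 _).
transitivity (\int[(P \x iid_law P n)%E]_z f (tcons z)).
  apply: esym; rewrite (bm_integral_push (m2 := iid_law P n.+1) mtc _ (bS2 n.+1)) //.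
have [_ _ ->] := bm_Fubini P (iid_law P n) bF.
transitivity (\int[P]_x (k x ^+ 2 + n%:R * \int[P]_y (k y ^+ 2))); last first.
  by rewrite bm_integralD ?bm_integral_cst//; [rewrite -nat1r mulrDl mul1r|exact: bm_cst].
apply: eq_Rintegral => x _.
transitivity (\int[iid_law P n]_s (k x ^+ 2 + ((k x *+ 2) * (\sum_(i < n) k (tnth s i)) +
    (\sum_(i < n) k (tnth s i)) ^+ 2))).
  apply: eq_Rintegral => s _; rewrite /f big_ord_recl /=.
  rewrite tnth0 (eq_bigr (fun i => k (tnth s i))); last by move=> i _; rewrite tnthS.
  by set S := \sum_(i < n) _; rewrite sqrrD; ring.
have bZ : bm (fun s : n.-tuple T => k x *+ 2 * \sum_(i < n) k (tnth s i)).
  by apply: bmM => //; exact: bm_cst.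
rewrite bm_integralD; [|exact: bm_cst|exact: bmD bZ (bS2 n)].
rewrite (bm_integralD _ bZ (bS2 n)) (bm_integral_cst (iid_law P n) (k x ^+ 2)).
by rewrite (bm_integralZ _ _ (bS n)) S0 mulr0 add0r IH.
Qed.

Lemma iid_chebyshev n (k : T -> R) (r : R) : bm k -> \int[P]_x k x = 0 -> 0 < r ->
  small (iid_law P n) [set s | r < `|\sum_(i < n) k (tnth s i)|]
    (n%:R * \int[P]_x (k x ^+ 2) / r ^+ 2).
Proof.
move=> bk k0 r0.
have bS : bm (fun s : n.-tuple T => (\sum_(i < n) k (tnth s i)) ^+ 2).
  have bS : bm (fun s : n.-tuple T => \sum_(i < n) k (tnth s i)).
    by apply: bm_sum => i; exact: bm_tnth.
  by under eq_fun do rewrite expr2; exact: bmM.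
exists [set s | r ^+ 2 < (\sum_(i < n) k (tnth s i)) ^+ 2]; split.
- rewrite -[X in measurable X]setTI; have := bS.1 measurableT `]r ^+ 2, +oo[%classic (measurable_itv _).
  by rewrite set_itvE.
- by move=> s /= rs; rewrite -[ltRHS]real_normK ?num_real// ltr_pXn2r// nnegrE ltW.
- rewrite -iid_second_moment//; apply: bm_markov => //; first by move=> x; exact: sqr_ge0.
  exact: exprn_gt0.
Qed.

Lemma emp_processE n (s : n.-tuple T) (f : T -> R) :
  emp_process P s f =
  (Num.sqrt n%:R)^-1 * \sum_(i < n) (f (tnth s i) - \int[P]_x f x).
Proof.
case: n s => [|n] s; first by rewrite /emp_process sqrtr0 mul0r invr0 mul0r.
have sn0 : Num.sqrt n.+1%:R != 0 :> R by rewrite sqrtr_eq0 -ltNge.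
rewrite /emp_process big_split /= sumrN sumr_const card_ord.
set S := \sum_(i < n.+1) _; set I0 := Rintegral _ _ _; rewrite -(mulr_natl I0).
have := @sqr_sqrtr _ n.+1%:R (ler0n R _); move: sn0.
by move: (Num.sqrt n.+1%:R) => r r0 <-; field.
Qed.

Lemma emp_processD n (s : n.-tuple T) (f g : T -> R) : bm f -> bm g ->
  emp_process P s (fun x => f x + g x) = emp_process P s f + emp_process P s g.
Proof.
move=> bf bg; rewrite !emp_processE -mulrDr -big_split /=; congr (_ * _).
by apply: eq_bigr => i _; rewrite bm_integralD//; ring.
Qed.

Lemma emp_processZ n (s : n.-tuple T) (r : R) (f : T -> R) : bm f ->
  emp_process P s (fun x => r * f x) = r * emp_process P s f.
Proof.
move=> bf; rewrite !emp_processE mulrCA; congr (_ * _).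
by rewrite big_distrr; apply: eq_bigr => i _; rewrite bm_integralZ//= mulrBr.
Qed.

Lemma emp_processB n (s : n.-tuple T) (f g : T -> R) : bm f -> bm g ->
  emp_process P s (fun x => f x - g x) = emp_process P s f - emp_process P s g.
Proof.
move=> bf bg; rewrite -mulN1r -emp_processZ// -emp_processD//.
  by congr emp_process; apply/funext => x; rewrite mulN1r.
by apply: bmM => //; exact: bm_cst.
Qed.

Lemma emp_process_cst n (s : n.-tuple T) (r : R) : emp_process P s (fun=> r) = 0.
Proof.
rewrite emp_processE bm_integral_cst big1 ?mulr0// => i _; exact: subrr.
Qed.

End iid.

Lemma rsumT (R : realType) n (s : {ffun 'I_n -> bool}) (g : 'I_n -> R) :
  rsum s (finset.setTfor 'I_n) g = \sum_i (-1) ^+ s i * g i.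
Proof. by rewrite /rsum; apply: eq_bigl => i; rewrite finset.in_setT. Qed.

(** * Symmetrization and monotone weights *)

Section symmetrization.
Context d (T : measurableType d) (R : realType) (P : probability T R) (n : nat).
Local Notation sign := {ffun 'I_n -> bool}.

Definition swap (s : sign) (z : n.-tuple T * n.-tuple T) : n.-tuple T :=
  [tuple if s i then tnth z.2 i else tnth z.1 i | i < n].

Lemma measurable_swap s : measurable_fun setT (swap s).
Proof.
apply/measurable_fun_tnthP => i.
have -> : @tnth n T ^~ i \o swap s = fun z => if s i then tnth z.2 i else tnth z.1 i.
  by apply/funext => z /=; rewrite tnth_mktuple.
case: (s i); [apply: (measurableT_comp (measurable_tnth i)) measurable_snd|
  apply: (measurableT_comp (measurable_tnth i)) measurable_fst].
Qed.

Lemma iid_swap s D : measurable D ->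
  (iid_law P n \x iid_law P n)%E (swap s @^-1` D) = iid_law P n D.
Proof.
move=> mD; apply: (iid_push (Q := (iid_law P n \x iid_law P n)%E) (measurable_swap s)) mD => A mA.
pose A1 i := if s i then setT else A i; pose A2 i := if s i then A i else setT.
have -> : swap s @^-1` [set t | forall i, A i (tnth t i)] =
    [set t | forall i, A1 i (tnth t i)] `*` [set t | forall i, A2 i (tnth t i)].
  apply/seteqP; split=> -[x y] /=.
    by move=> h; split=> i; have := h i; rewrite tnth_mktuple /A1 /A2 /=; case: (s i).
  by move=> [h1 h2] i; have := h1 i; have := h2 i; rewrite tnth_mktuple /A1 /A2 /=; case: (s i).
have mrect B : (forall i, measurable (B i)) ->
    measurable [set t : n.-tuple T | forall i, B i (tnth t i)].
  move=> mB; have -> : [set t : n.-tuple T | forall i, B i (tnth t i)] =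
      \bigcap_(i in [set: 'I_n]) ((fun t => tnth t i) @^-1` B i).
    by apply/seteqP; split=> t /= Bt i => [_|]; exact: Bt.
  apply: fin_bigcap_measurable; first exact: finite_finset.
  by move=> i _; rewrite -[X in measurable X]setTI; exact: measurable_tnth.
have mA1 i : measurable (A1 i) by rewrite /A1; case: ifP.
have mA2 i : measurable (A2 i) by rewrite /A2; case: ifP.
transitivity ((\prod_(i < n) P (A1 i)) * \prod_(i < n) P (A2 i))%E.
  rewrite -(iid_lawE P mA1) -(iid_lawE P mA2).
  exact: product_measure1E (mrect _ mA1) (mrect _ mA2).
rewrite -big_split /=.
by apply: eq_bigr => i _; rewrite /A1 /A2; case: (s i); rewrite probability_setT ?mul1e ?mule1.
Qed.

(** The sign vector is fixed. With a second sample y, the mixtures of x and y prescribed by [s] and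
    by its complement both have the law of a sample, and the difference of their sign sums is the
    sum over x minus the sum over y. By Chebyshev's inequality the centred sum over y is at most [r]
    with probability at least 3/4, so a bad x puts (x, y) into an event of probability at most
    [2 * q] for at least 3/4 of the y. Markov's inequality at level 1/2 gives [4 * q]. *)
Lemma symmetrization (H : set (T -> R)) (s : sign) (D : set (n.-tuple T)) (r q : R) :
  0 < r -> (forall h, H h -> bm h) ->
  (forall h, H h -> n%:R * \int[P]_x (h x ^+ 2) <= r ^+ 2 / 4) ->
  measurable D -> fine (iid_law P n D) <= q ->
  (forall x, ~ D x -> forall h, H h ->
     `|rsum s (finset.setTfor 'I_n) (fun i => h (tnth x i))| <= r) ->
  small (iid_law P n) [set x | exists2 h, H h &
    3 * r < `|\sum_(i < n) (h (tnth x i) - \int[P]_o h o)|] (4 * q).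
Proof.
move=> r0 bH vH mD Dq DH.
pose Q : probability _ R := (iid_law P n \x iid_law P n)%E.
pose ns : sign := [ffun i => ~~ s i].
pose D2 := (swap s @^-1` D) `|` (swap ns @^-1` D).
have msw t : measurable (swap t @^-1` D).
  by rewrite -[X in measurable X]setTI; exact: measurable_swap.
have mD2 : measurable D2 by exact: measurableU.
have QD2 : \int[Q]_z (\1_D2 z : R) <= 2 * q.
  rewrite bm_integral_indic//.
  have e t : Q (swap t @^-1` D) = (fine (iid_law P n D))%:E.
    by rewrite fineK ?fin_num_measure//; exact: iid_swap.
  rewrite -lee_fin fineK ?fin_num_measure//.
  apply: (le_trans (measureU2 Q (msw s) (msw ns))).
  by rewrite [X in (X + _)%E]e [X in (_ + X)%E]e -EFinD lee_fin; lra.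
have [b1 bf eQ] := bm_Fubini (iid_law P n) (iid_law P n) (bm_indic R mD2).
pose f x := \int[iid_law P n]_y (\1_D2 (x, y) : R).
exists [set x | 2^-1 < f x]; split.
- rewrite -[X in measurable X]setTI; have := bf.1 measurableT `]2^-1, +oo[%classic (measurable_itv _).
  by rewrite set_itvE.
- move=> x [h Hh hx] /=.
  pose k o := h o - \int[P]_o h o.
  have bh := bH _ Hh.
  have bk : bm k by apply: bmB => //; exact: bm_cst.
  have bk2 : bm (fun o => k o ^+ 2) by under eq_fun do rewrite expr2; exact: bmM.
  have bh2 : bm (fun o => h o ^+ 2) by under eq_fun do rewrite expr2; exact: bmM.
  have k0 : \int[P]_o k o = 0.
    by rewrite bm_integralB//; [rewrite bm_integral_cst subrr|exact: bm_cst].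
  have kh : \int[P]_o (k o ^+ 2) <= \int[P]_o (h o ^+ 2).
    have -> : \int[P]_o (k o ^+ 2) = \int[P]_o (h o ^+ 2 - (2 * \int[P]_o h o) * k o - (\int[P]_o h o) ^+ 2).
      by apply: eq_Rintegral => o _; rewrite /k; ring.
    have bz : bm (fun o => 2 * \int[P]_o h o * k o) by apply: bmM => //; exact: bm_cst.
    rewrite bm_integralB; [|exact: bmB|exact: bm_cst].
    rewrite (bm_integralB _ bh2 bz) (bm_integralZ _ _ bk) k0 mulr0 subr0.
    by rewrite (bm_integral_cst P (_ ^+ 2)) lerBlDr lerDl sqr_ge0.
  have [E [mE EE PE]] := iid_chebyshev n bk k0 r0.
  have {}PE : fine (iid_law P n E) <= 4^-1.
    rewrite -lee_fin fineK ?fin_num_measure//; apply: (le_trans PE); rewrite lee_fin.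
    rewrite ler_pdivrMr ?exprn_gt0//; apply: (le_trans (ler_wpM2l _ kh)) => //.
    by have := vH _ Hh; lra.
  have : \int[iid_law P n]_y (\1_(~` E) y : R) <= f x.
    apply: bm_integral_le; [exact/bm_indic/measurableC|exact: b1|].
    move=> y; rewrite !indicE; case: (boolP (y \in ~` E)) => [|_]; last by case: (_ \in _).
    rewrite inE => yE; suff : (x, y) \in D2 by move=> ->.
    rewrite inE; apply: contrapT => /not_orP[/= xy1 xy2].
    have {EE} ky : `|\sum_(i < n) k (tnth y i)| <= r.
      by rewrite leNgt; apply/negP => /EE.
    have h1 := DH _ xy1 _ Hh; have h2 := DH _ xy2 _ Hh.
    move: hx; rewrite ltNge => /negP; apply.
    have -> : \sum_(i < n) (h (tnth x i) - \int[P]_o h o) =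
       rsum s (finset.setTfor 'I_n) (fun i => h (tnth (swap s (x, y)) i)) -
       rsum s (finset.setTfor 'I_n) (fun i => h (tnth (swap ns (x, y)) i)) +
       \sum_(i < n) k (tnth y i).
      rewrite !rsumT -sumrB -big_split /=; apply: eq_bigr => i _.
      rewrite !tnth_mktuple ffunE /k /=.
      by case: (s i) => /=; rewrite ?expr0 ?expr1; ring.
    apply: (le_trans (ler_normD _ _)); apply: (le_trans (lerD (ler_normB _ _) ky)).
    lra.
  rewrite bm_integral_indic; last exact: measurableC.
  rewrite probability_setC// fineB ?fin_num_measure//= => h1.
  by move: h1 PE; rewrite -/(f x); lra.
- apply: (le_trans (bm_markov _ _ _ _)) => //.
    by move=> x; apply: Rintegral_ge0 => y _.
  rewrite lee_fin ler_pdivrMr ?invr_gt0//; move: QD2; rewrite eQ -/f.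
  lra.
Qed.

End symmetrization.

Section finite_data.
Context d (T : measurableType d).

Lemma measurable_finset_data (I : finType) (f : T -> {set I}) (Q : {set I} -> Prop) :
  (forall i, measurable [set x | i \in f x]) -> measurable [set x | Q (f x)].
Proof.
move=> mf.
have mfB B : measurable [set x | f x = B].
  have -> : [set x | f x = B] =
      \bigcap_(i in [set: I]) [set x | (i \in f x) = (i \in B)].
    apply/seteqP; split=> x /=; first by move=> <-.
    by move=> h; apply/setP => i; exact: h.
  apply: fin_bigcap_measurable; first exact: finite_finset.
  move=> i _; case: (i \in B); first exact: mf.
  have -> : [set x | (i \in f x) = false] = ~` [set x | i \in f x].
    by apply/seteqP; split=> x /=; [move=> ->|move/negP/negbTE].
  exact: measurableC.
have -> : [set x | Q (f x)] = \bigcup_(B in [set B | Q B]) [set x | f x = B].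
  by apply/seteqP; split=> [x /= Qx|x [B /= QB ->]//]; exists (f x).
by apply: fin_bigcup_measurable; first exact: finite_finset.
Qed.

End finite_data.

Section layers.
Variable R : realType.

(** The sum is the ceiling of [y]. Applied to n times a weight, it replaces the weight by an average
    of indicators of level sets. *)
Lemma sum_layers m (y : R) : 0 <= y <= m%:R ->
  y <= \sum_(k < m) (k%:R < y)%R%:R <= y + 1.
Proof.
elim: m => [|m IH] /andP[y0 ym].
  by rewrite big_ord0; apply/andP; split=> //; lra.
rewrite big_ord_recr /=; have [h|h] := ltP m%:R y; last first.
  by rewrite addr0; apply: IH; rewrite y0.
have -> : \sum_(k < m) (k%:R < y)%R%:R = m%:R :> R.
  rewrite (eq_bigr (fun=> 1)) ?sumr_const ?card_ord// => k _.
  suff -> : k%:R < y by [].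
  by apply: le_lt_trans h; rewrite ler_nat ltnW.
by move: ym; rewrite -natr1 /= => ym; apply/andP; split; lra.
Qed.

End layers.

Section weighted.
Context d (T : measurableType d) (R : realType) (P : probability T R) (n : nat).
Local Notation sign := {ffun 'I_n -> bool}.
Local Notation fullI := (finset.setTfor 'I_n).
Local Notation data := ({set (sign + 'I_n * {set 'I_n})%type}).

(* The class of the vectors (g(x_i))_i depends on the sample x in a
   non-measurable way. It is enlarged to the largest class bounded by b whose
   sign sums are at most l outside the set S of bad signs: only finitely many
   such classes occur, so that the majorant built from them is measurable. *)
Definition maxclass (b l : R) (S : {set sign}) : set ('I_n -> R) :=
  [set g | (forall i, `|g i| <= b) /\ forall s, s \notin S -> `|rsum s fullI g| <= l].

(* A datum records the bad signs (inl) and, for each level k, the chain of the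
   index sets {i | k < n * W_v(x_i)} for all v (inr). *)
Definition data_signs (B : data) : {set sign} := [set s | inl s \in B]%SET.
Definition data_chain (B : data) k : {set {set 'I_n}} := [set J | inr (k, J) \in B]%SET.

Definition majorant (b l : R) (B : data) (s : sign) : R :=
  l * (n%:R^-1 * \sum_k (weight (maxclass b l (data_signs B)) l (data_chain B k) s)%:R).

Lemma hits_maxclass (b l : R) S : (#|hits (maxclass b l S) l [set fullI]%SET| <= #|S|)%N.
Proof.
apply: subset_leq_card; apply/fintype.subsetP => s; rewrite inE => /existsP[J].
move=> /andP[/set1P -> /asboolP[g [_ gS] lg]].
by apply: contraLR lg => /gS; rewrite leNgt.
Qed.

Lemma sum_majorant (b l : R) (B : data) : 0 <= b <= l -> (0 < n)%N ->
  (64 * #|data_signs B| <= 2 ^ n)%N ->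
  (forall k, {in data_chain B k &, forall J K : {set 'I_n}, (J \subset K) || (K \subset J)}) ->
  \sum_s majorant b l B s <= 2 * l * 2 ^+ n.
Proof.
move=> bl n0 hS chain; have /andP[b0 bl'] := bl; have l0 := le_trans b0 bl'.
have n0' : 0 < n%:R :> R by rewrite ltr0n.
rewrite /majorant -big_distrr /= [leRHS](_ : _ = l * (2 * 2 ^+ n)); last by ring.
rewrite ler_wpM2l// -big_distrr /= mulrC ler_pdivrMr// exchange_big /=.
apply: (@le_trans _ _ (\sum_(k < n) 2 * 2 ^+ n)); last first.
  by rewrite sumr_const card_ord -[_ *+ _]mulr_natr.
apply: ler_sum => k _; rewrite -natr_sum -natrX -natrM ler_nat.
apply: (sum_weight bl) => //; first by move=> g [].
by apply: leq_trans hS; rewrite leq_mul2l hits_maxclass orbT.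
Qed.

(** Rounding n * w_i up to an integer changes w_i by at most 1/n, which costs at most [b] over all
    terms. The rounded weight is an average of level set indicators, whose sums are bounded by their
    charges. *)
Lemma le_majorant (b l : R) (B : data) s g (w : 'I_n -> R) : 0 <= b <= l -> (0 < n)%N ->
  maxclass b l (data_signs B) g -> (forall i, 0 <= w i <= 1) ->
  (forall k : 'I_n, [set i | (k%:R < n%:R * w i)%R]%SET \in data_chain B k) ->
  `|rsum s fullI (fun i => w i * g i)| <= majorant b l B s + b.
Proof.
move=> bl n0 Gg w01 hw; have /andP[b0 bl'] := bl; have l0 := le_trans b0 bl'.
have n0' : 0 < n%:R :> R by rewrite ltr0n.
pose L i : R := \sum_(k < n) (k%:R < n%:R * w i)%R%:R.
have -> : rsum s fullI (fun i => w i * g i) =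
    n%:R^-1 * \sum_(k < n) rsum s [set i | (k%:R < n%:R * w i)%R]%SET g
    + \sum_i (w i - n%:R^-1 * L i) * ((-1) ^+ s i * g i).
  have -> : \sum_(k < n) rsum s [set i | (k%:R < n%:R * w i)%R]%SET g =
      \sum_i L i * ((-1) ^+ s i * g i).
    transitivity (\sum_(k < n) \sum_i (k%:R < n%:R * w i)%R%:R * ((-1) ^+ s i * g i)).
      apply: eq_bigr => k _; rewrite /rsum big_mkcond /=; apply: eq_bigr => i _.
      by rewrite inE; case: ifP => _; rewrite ?mul1r ?mul0r.
    by rewrite exchange_big /=; apply: eq_bigr => i _; rewrite -big_distrl.
  rewrite rsumT big_distrr -big_split /=; apply: eq_bigr => i _.
  by rewrite !mulrA mulrBl mulrBl; ring.
apply: (le_trans (ler_normD _ _)); apply: lerD.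
  rewrite /majorant mulrCA normrM ger0_norm ?invr_ge0// ler_wpM2l ?invr_ge0//.
  rewrite big_distrr /=; apply: (le_trans (ler_norm_sum _ _ _)).
  apply: ler_sum => k _.
  by case: (weight_bound s bl _ Gg (hw k)) => // g' [].
apply: (le_trans (ler_norm_sum _ _ _)).
apply: (@le_trans _ _ (\sum_(i < n) n%:R^-1 * b)); last first.
  by rewrite sumr_const card_ord -[_ *+ _]mulr_natl mulrA divff ?mul1r// gt_eqF.
apply: ler_sum => i _; rewrite normrM normrMsign ler_pM//; last by case: Gg.
have /andP[w0 w1] := w01 i.
have /sum_layers/andP[h1 h2] : 0 <= n%:R * w i <= n%:R.
  by rewrite mulr_ge0//= -[leRHS]mulr1 ler_wpM2l.
have -> : w i = n%:R^-1 * (n%:R * w i) by rewrite mulrA mulVf ?mul1r// gt_eqF.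
rewrite -mulrBr normrM ger0_norm ?invr_ge0// -[leRHS]mulr1 ler_wpM2l ?invr_ge0//.
by rewrite ler_norml; apply/andP; split; rewrite -/(L i) in h1 h2 *; lra.
Qed.

(* By right continuity, the supremum over v is a supremum over rationals. *)
Record monotone_weight (W : R -> T -> R) : Prop := MonotoneWeight {
  mw_01 : forall v o, 0 <= W v o <= 1;
  mw_homo : forall u v o, u <= v -> W u o <= W v o;
  mw_meas : forall v, measurable_fun setT (W v);
  mw_right : forall v o (e : R), 0 < e -> exists2 u, v < u & W u o < W v o + e }.

Lemma mw_bm W v : monotone_weight W -> bm (W v).
Proof.
move=> mw; split; first exact: mw_meas.
by exists 1 => x; have /andP[w0 w1] := mw_01 mw v x; rewrite ger0_norm.
Qed.

Lemma mw_rat W v (x : n.-tuple T) (e : R) : monotone_weight W -> 0 < e ->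
  exists q : rat, forall i, W v (tnth x i) <= W (ratr q) (tnth x i) < W v (tnth x i) + e.
Proof.
move=> mw e0; have [u hu] : exists2 u, v < u & forall i, W u (tnth x i) < W v (tnth x i) + e.
  have /boolp.choice[u hu] : forall i : 'I_n, exists u, v < u /\ W u (tnth x i) < W v (tnth x i) + e.
    by move=> i; have [u] := mw_right mw v (tnth x i) e0; exists u.
  exists (\big[Num.min/(v + 1)]_i u i).
    by elim/big_ind: _ => [|a b ha hb|i _]; [rewrite ltrDl|rewrite lt_min ha|case: (hu i)].
  move=> i; apply: le_lt_trans (hu i).2; apply: (mw_homo mw).
  by rewrite (bigD1 i)//= ge_min lexx.
move=> hW; have [q] := rat_in_itvoo hu; rewrite in_itv /= => /andP[vq qu].
exists q => i; apply/andP; split; first by apply: (mw_homo mw); exact: ltW.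
by apply: le_lt_trans (hW i); apply: (mw_homo mw); exact: ltW.
Qed.

(** One sign vector has to serve the whole class. Samples for which more than 1/64 of the sign
    vectors are bad have probability at most [64 * eps] by Markov's inequality. On the others the
    majorant averages to at most [2 * l] over the signs, so for some [s] it exceeds [lam] with
    probability at most [2 * l / lam]. Of the [2 * b], one [b] pays for rounding to level sets and
    one for passing to a rational threshold. *)
Lemma weighted_sums (G : set (T -> R)) (A : sign -> set (n.-tuple T)) (W : R -> T -> R)
    (b l eps lam : R) :
  (0 < n)%N -> 0 <= b <= l -> 0 < lam ->
  (forall g, G g -> forall x, `|g x| <= b) ->
  (forall s, measurable (A s)) ->
  (forall s x, ~ A s x -> forall g, G g -> `|rsum s fullI (fun i => g (tnth x i))| <= l) ->
  \sum_s fine (iid_law P n (A s)) <= 2 ^+ n * eps ->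
  monotone_weight W ->
  exists s D, [/\ measurable D, fine (iid_law P n D) <= 64 * eps + 2 * l / lam &
    forall x, ~ D x -> forall g, G g -> forall v,
      `|rsum s fullI (fun i => W v (tnth x i) * g (tnth x i))| <= lam + 2 * b].
Proof.
move=> n0 bl lam0 Gb mA AG sA mw; have /andP[b0 bl'] := bl; have l0 := le_trans b0 bl'.
pose J k q (x : n.-tuple T) : {set 'I_n} :=
  [set i | (k%:R < n%:R * W (ratr q) (tnth x i))%R]%SET.
pose F (x : n.-tuple T) : data := [set z | match z with
  | inl s => x \in A s
  | inr (k, K) => `[< exists q : rat, K = J (nat_of_ord k) q x >] end]%SET.
have mJ k q i : measurable [set x | i \in J k q x].
  have -> : [set x | i \in J k q x] =
      (fun x => n%:R * W (ratr q) (tnth x i)) @^-1` `]k%:R, +oo[%classic.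
    by rewrite set_itvE; apply/seteqP; split=> x /=; rewrite inE.
  rewrite -[X in measurable X]setTI.
  have : bm (fun x : n.-tuple T => n%:R * W (ratr q) (tnth x i)).
    by apply: bmM; [exact: bm_cst|apply: bm_tnth; exact: mw_bm].
  by case=> + _; apply.
have mF z : measurable [set x | z \in F x].
  case: z => [s|[k K]].
    rewrite (_ : [set x | _] = A s)//.
    by apply/seteqP; split=> x /=; rewrite !inE.
  rewrite (_ : [set x | _] = \bigcup_q [set x | K = J (nat_of_ord k) (q : rat) x]).
    apply: bigcupT_measurable_rat => q.
    exact: (measurable_finset_data (f := J k q) (fun L => K = L) (mJ k q)).
  apply/seteqP; split=> x /=; rewrite inE.
    by move/asboolW => [q ->]; exists q.
  by move=> [q _ /= ->]; apply/asboolP; exists q.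
have FS x : data_signs (F x) = [set s | x \in A s]%SET.
  by apply/setP => s; rewrite !inE.
have FC k x : data_chain (F x) k = [set K | `[< exists q : rat, K = J (nat_of_ord k) q x >]]%SET.
  by apply/setP => K; rewrite !inE.
pose good (B : data) := (64 * #|data_signs B| <= 2 ^ n)%N.
pose D s := [set x | good (F x) /\ lam < majorant b l (F x) s].
have mD s : measurable (D s).
  exact: (measurable_finset_data (f := F) (fun B => good B /\ lam < majorant b l B s) mF).
have chain x k : {in data_chain (F x) k &, forall J K : {set 'I_n}, (J \subset K) || (K \subset J)}.
  move=> K1 K2; rewrite FC !inE => -[q1 ->] [q2 ->].
  have sub p q : p <= q -> J k p x \subset J k q x.
    move=> pq; apply/fintype.subsetP => i; rewrite !inE => /lt_le_trans; apply.
    by rewrite ler_wpM2l//; apply: (mw_homo mw); rewrite ler_rat.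
  by apply/orP; case: (leP q1 q2) => [|/ltW] /sub; [left|right].
have N0 : 0 < 2 ^+ n :> R by rewrite exprn_gt0.
have [s Ds] : exists s, fine (iid_law P n (D s)) <= 2 * l / lam.
  apply: (count_min (mu := iid_law P n) (D := D) [ffun=> true]).
  apply: (@le_trans _ _ (2 ^+ n * (2 * l / lam))); last first.
    by rewrite card_ffun card_bool card_ord natrX.
  apply: count_le => // x.
  have [gx|ngx] := boolP (good (F x)); last first.
    rewrite big1; first exact: (mulr_ge0 (ltW N0) (divr_ge0 (mulr_ge0 (ler0n _ 2) l0) (ltW lam0))).
    by move=> s _; rewrite indicE memNset// => -[]; rewrite (negbTE ngx).
  rewrite mulrA ler_pdivlMr// [leRHS]mulrC.
  apply: le_trans (sum_majorant bl n0 gx (chain x)).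
  rewrite big_distrl /=; apply: ler_sum => s _; rewrite indicE.
  have m0 : 0 <= majorant b l (F x) s.
    by rewrite mulr_ge0// mulr_ge0 ?invr_ge0//; apply: sumr_ge0.
  case: (boolP (x \in D s)) => /=; rewrite ?mul0r// mul1r inE => -[_ h].
  exact: ltW.
have [E [mE sE PE]] := count_markov (iid_law P n) mA (divr_gt0 N0 (ltr0n R 64)).
exists s, (E `|` D s); split.
- exact: measurableU.
- rewrite -lee_fin fineK ?fin_num_measure//; last exact: measurableU.
  apply: (le_trans (measureU2 _ mE (mD s))); rewrite EFinD; apply: leeD.
    apply: (le_trans PE); rewrite lee_fin -big_distrl /= ler_pdivrMr ?divr_gt0//.
    by apply: (le_trans sA); rewrite le_eqVlt; apply/orP; left; apply/eqP; field.
  by rewrite -[leLHS]fineK ?fin_num_measure// lee_fin.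
- move=> x /not_orP[xE xD] g Gg v.
  have gx : good (F x).
    rewrite /good leqNgt; apply/negP => bad; apply: xE; apply: sE => /=.
    rewrite ltr_pdivrMr//; move: bad; rewrite -(ltr_nat R) natrX natrM mulrC.
    suff -> : #|data_signs (F x)|%:R = \sum_s \1_(A s) x :> R by [].
    rewrite FS -sum1_card natr_sum big_mkcond /=; apply: eq_bigr => t _.
    by rewrite inE indicE; case: (x \in A t).
  have Gx : maxclass b l (data_signs (F x)) (fun i => g (tnth x i)).
    split=> [i|t]; first exact: Gb.
    by rewrite FS inE => /negP; rewrite inE => /AG; apply.
  pose e : R := n.+1%:R^-1.
  have e0 : 0 < e by rewrite invr_gt0.
  have [q hq] := mw_rat v x mw e0.
  have -> : rsum s fullI (fun i => W v (tnth x i) * g (tnth x i)) =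
     rsum s fullI (fun i => W (ratr q) (tnth x i) * g (tnth x i)) -
     rsum s fullI (fun i => (W (ratr q) (tnth x i) - W v (tnth x i)) * g (tnth x i)).
    by rewrite !rsumT -sumrB; apply: eq_bigr => i _; ring.
  apply: (le_trans (ler_normB _ _)).
  rewrite mulr2n mulrDl mul1r addrA; apply: lerD.
    apply: (le_trans (le_majorant s bl n0 Gx _ _)) => //.
    - by move=> i; exact: mw_01.
    - by move=> k; rewrite FC inE; apply/asboolP; exists q.
    - by rewrite lerD2r leNgt; apply/negP => h; exact: xD.
  apply: (le_trans (ler_norm_sum _ _ _)); rewrite big_mkcond /=.
  apply: (@le_trans _ _ (\sum_(i < n) e * b)).
    apply: ler_sum => i _; rewrite finset.in_setT normrMsign normrM ler_pM//; last exact: Gb.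
    by have /andP[h1 h2] := hq i; rewrite ger0_norm ?subr_ge0// lerBlDl ltW.
  rewrite sumr_const card_ord -[_ *+ _]mulr_natl mulrA -[leRHS]mul1r ler_wpM2r//.
  by rewrite /e ler_pdivrMr// mul1r ler_nat.
Qed.

End weighted.

Lemma finite_partition (A : Type) (R : realType) (u : A -> R) (M e : R) : 0 < e ->
  (forall a, `|u a| <= M) ->
  exists (I : finType) (k : A -> I), forall a b, k a = k b -> `|u a - u b| <= e.
Proof.
move=> e0 uM.
have uM2 a : 0 <= (u a + M) / e.
  by have := uM a; rewrite ler_norml => /andP[h _]; apply: divr_ge0; [lra|exact: ltW].
pose N := Num.truncn (2 * M / e).
have lN a : (Num.truncn ((u a + M) / e) <= N)%N.
  apply: le_truncn; apply: ler_wpM2r; first by rewrite invr_ge0 ltW.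
  by have := uM a; rewrite ler_norml => /andP[_ ?]; lra.
exists 'I_N.+1, (fun a => inord (Num.truncn ((u a + M) / e))) => a b ab.
have {ab} : Num.truncn ((u a + M) / e) = Num.truncn ((u b + M) / e).
  by have := congr1 (@nat_of_ord _) ab; rewrite !inordK ?ltnS.
have /andP[a1 a2] := truncn_itv (uM2 a); have /andP[b1 b2] := truncn_itv (uM2 b).
move=> ab; move: a1 a2 b1 b2; rewrite ab.
have : (Num.truncn ((u b + M) / e)).+1%:R * e = (Num.truncn ((u b + M) / e))%:R * e + e.
  by rewrite -natr1 mulrDl mul1r.
rewrite !ler_pdivlMr// !ltr_pdivrMr//; move=> -> a1 a2 b1 b2.
by rewrite ler_norml; apply/andP; split; lra.
Qed.

Lemma finite_partitions (A : Type) (R : realType) (S : eqType) (s : seq S) (u : S -> A -> R) (e : R) :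
  0 < e -> (forall z, z \in s -> exists M, forall a, `|u z a| <= M) ->
  exists (I : finType) (k : A -> I),
    forall a b, k a = k b -> forall z, z \in s -> `|u z a - u z b| <= e.
Proof.
move=> e0; elim: s => [_|z s IH h]; first by exists unit, (fun=> tt).
have [|I [k kP]] := IH; first by move=> y ys; apply: h; rewrite inE ys orbT.
have [|M uM] := h z; first by rewrite inE eqxx.
have [J [l lP]] := finite_partition e0 uM.
exists (I * J)%type, (fun a => (k a, l a)) => a b [kab lab] y; rewrite inE => /orP[/eqP ->|].
  exact: lP.
exact: kP.
Qed.

Import HBNNSimple.

(** The integral of a nonnegative function is a supremum over the simple functions below it, hence
    monotone. The test functional on l^oo(F) is compared with an indicator in this way. *)
Lemma ge0_le_integral_nonmeas d (T : measurableType d) (R : realType)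
    (mu : {measure set T -> \bar R}) (f g : T -> \bar R) :
  (forall x, 0 <= f x)%E -> (forall x, f x <= g x)%E ->
  (\int[mu]_x f x <= \int[mu]_x g x)%E.
Proof.
move=> f0 fg; have g0 x : (0 <= g x)%E by apply: le_trans (fg x).
rewrite !ge0_integralTE//; apply: le_ereal_sup => _ [h hf <-].
by exists h => // x; apply: le_trans (fg x).
Qed.

(** * Equicontinuity over a Donsker class *)

Section uniform_space.
Context (U : choiceType) (R : realType).
Local Notation space := {uniform U -> R}.
Implicit Types z : space.

Definition uball z (e : R) : set space := [set w : space | forall f, `|z f - w f| < e].

Lemma nbhs_uball z e : 0 < e -> nbhs z (uball z e).
Proof.
move=> e0; apply/uniform_nbhs; exists [set xy : R * R | `|xy.1 - xy.2| < e]; split.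
  by rewrite -entourage_ballE; exists e.
by move=> w h f; exact: h.
Qed.

Lemma uniform_hausdorff : hausdorff_space space.
Proof.
move=> p q clpq; apply/funext => f; apply/eqP; rewrite -subr_eq0 -normr_eq0.
apply/negP => /negP pq.
pose e := `|p f - q f| / 2.
have e0 : 0 < e by rewrite divr_gt0// lt_def pq normr_ge0.
have [w [/(_ f) pw /(_ f) qw]] := clpq _ _ (nbhs_uball p e0) (nbhs_uball q e0).
have : `|p f - q f| < e + e.
  have -> : p f - q f = (p f - w f) - (q f - w f) by ring.
  by apply: (le_lt_trans (ler_normB _ _)); exact: ltrD.
by rewrite /e; lra.
Qed.

Variables (I : Type) (k : U -> I).

(** The value 0 is adjoined so that the supremum is over a nonempty set even when there is no
    index. *)
Definition osc_set z : set R :=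
  [set r | r = 0 \/ exists f g, k f = k g /\ r = `|z f - z g|].

Definition osc z : R := sup (osc_set z).

Lemma osc_ub z M : (forall f, `|z f| <= M) -> has_sup (osc_set z).
Proof.
move=> zM; split; first by exists 0; left.
exists (`|M| + `|M|) => _ [->|[f [g [_ ->]]]]; first by rewrite addr_ge0.
apply: (le_trans (ler_normB _ _)).
by apply: lerD; apply: (le_trans (zM _)); exact: ler_norm.
Qed.

Lemma osc_le z e : 0 <= e -> (forall f g, k f = k g -> `|z f - z g| <= e) -> osc z <= e.
Proof.
move=> e0 h; apply: ge_sup; first by exists 0; left.
by move=> _ [->//|[f [g [kfg ->]]]]; exact: h.
Qed.

Lemma le_osc z M f g : (forall f, `|z f| <= M) -> k f = k g -> `|z f - z g| <= osc z.
Proof.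
move=> zM kfg; apply: (sup_ubound (osc_ub zM).2); right; exists f, g; by [].
Qed.

Lemma osc_uball z w M e : 0 < e -> (forall f, `|z f| <= M) -> uball z e w ->
  `|osc z - osc w| <= 2 * e.
Proof.
move=> e0 zM zw.
have wM f : `|w f| <= M + e.
  have -> : w f = z f - (z f - w f) by ring.
  by apply: (le_trans (ler_normB _ _)); apply: lerD => //; exact/ltW.
have osc0 v N : (forall f, `|v f| <= N) -> 0 <= osc v.
  by move=> vN; apply: (sup_ubound (osc_ub vN).2); left.
have key v u N f g : (forall f, `|v f| <= N) -> (forall f, `|u f - v f| < e) -> k f = k g ->
    `|u f - u g| <= osc v + 2 * e.
  move=> vN uv kfg; have -> : u f - u g = (v f - v g) + ((u f - v f) - (u g - v g)) by ring.
  apply: (le_trans (ler_normD _ _)); apply: lerD; first exact: le_osc vN kfg.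
  apply: (le_trans (ler_normB _ _)); have := uv f; have := uv g; lra.
have h1 : osc z <= osc w + 2 * e.
  apply: osc_le; first by rewrite addr_ge0 ?mulr_ge0 ?(osc0 _ _ wM)// ltW.
  by move=> f g; apply: key wM zw.
have h2 : osc w <= osc z + 2 * e.
  apply: osc_le; first by rewrite addr_ge0 ?mulr_ge0 ?(osc0 _ _ zM)// ltW.
  by move=> f g; apply: key zM _ => f'; rewrite distrC.
by rewrite ler_norml; apply/andP; split; lra.
Qed.

End uniform_space.

Lemma clip_dist (R : realType) (a b r : R) : `|a - b| <= r ->
  `|Num.min 1 (Num.max 0 (a - 3)) - Num.min 1 (Num.max 0 (b - 3))| <= r.
Proof.
rewrite !ler_norml => /andP[ab1 ab2].
have h2 : `|Num.max 0 (a - 3) - Num.max 0 (b - 3)| <= r.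
  by case: (leP 0 (a - 3)) => h1; case: (leP 0 (b - 3)) => h2;
    rewrite ler_norml; apply/andP; split; lra.
move: h2; move: (Num.max _ _) (Num.max _ _) => c e; rewrite ler_norml => /andP[h1 h2].
by case: (leP 1 c) => h3; case: (leP 1 e) => h4; apply/andP; split; lra.
Qed.

Section donsker_partition.
Context d (T : measurableType d) (R : realType) (P : probability T R).
Variable F : set (T -> R).
Local Notation space := {uniform F -> R}.

Lemma bounded_funP (z : space) : linfty F z <-> exists M, forall f, `|z f| <= M.
Proof.
split.
  move=> [M [Mr h]]; exists (M + 1) => f; apply: h => //; rewrite ltrDl; exact: ltr01.
by move=> [M h]; exists M; split=> [|N MN f _]; rewrite ?num_real//; apply: (le_trans (h f)); exact: ltW.
Qed.

Lemma compact_net (K : set space) (e : R) : 0 < e -> compact K ->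
  exists2 s : seq space, (forall z, z \in s -> K z) &
    exists O : set space, [/\ open O, K `<=` O &
      forall w, O w -> exists2 z, z \in s & uball z e w].
Proof.
move=> e0 cK.
pose pspace : ptopologicalType := HB.pack space (isPointed.Build space (fun=> 0 : R)).
have : @cover_compact pspace K by rewrite -compact_cover.
move=> /(_ space K (fun z => (uball z e)^°)); case.
- by move=> z _; exact: open_interior.
- by move=> z Kz; exists z => //; exact: nbhs_uball.
move=> D DK KD; exists (finmap.enum_fset D).
  by move=> z /DK; rewrite inE.
exists (\bigcup_(z in [set z | z \in finmap.enum_fset D]) (uball z e)^°); split.
- by apply: bigcup_open => z _; exact: open_interior.
- exact: KD.
- by move=> w [z /= zD /interior_subset zw]; exists z.
Qed.

(** Tightness gives a compact set of nearly full mass, and a cell collects the indices at which all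
    members of a finite net of it nearly agree. Near the compact set the oscillation within cells is
    then at most [3 * e]: [e] for the net and [2 * e] for approximation at two indices. Weak
    convergence is applied to a continuous ramp of the oscillation, equal to 0 up to [3 * e] and to
    1 from [4 * e] on, which detects differences above t = 5 * e. *)
Lemma donsker_partition (t q : R) : donsker P F -> 0 < t -> 0 < q ->
  exists (I : finType) (k : F -> I), \forall n \near \oo,
    small (iid_law P n) [set s | exists f g : F, k f = k g /\
      t < `|emp_process P s (val f) - emp_process P s (val g)|] q.
Proof.
move=> [_ emp_linfty [L Ltight Lcvg]] t0 q0.
pose e := t / 5; have e0 : 0 < e by rewrite divr_gt0.
have [K [cK Kl LK]] := Ltight _ (divr_gt0 q0 (ltr0n R 2)).
have [s sK [Q [oQ KQ Qs]]] := compact_net e0 cK.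
have [I [k kP]] := @finite_partitions F R space s (fun z f => z f) e e0
  (fun z zs => (bounded_funP z).1 (Kl _ (sK _ zs))).
exists I, k.
(* h vanishes near K and is 1 where the oscillation within a cell is large. *)
pose h (z : space) := Num.min 1 (Num.max 0 (osc k z / e - 3)).
have h01 z : 0 <= h z <= 1 by rewrite le_min ler01 le_max lexx /= ge_min lexx.
have hQ z : Q z -> h z = 0.
  move=> /Qs[w ws wz]; have oz : osc k z <= 3 * e.
    apply: osc_le; first by rewrite mulr_ge0// ltW.
    move=> f g kfg.
    have -> : z f - z g = (w f - w g) - ((w f - z f) - (w g - z g)) by ring.
    apply: (le_trans (ler_normB _ _)).
    have := kP _ _ kfg _ ws; have := wz f; have := wz g.
    have := ler_normB (w f - z f) (w g - z g); lra.
  rewrite /h max_l; first by rewrite min_r.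
  by rewrite subr_le0 ler_pdivrMr.
have hc : {within linfty F, continuous h}.
  apply/subspace_continuousP => z zl; apply/cvgrPdist_le => r r0 /=.
  have [M zM] := (bounded_funP z).1 zl.
  have re : 0 < r * e / 2 by rewrite divr_gt0// mulr_gt0.
  apply: filterS (nbhs_uball z re) => w zw _.
  have o := osc_uball k re zM zw.
  have {}o : `|osc k z / e - osc k w / e| <= r.
    by rewrite -mulrBl normrM [`|e^-1|]gtr0_norm ?invr_gt0// ler_pdivrMr//; apply: (le_trans o); lra.
  exact: clip_dist.
have hb : [bounded h z | z in linfty F].
  exists 1; split=> // x x1 z _ /=; have /andP[h0 h1] := h01 z.
  by rewrite ger0_norm// (le_trans h1)// ltW.
have := Lcvg h hc hb; set l := (\int[L]_(z in _) _)%E.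
have ll : (l <= (q / 2)%:E)%E.
  have mQ : measurable (Q : set (borel F)) by exact: sub_sigma_algebra.
  have mK : measurable (K : set (borel F)).
    rewrite -[K]setCK; apply: measurableC; apply: sub_sigma_algebra.
    by apply: closed_openC; apply: compact_closed => //; exact: uniform_hausdorff.
  rewrite /l integral_mkcond.
  apply: (@le_trans _ _ (\int[L]_z (\1_(~` (Q : set (borel F))) z : R)%:E)%E).
    apply: ge0_le_integral_nonmeas => z; rewrite patchE; case: (z \in linfty F).
    - by rewrite lee_fin; case/andP: (h01 z).
    - exact: lexx.
    - rewrite lee_fin indicE; case: (boolP (z \in _)) => [_|].
        by case/andP: (h01 z).
      by rewrite notin_setE /= => /contrapT /hQ ->.
    - have h0 : (0 <= (\1_(~` (Q : set (borel F))) z : R)%:E)%E by rewrite lee_fin.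
      exact: h0.
  rewrite integral_indic//; last exact: measurableC.
  have LQ : ((1 - q / 2)%:E <= L Q)%E.
    by apply: (le_trans LK); apply: le_measure => //; rewrite inE.
  rewrite setIT; apply: (@le_trans _ _ (1 - L Q)%E).
    by rewrite -(probability_setC L mQ).
  move: LQ.
  rewrite -[L Q]fineK ?fin_num_measure// -EFinB !lee_fin; lra.
move=> cvl; have : nbhs l [set x | (x < q%:E)%E].
  apply: open_nbhs_nbhs; split; first exact: open_ereal_lt_ereal.
  have qq : ((q / 2)%:E < q%:E)%E by rewrite lte_fin; lra.
  exact: le_lt_trans ll qq.
move=> /cvl cvq; have {cvq} : \forall n \near \oo, (outer_expectation (iid_law P n)
    (fun s' : n.-tuple T => h (emp_path P F s')) < q%:E)%E by exact: cvq.
apply: filterS => n /= /ereal_inf_lt[_ [V [iV hV] <-] Vq].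
have mV : measurable_fun setT V by case/integrableP: iV.
have V0 s' : (0 <= V s')%E.
  by apply: le_trans (hV s'); rewrite lee_fin; case/andP: (h01 (emp_path P F s')).
have mD : measurable [set s' | (1 <= V s')%E].
  by rewrite -[X in measurable X]setTI; exact: emeasurable_fun_c_infty.
exists [set s' | (1 <= V s')%E]; split=> //.
  move=> s' [f [g [kfg fg]]] /=; apply: le_trans (hV s'); rewrite lee_fin.
  have [N sN] := (bounded_funP _).1 (emp_linfty n s').
  have : 5 * e < osc k (emp_path P F s').
    by rewrite /e mulrC divfK//; apply: lt_le_trans fg _; exact: le_osc sN kfg.
  rewrite /h le_min lexx /= le_max => o; apply/orP; right.
  by rewrite lerBrDr ler_pdivlMr//; apply/ltW; apply: le_lt_trans o; lra.
apply: le_trans (ltW Vq).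
rewrite -[X in (_ X <= _)%E]setIT -integral_indic//.
apply: ge0_le_integral => //.
  by apply/measurable_EFinP; exact: measurable_indic.
move=> s' _; rewrite indicE; case: (boolP (s' \in _)) => //=.
by rewrite inE.
Qed.

End donsker_partition.

Section rademacher.
Variables (R : realType) (n : nat).
Local Notation sign := {ffun 'I_n -> bool}.
Local Notation fullI := (finset.setTfor 'I_n).

Lemma sum_rsum_sq (g : 'I_n -> R) :
  \sum_(s : sign) rsum s fullI g ^+ 2 = 2 ^+ n * \sum_i g i ^+ 2.
Proof.
have cross i j : i != j ->
    \sum_(s : sign) ((-1) ^+ s i * (-1) ^+ s j) = 0 :> R.
  (* With the complement of a singleton, [flip] reverses the sign at [i] alone and so negates each
     product of the signs at [i] and [j]. *)
  move=> ij; pose f (s : sign) : sign := flip (~: [set i])%SET s.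
  have finv : {on [pred s : sign | true], bijective f}.
    by exists f => s _; exact: flipK.
  apply/eqP; rewrite -[_ == 0](mulrn_eq0 _ 2) /= mulr2n.
  rewrite {1}(reindex f finv) /= -big_split /= big1// => s _.
  rewrite !ffunE !inE eqxx /= eq_sym ij /=.
  by case: (s i) => /=; rewrite ?expr0 ?expr1; ring.
transitivity (\sum_(s : sign) \sum_i \sum_j
    (g i * g j) * ((-1) ^+ s i * (-1) ^+ s j)).
  apply: eq_bigr => s _; rewrite rsumT expr2 big_distrl /=; apply: eq_bigr => i _.
  by rewrite big_distrr /=; apply: eq_bigr => j _; ring.
rewrite exchange_big big_distrr /=; apply: eq_bigr => i _.
rewrite exchange_big /= (bigD1 i)//=.
have -> : \sum_(s : sign) g i * g i * ((-1) ^+ s i * (-1) ^+ s i) = 2 ^+ n * g i ^+ 2.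
  transitivity (\sum_(s : sign) g i ^+ 2).
    by apply: eq_bigr => s _; rewrite -!expr2 sqrr_sign mulr1.
  by rewrite sumr_const card_ffun card_bool card_ord -[_ *+ _]mulr_natl natrX.
rewrite [X in _ + X]big1 ?addr0// => j ji.
by rewrite -mulr_sumr cross 1?eq_sym// mulr0.
Qed.

End rademacher.

Lemma near_sqrt (R : realType) (M : R) : \forall n \near \oo, M <= Num.sqrt n%:R.
Proof.
near=> n; have [M0|/ltW M0] := leP M 0; first exact: le_trans (sqrtr_ge0 _).
rewrite -(ler_sqr _ _) ?nnegrE ?sqrtr_ge0// sqr_sqrtr//.
by near: n; exact: nbhs_infty_ger.
Unshelve. all: by end_near. Qed.

Section process.
Context d (T : measurableType d) (R : realType) (P : probability T R).

Lemma norm_emp_process n (s : n.-tuple T) f (r : R) :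
  (0 < n)%N -> (r < `|emp_process P s f|) =
  (Num.sqrt n%:R * r < `|\sum_(i < n) (f (tnth s i) - \int[P]_x f x)|).
Proof.
move=> n0; have sn : 0 < Num.sqrt n%:R :> R by rewrite sqrtr_gt0 ltr0n.
rewrite emp_processE normrM [`|_^-1|]gtr0_norm ?invr_gt0//.
by rewrite mulrC ltr_pdivlMr// mulrC.
Qed.

(** In 9 = 3 * 3, one factor bounds the weighted sign sums by [lam] plus [2 * b] at scale sqrt n,
    the other is the price of symmetrization. A weight in [0, 1] does not increase second moments,
    so the bound for [g] serves for the second sample. *)
Lemma weighted_process n (G : set (T -> R))
    (A : {ffun 'I_n -> bool} -> set (n.-tuple T)) (W : R -> T -> R) (b t eps lam : R) :
  0 <= b <= Num.sqrt n%:R * t -> 0 < lam -> b <= Num.sqrt n%:R * lam -> (0 < n)%N ->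
  (forall g, G g -> bm g /\ forall x, `|g x| <= b) ->
  (forall g, G g -> \int[P]_x (g x ^+ 2) <= lam ^+ 2) ->
  (forall s, measurable (A s)) ->
  (forall s x, ~ A s x -> forall g, G g ->
    `|rsum s (finset.setTfor 'I_n) (fun i => g (tnth x i))| <= Num.sqrt n%:R * t) ->
  \sum_s fine (iid_law P n (A s)) <= 2 ^+ n * eps ->
  monotone_weight W ->
  small (iid_law P n) [set s | exists2 g, G g & exists v,
    9 * lam < `|emp_process P s (fun x => W v x * g x)|] (4 * (64 * eps + 2 * t / lam)).
Proof.
move=> bt lam0 bl n0 Gb G2 mA AG sA mw.
have sn : 0 < Num.sqrt n%:R :> R by rewrite sqrtr_gt0 ltr0n.
have [|s [D [mD Dq DG]]] := weighted_sums n0 bt (mulr_gt0 sn lam0) _ mA AG sA mw.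
  by move=> g /Gb[].
pose H := [set h | exists g v, G g /\ h = fun x => W v x * g x].
have bH h : H h -> bm h.
  by move=> [g [v [/Gb[bg _] ->]]]; apply: bmM => //; exact: mw_bm.
pose r := 3 * (Num.sqrt n%:R * lam).
have r0 : 0 < r by rewrite mulr_gt0// mulr_gt0.
have sm : small (iid_law P n) [set x | exists2 h, H h &
    3 * r < `|\sum_(i < n) (h (tnth x i) - \int[P]_o h o)|] (4 * (64 * eps + 2 * t / lam)).
  apply: (symmetrization (s := s) r0 bH _ mD).
  - move=> h [g [v [Gg ->]]]; have [bg _] := Gb _ Gg.
    have bg2 : bm (fun x => g x ^+ 2) by under eq_fun do rewrite expr2; exact: bmM.
    have bW := mw_bm v mw.
    apply: (@le_trans _ _ (n%:R * lam ^+ 2)).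
      apply: ler_wpM2l => //; apply: le_trans (G2 _ Gg).
      apply: bm_integral_le => //.
        by under eq_fun do rewrite expr2; apply: bmM; exact: bmM.
      move=> x; rewrite exprMn -[leRHS]mul1r ler_wpM2r ?sqr_ge0//.
      by have /andP[w0 w1] := mw_01 mw v x; rewrite expr_le1.
    rewrite /r !exprMn sqr_sqrtr//.
    have : 0 <= n%:R * lam ^+ 2 by rewrite mulr_ge0// sqr_ge0.
    lra.
  - apply: (le_trans Dq); rewrite lerD2l le_eqVlt; apply/orP; left; apply/eqP.
    by field; rewrite !gt_eqF.
  - move=> x Dx h [g [v [Gg ->]]]; apply: (le_trans (DG _ Dx _ Gg v)).
    by rewrite /r; lra.
apply: small_sub sm => s' [g Gg [v h]]; exists (fun x => W v x * g x); first by exists g, v.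
by move: h; rewrite norm_emp_process// /r; congr (_ < _); ring.
Qed.

End process.

(** * From the empirical process back to sign sums *)

Section selection.
Context d (T : measurableType d) (R : realType) (P : probability T R).

Definition select k n (h : 'I_k -> 'I_n) (s : n.-tuple T) : k.-tuple T :=
  [tuple tnth s (h i) | i < k].

Lemma measurable_select k n (h : 'I_k -> 'I_n) : measurable_fun setT (select h).
Proof.
apply/measurable_fun_tnthP => i.
rewrite (_ : _ \o _ = fun s : n.-tuple T => tnth s (h i)); first exact: measurable_tnth.
by apply/funext => s /=; rewrite tnth_mktuple.
Qed.

Lemma iid_select k n (h : 'I_k -> 'I_n) D : injective h -> measurable D ->
  iid_law P n (select h @^-1` D) = iid_law P k D.
Proof.
move=> hinj mD; apply: (iid_push (measurable_select h)) mD => A mA.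
pose B j := if [pick i | h i == j] is Some i then A i else setT.
have mB j : measurable (B j) by rewrite /B; case: pickP.
have Bh i : B (h i) = A i.
  by rewrite /B; case: pickP => [j /eqP/hinj ->//|/(_ i)]; rewrite eqxx.
have -> : select h @^-1` [set s | forall i, A i (tnth s i)] =
    [set s | forall j, B j (tnth s j)].
  apply/seteqP; split=> s /= As i.
    by rewrite /B; case: pickP => // j /eqP <-; have := As j; rewrite tnth_mktuple.
  by rewrite tnth_mktuple -Bh.
rewrite (iid_lawE P mB) (bigID (fun j => j \in h @: [set: 'I_k]%SET)) /=.
rewrite [X in (_ * X)%E]big1 ?mule1; last first.
  move=> j jh; rewrite /B; case: pickP => [i /eqP hij|_]; last exact: probability_setT.
  by move: jh; rewrite -hij imset_f ?inE.
rewrite big_imset /=; last by move=> i j _ _; exact: hinj.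
by apply: eq_big => [i|i _]; rewrite ?inE ?Bh.
Qed.

Lemma small_select k n (h : 'I_k -> 'I_n) E q : injective h ->
  small (iid_law P k) E q -> small (iid_law P n) (select h @^-1` E) q.
Proof.
move=> hinj [D [mD ED Dq]]; exists (select h @^-1` D); split.
- by rewrite -[X in measurable X]setTI; exact: measurable_select.
- by move=> s; exact: ED.
- by rewrite iid_select.
Qed.

End selection.

Section desymmetrization.
Context d (T : measurableType d) (R : realType) (P : probability T R).
Variables (C : (T -> R) -> (T -> R) -> Prop).
Hypothesis bC : forall f g, C f g -> [/\ bm f, bm g, forall x, `|f x| <= 1 & forall x, `|g x| <= 1].
Variables (n0 : nat) (t q : R).
Hypothesis t0 : 0 < t.
Hypothesis q0 : 0 <= q.
Hypothesis Ct : forall k, (n0 <= k)%N ->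
  small (iid_law P k) [set s | exists f g, C f g /\
    t < `|emp_process P s f - emp_process P s g|] q.

Let ctr (f g : T -> R) x := f x - g x - \int[P]_y (f y - g y).

(** The observations indexed by [J] are themselves an i.i.d. sample. If [J] has at least [n0]
    elements, the assumption applies at that sample size and the square root of the size is at most
    sqrt n; otherwise there are fewer than [n0] terms, each at most 4. *)
Lemma small_subsum n (J : {set 'I_n}) : 4 * n0%:R <= Num.sqrt n%:R * t ->
  small (iid_law P n) [set s | exists f g, C f g /\
    Num.sqrt n%:R * t < `|\sum_(i in J) ctr f g (tnth s i)|] q.
Proof.
move=> n0t.
have ctr_le f g x : C f g -> `|ctr f g x| <= 4.
  move=> /bC[bf bg f1 g1]; have bfg := bmB bf bg.
  have fg2 y : `|f y - g y| <= 2.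
    by apply: (le_trans (ler_normB _ _)); have := f1 y; have := g1 y; lra.
  apply: (le_trans (ler_normB _ _)).
  have : `|\int[P]_y (f y - g y)| <= 2.
    have : -2 <= \int[P]_y (f y - g y) <= 2.
      rewrite -[X in X <= _ <= _](bm_integral_cst P) -[X in _ <= _ <= X](bm_integral_cst P).
      apply/andP; split; apply: bm_integral_le => //; try exact: bm_cst.
        by move=> y; have := fg2 y; rewrite ler_norml => /andP[].
      by move=> y; have := fg2 y; rewrite ler_norml => /andP[].
    by rewrite ler_norml.
  by have := fg2 x; lra.
have [n0J|Jn0] := leqP n0 #|J|; last first.
  apply: small_sub (small0 _ q0) => s /= -[f [g [Cfg]]].
  rewrite ltNge => /negP; apply; apply: le_trans n0t.
  apply: (le_trans (ler_norm_sum _ _ _)).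
  apply: (@le_trans _ _ (\sum_(i in J) 4)); first by apply: ler_sum => i _; exact: ctr_le.
  by rewrite sumr_const -[_ *+ _]mulr_natr ler_wpM2l// ler_nat ltnW.
apply: small_sub (small_select (h := enum_val (A := mem J)) enum_val_inj (Ct n0J)).
move=> s [f [g [Cfg h]]] /=; exists f, g; split=> //.
have [bf bg _ _] := bC Cfg; rewrite -emp_processB//.
have J0 : (0 < #|J|)%N.
  rewrite lt0n; apply/negP => /eqP J0; move: h; rewrite big1; last first.
    by move=> i; rewrite (card0_eq J0).
  by rewrite normr0 ltNge mulr_ge0// ?ltW// sqrtr_ge0.
rewrite norm_emp_process//; apply: le_lt_trans (lt_le_trans h _).
  by apply: ler_wpM2r; [exact: ltW|rewrite ler_wsqrtr// ler_nat -[leqRHS](card_ord n) max_card].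
rewrite le_eqVlt; apply/orP; left; apply/eqP; congr `|_|.
rewrite (big_enum_val _ (A := mem J)) /=; apply: eq_bigr => i _.
by rewrite tnth_mktuple.
Qed.

(** A sign sum is the difference of the centred sums over the two sets of equal signs, plus the mean
    of f - g times the sum of the signs. That last sum is at most K * sqrt n except for a fraction
    at most K ^ -2 of the sign vectors, for which [A s] is the whole space. *)
Lemma desymmetrization n (K : R) : 4 * n0%:R <= Num.sqrt n%:R * t -> (0 < n)%N ->
  0 < K -> (forall f g, C f g -> K * `|\int[P]_y (f y - g y)| <= t) ->
  exists A : {ffun 'I_n -> bool} -> set (n.-tuple T),
    [/\ forall s, measurable (A s),
      forall s x, ~ A s x -> forall f g, C f g ->
        `|rsum s (finset.setTfor 'I_n) (fun i => f (tnth x i) - g (tnth x i))| <=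
           Num.sqrt n%:R * (3 * t) &
      \sum_s fine (iid_law P n (A s)) <= 2 ^+ n * (2 * q + (K ^+ 2)^-1)].
Proof.
move=> n0t n_gt0 K0 Cmean.
have sn : 0 < Num.sqrt n%:R :> R by rewrite sqrtr_gt0 ltr0n.
pose one := fun _ : 'I_n => 1 : R.
pose bad (s : {ffun 'I_n -> bool}) := K * Num.sqrt n%:R < `|rsum s (finset.setTfor 'I_n) one|.
have key s : exists D, [/\ measurable D, fine (iid_law P n D) <= 2 * q + (bad s)%:R &
    forall x, ~ D x -> forall f g, C f g ->
        `|rsum s (finset.setTfor 'I_n) (fun i => f (tnth x i) - g (tnth x i))| <=
           Num.sqrt n%:R * (3 * t)].
  have [bs|nbs] := boolP (bad s).
    exists setT; split=> //; last by move=> x; case.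
    by rewrite probability_setT /= lerDr mulr_ge0.
  pose J b : {set 'I_n} := [set i | s i == b]%SET.
  have [D [mD ED Dq]] := smallU (small_subsum (J true) n0t) (small_subsum (J false) n0t).
  exists D; split=> //.
    by rewrite -lee_fin fineK ?fin_num_measure//; apply: (le_trans Dq); rewrite lee_fin /= addr0 mulr2n mulrDl mul1r.
  move=> x Dx f g Cfg.
  have e : rsum s (finset.setTfor 'I_n) (fun i => f (tnth x i) - g (tnth x i)) =
      \sum_(i in J false) ctr f g (tnth x i) - \sum_(i in J true) ctr f g (tnth x i)
      + rsum s (finset.setTfor 'I_n) one * \int[P]_y (f y - g y).
    rewrite !rsumT [X in X - _]big_mkcond [X in _ - X]big_mkcond /= big_distrl /=.
    rewrite -sumrB -big_split /=; apply: eq_bigr => i _; rewrite !inE /one /ctr.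
    by case: (s i) => /=; rewrite ?expr0 ?expr1; ring.
  have hJ b : `|\sum_(i in J b) ctr f g (tnth x i)| <= Num.sqrt n%:R * t.
    rewrite leNgt; apply/negP => h; apply: Dx; apply: ED.
    by case: b h => h; [left|right]; exists f, g.
  rewrite e; apply: (le_trans (ler_normD _ _)).
  have h1 := ler_normB (\sum_(i in J false) ctr f g (tnth x i)) (\sum_(i in J true) ctr f g (tnth x i)).
  have h2 : `|rsum s (finset.setTfor 'I_n) one * \int[P]_y (f y - g y)| <= Num.sqrt n%:R * t.
    rewrite normrM; apply: (@le_trans _ _ (K * Num.sqrt n%:R * `|\int[P]_y (f y - g y)|)).
      by rewrite ler_wpM2r// leNgt.
    by rewrite -mulrA mulrCA; apply: ler_wpM2l; [exact: ltW|exact: Cmean].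
  have := hJ false; have := hJ true; lra.
have /boolp.choice[A hA] := key.
exists A; split=> [s|s|]; [by case: (hA s)|by case: (hA s)|].
apply: (@le_trans _ _ (\sum_(s : {ffun 'I_n -> bool}) (2 * q + (bad s)%:R))).
  by apply: ler_sum => s _; case: (hA s).
rewrite big_split /= sumr_const card_ffun card_bool card_ord -[_ *+ _]mulr_natl natrX mulrDr lerD2l.
have Kn : 0 < K ^+ 2 * n%:R by rewrite mulr_gt0// ?exprn_gt0// ltr0n.
rewrite ler_pdivlMr ?exprn_gt0// -(ler_pM2r (x := n%:R)) ?ltr0n// -mulrA big_distrl /=.
apply: (@le_trans _ _ (\sum_(s : {ffun 'I_n -> bool}) rsum s (finset.setTfor 'I_n) one ^+ 2)).
  apply: ler_sum => s _; rewrite /bad; case: ltP => h /=; last by rewrite mul0r sqr_ge0.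
  rewrite mul1r -[leRHS]real_normK ?num_real// -[X in _ * X](@sqr_sqrtr _ n%:R)// -exprMn.
  by rewrite ler_sqr ?nnegrE// ltW// mulr_gt0.
rewrite sum_rsum_sq (eq_bigr (fun=> 1)); last by move=> i _; rewrite expr1n.
by rewrite sumr_const card_ord.
Qed.

End desymmetrization.

Section l2.
Context d (T : measurableType d) (R : realType) (P : probability T R).

Lemma bm_sqr (g : T -> R) : bm g -> bm (fun x => g x ^+ 2).
Proof. by move=> bg; under eq_fun do rewrite expr2; exact: bmM. Qed.

(** The conclusion involves no sample, so a single good one suffices. For it the sum of g ^ 2 is the
    average of the squared sign sums. Only most of these are known to be small, but the charges
    bound their average by 2 * l ^ 2 with l = sqrt n * tau. Chebyshev's inequality for g ^ 2
    accounts for the third tau ^ 2. *)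
Lemma l2_bound n (A : {ffun 'I_n -> bool} -> set (n.-tuple T)) (tau eps : R) (g : T -> R) :
  (0 < n)%N -> 0 < tau -> 2 <= Num.sqrt n%:R * tau -> 64 <= tau ^+ 4 * n%:R ->
  64 * eps <= 4^-1 -> bm g -> (forall x, `|g x| <= 2) ->
  (forall s, measurable (A s)) ->
  (forall s x, ~ A s x ->
    `|rsum s (finset.setTfor 'I_n) (fun i => g (tnth x i))| <= Num.sqrt n%:R * tau) ->
  \sum_s fine (iid_law P n (A s)) <= 2 ^+ n * eps ->
  \int[P]_x (g x ^+ 2) <= 3 * tau ^+ 2.
Proof.
move=> n0 tau0 tau2 tau4 eps4 bg g2 mA Ag sA.
have n0' : 0 < n%:R :> R by rewrite ltr0n.
have N0 : 0 < 2 ^+ n / 64 :> R by rewrite divr_gt0// exprn_gt0.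
have bg2 := bm_sqr bg.
pose k x := g x ^+ 2 - \int[P]_y (g y ^+ 2).
have g24 x : 0 <= g x ^+ 2 <= 4.
  rewrite sqr_ge0 /= -real_normK ?num_real// (_ : 4 = 2 ^+ 2); last by ring.
  by rewrite ler_sqr ?nnegrE.
have Ig : 0 <= \int[P]_y (g y ^+ 2) <= 4.
  rewrite -[X in X <= _ <= _](bm_integral_cst P) -[X in _ <= _ <= X](bm_integral_cst P).
  by apply/andP; split; apply: bm_integral_le => //; try exact: bm_cst; move=> x; case/andP: (g24 x).
have bk : bm k by apply: bmB => //; exact: bm_cst.
have k0 : \int[P]_x k x = 0.
  by rewrite bm_integralB//; [rewrite bm_integral_cst subrr|exact: bm_cst].
have k16 : \int[P]_x (k x ^+ 2) <= 16.
  rewrite -[leRHS](bm_integral_cst P); apply: bm_integral_le; [exact: bm_sqr|exact: bm_cst|].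
  move=> x; rewrite -real_normK ?num_real// (_ : 16 = 4 ^+ 2); last by ring.
  rewrite ler_sqr ?nnegrE// ler_norml /k; have /andP[a1 a2] := g24 x; have /andP[i1 i2] := Ig.
  by apply/andP; split; lra.
pose r := tau ^+ 2 * n%:R; have r0 : 0 < r by rewrite mulr_gt0// exprn_gt0.
have [D [mD ED Dq]] := smallU (count_markov (iid_law P n) mA N0) (iid_chebyshev n bk k0 r0).
(* Markov's inequality contributes [64 * eps] and Chebyshev's 16 / (tau ^ 4 * n), each at most
   1/4. *)
have Dlt1 : (iid_law P n D < 1)%E.
  apply: (le_lt_trans Dq); rewrite lte_fin.
  have h1 : \sum_i fine (iid_law P n (A i)) / (2 ^+ n / 64) <= 4^-1.
    rewrite -big_distrl /= ler_pdivrMr//; apply: (le_trans sA).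
    have -> : 4^-1 * (2 ^+ n / 64) = 2 ^+ n * (4^-1 / 64) :> R by ring.
    by apply: ler_wpM2l; [rewrite exprn_ge0|lra].
  have h2 : n%:R * \int[P]_x k x ^+ 2 / r ^+ 2 <= 4^-1.
    rewrite ler_pdivrMr ?exprn_gt0//; apply: (@le_trans _ _ (n%:R * 16)).
      by apply: ler_wpM2l.
    have -> : r ^+ 2 = n%:R * (tau ^+ 4 * n%:R) by rewrite /r; ring.
    by rewrite mulrCA; apply: ler_wpM2l => //; lra.
  lra.
have [x Dx] : exists x, ~ D x.
  apply/not_existsP => h; move: Dlt1; rewrite (_ : D = setT) ?probability_setT ?ltxx//.
  by apply/seteqP; split=> // x _; apply: contrapT; exact: h.
have hx1 : ~ 2 ^+ n / 64 < \sum_i \1_(A i) x :> R by move=> h; apply: Dx; apply: ED; left.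
have hx2 : `|\sum_(i < n) k (tnth x i)| <= r.
  by rewrite leNgt; apply/negP => h; apply: Dx; apply: ED; right.
pose G : set ('I_n -> R) := [set fun i => g (tnth x i)].
pose l := Num.sqrt n%:R * tau.
have bl : 0 <= (2 : R) <= l by apply/andP; split=> //; exact: ler0n.
have Gb h : G h -> forall i, `|h i| <= 2 by move=> -> i.
have ch1 : {in [set finset.setTfor 'I_n]%SET &, forall J K : {set 'I_n}, (J \subset K) || (K \subset J)}.
  by move=> J K /set1P -> /set1P ->; rewrite subxx.
have hc : (64 * #|hits G l [set finset.setTfor 'I_n]%SET| <= 2 ^ n)%N.
  rewrite leqNgt; apply/negP; rewrite -(ltr_nat R) natrX natrM => h; apply: hx1.
  rewrite ltr_pdivrMr// mulrC; apply: (lt_le_trans h); apply: ler_wpM2l => //.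
  rewrite -sum1_card natr_sum big_mkcond /=; apply: ler_sum => s _.
  case: ifP => // sh; rewrite indicE mem_set//; apply: contrapT => nA.
  move: sh; rewrite inE => /existsP[J /andP[/set1P -> /asboolP[h' -> lh]]].
  by move: lh; rewrite ltNge (Ag s x nA).
have := sum_weight bl Gb hc ch1; rewrite -(ler_nat R) natr_sum natrM natrX => hw.
have h1 : 2 ^+ n * \sum_i g (tnth x i) ^+ 2 <= l ^+ 2 * (2 * 2 ^+ n).
  rewrite -sum_rsum_sq; apply: le_trans (ler_wpM2l (sqr_ge0 _) hw).
  rewrite big_distrr /=; apply: ler_sum => s _.
  have fin : finset.setTfor 'I_n \in [set finset.setTfor 'I_n]%SET by rewrite inE.
  by have [_] := weight_bound s bl Gb (erefl : G (fun i => g (tnth x i))) fin.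
have {}h1 : \sum_i g (tnth x i) ^+ 2 <= 2 * r.
  have : 2 ^+ n * \sum_i g (tnth x i) ^+ 2 <= 2 ^+ n * (2 * r).
    apply: (le_trans h1); rewrite /l exprMn sqr_sqrtr// /r; lra.
  by rewrite ler_pM2l ?exprn_gt0.
have : n%:R * \int[P]_y (g y ^+ 2) <= n%:R * (3 * tau ^+ 2).
  have -> : n%:R * \int[P]_y (g y ^+ 2) = \sum_(i < n) g (tnth x i) ^+ 2 - \sum_(i < n) k (tnth x i).
    rewrite -sumrB (eq_bigr (fun=> \int[P]_y (g y ^+ 2))); last by move=> i _; rewrite /k; ring.
    by rewrite sumr_const card_ord -[RHS]mulr_natl.
  have := hx2; rewrite ler_norml => /andP[h2 _].
  apply: (@le_trans _ _ (3 * r)); first by lra.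
  by rewrite /r; lra.
by rewrite ler_pM2l.
Qed.

Lemma equicontinuity (F : set (T -> R)) (lam q : R) : donsker P F ->
  (forall f, F f -> bm f /\ forall x, `|f x| <= 1) -> 0 < lam -> 0 < q ->
  exists (I : finType) (k : F -> I), \forall n \near \oo, forall W : R -> T -> R,
    monotone_weight W ->
    small (iid_law P n) [set s | exists f g : F, k f = k g /\ exists v,
      9 * lam < `|emp_process P s (fun x => W v x * (val f x - val g x))|] q.
Proof.
move=> dF bF lam0 q0.
(* The constants make eps = 2 * q' + K ^ -2 at most q1 / 512, so that 64 * eps and 2 * tau / lam are
   each at most q1 / 8 and four times their sum is at most q1. The cap at 1 gives K >= 1 and the
   bound 64 * eps <= 1/4 required for the second moments. The 3 in tau = 3 * t comes from
   desymmetrization. *)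
pose q1 := Num.min q 1.
have q10 : 0 < q1 by rewrite lt_min q0 ltr01.
have q1q : q1 <= q by rewrite ge_min lexx.
have q11 : q1 <= 1 by rewrite ge_min lexx orbT.
pose q' := q1 / (32 * 64); have q'0 : 0 < q' by rewrite divr_gt0// mulr_gt0.
pose K := 32 * 32 / q1; have K0 : 0 < K by rewrite divr_gt0// mulr_gt0.
pose tau := q1 * lam / 16; have tau0 : 0 < tau by rewrite divr_gt0// mulr_gt0.
pose t := tau / 3; have t0 : 0 < t by rewrite divr_gt0.
have bFv (f : F) : bm (val f) /\ forall x, `|val f x| <= 1 by apply: bF; exact: set_valP.
have [I [k [n0 _ kP]]] := donsker_partition dF t0 q'0.
have uF (f : F) : `|\int[P]_x val f x| <= 1.
  have [bf f1] := bFv f; rewrite ler_norml.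
  rewrite -[X in X <= _ <= _](bm_integral_cst P) -[X in _ <= _ <= X](bm_integral_cst P).
  by apply/andP; split; apply: bm_integral_le => //; try exact: bm_cst;
    move=> x; have := f1 x; rewrite ler_norml => /andP[].
(* Cells also fix the mean up to t / K, so that its product with a sum of signs of order K * sqrt n
   stays below t * sqrt n. *)
have [J [l lP]] := @finite_partition F R (fun f => \int[P]_x val f x) 1 (t / K) (divr_gt0 t0 K0) uF.
exists (I * J)%type, (fun f => (k f, l f)).
pose C (f g : T -> R) := exists f' g' : F, [/\ (k f', l f') = (k g', l g'), f = val f' & g = val g'].
have bC f g : C f g -> [/\ bm f, bm g, forall x, `|f x| <= 1 & forall x, `|g x| <= 1].
  move=> [f' [g' [_ -> ->]]]; have [? ?] := bFv f'; have [? ?] := bFv g'; by split.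
have Ct m : (n0 <= m)%N -> small (iid_law P m) [set s | exists f g, C f g /\
    t < `|emp_process P s f - emp_process P s g|] q'.
  move=> n0m; apply: small_sub (kP _ n0m) => s [_ [_ [[f [g [[kfg _] -> ->]]] h]]].
  by exists f, g.
have Cmean f g : C f g -> K * `|\int[P]_y (f y - g y)| <= t.
  move=> [f' [g' [[_ lfg] -> ->]]]; rewrite bm_integralB; [|by case: (bFv f')|by case: (bFv g')].
  by rewrite mulrC -ler_pdivlMr//; exact: lP.
have eps_le : 2 * q' + (K ^+ 2)^-1 <= q1 / (8 * 64).
  have h : (K ^+ 2)^-1 <= K^-1.
    have K1 : 1 <= K by rewrite /K ler_pdivlMr// mul1r; lra.
    by rewrite lef_pV2 ?posrE ?exprn_gt0// expr2 ler_peMr// ltW.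
  have {}h : (K ^+ 2)^-1 <= q1 / (32 * 32) by apply: (le_trans h); rewrite /K invf_div.
  by apply: (le_trans (lerD (lexx _) h)); rewrite /q'; lra.
near=> n => W mw.
have n_gt0 : (0 < n)%N by near: n; exists 1%N.
have hn1 : 4 * n0%:R <= Num.sqrt n%:R * t.
  by rewrite -ler_pdivrMr//; near: n; exact: near_sqrt.
have hn2 : 2 <= Num.sqrt n%:R * tau.
  by rewrite -ler_pdivrMr//; near: n; exact: near_sqrt.
have hn3 : 2 <= Num.sqrt n%:R * lam.
  by rewrite -ler_pdivrMr//; near: n; exact: near_sqrt.
have hn4 : 64 <= tau ^+ 4 * n%:R.
  by rewrite mulrC -ler_pdivrMr ?exprn_gt0//; near: n; exact: nbhs_infty_ger.
have [A [mA AC sA]] := desymmetrization bC t0 (ltW q'0) Ct hn1 n_gt0 K0 Cmean.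
have t3 : 3 * t = tau by rewrite /t; field.
pose G := [set h | exists f g, C f g /\ h = fun x => f x - g x].
have Gb h : G h -> bm h /\ forall x, `|h x| <= 2.
  move=> [f [g [/bC[bf bg f1 g1] ->]]]; split; first exact: bmB.
  by move=> x; apply: (le_trans (ler_normB _ _)); have := f1 x; have := g1 x; lra.
have AG s x : ~ A s x -> forall h, G h ->
    `|rsum s (finset.setTfor 'I_n) (fun i => h (tnth x i))| <= Num.sqrt n%:R * tau.
  by move=> nA h [f [g [Cfg ->]]]; rewrite -t3; exact: AC.
have G2 h : G h -> \int[P]_x (h x ^+ 2) <= lam ^+ 2.
  move=> Gh; have [bh h2] := Gb _ Gh.
  have e4 : 64 * (2 * q' + (K ^+ 2)^-1) <= 4^-1 by lra.
  have := l2_bound n_gt0 tau0 hn2 hn4 e4 bh h2 mA (fun s x nA => AG s x nA h Gh) sA.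
  move=> /le_trans; apply.
  have taul : tau <= lam / 2.
    have : q1 * lam <= 1 * lam by apply: ler_wpM2r; [exact: ltW|].
    by rewrite /tau; lra.
  apply: (@le_trans _ _ (3 * (lam / 2) ^+ 2)).
    by apply: ler_wpM2l => //; rewrite ler_sqr ?nnegrE//; [exact: ltW|rewrite divr_ge0// ltW].
  have -> : 3 * (lam / 2) ^+ 2 = lam ^+ 2 * (3 / 4) by field.
  by rewrite -[leRHS]mulr1; apply: ler_wpM2l; [exact: sqr_ge0|lra].
have b2 : 0 <= (2 : R) <= Num.sqrt n%:R * tau by apply/andP; split=> //; exact: ler0n.
have sm := weighted_process b2 lam0 hn3 n_gt0 Gb G2 mA AG sA mw.
apply: small_le (small_sub _ sm).
  apply: le_trans q1q; have -> : 2 * tau / lam = q1 / 8 by rewrite /tau; field; rewrite gt_eqF.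
  lra.
move=> s [f [g [kfg [v h]]]]; exists (fun x => val f x - val g x); last by exists v.
by exists (val f), (val g); split=> //; exists f, g.
Unshelve. all: by end_near. Qed.

(** For one function the second moment controls the unweighted sign sums: averaged over signs, the
    probability of exceeding t * sqrt n is at most E g ^ 2 / t ^ 2. With t = q * lam / 16 both
    contributions to the final probability are at most q / 2. *)
Lemma single_function (g : T -> R) (W : R -> T -> R) (lam q : R) :
  bm g -> monotone_weight W -> 0 < lam -> 0 < q ->
  \int[P]_x (g x ^+ 2) <= lam ^+ 2 ->
  64 * (8 * \int[P]_x (g x ^+ 2)) <= q * (q * lam / 16) ^+ 2 ->
  \forall n \near \oo, small (iid_law P n) [set s | exists v,
     9 * lam < `|emp_process P s (fun x => W v x * g x)|] q.
Proof.
move=> bg mw lam0 q0 g2 g3; have [mg [b gb]] := bg.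
pose t := q * lam / 16; have t0 : 0 < t by rewrite divr_gt0// mulr_gt0.
have bg2 := bm_sqr bg.
have b0 : 0 <= Num.max b 0 by rewrite le_max lexx orbT.
near=> n.
have n_gt0 : (0 < n)%N by near: n; exists 1%N.
have hn1 : Num.max b 0 <= Num.sqrt n%:R * t.
  by rewrite -ler_pdivrMr//; near: n; exact: near_sqrt.
have hn2 : Num.max b 0 <= Num.sqrt n%:R * lam.
  by rewrite -ler_pdivrMr//; near: n; exact: near_sqrt.
have sn : 0 < Num.sqrt n%:R :> R by rewrite sqrtr_gt0 ltr0n.
pose l := Num.sqrt n%:R * t; have l0 : 0 < l by rewrite mulr_gt0.
pose rs s (x : n.-tuple T) := rsum s (finset.setTfor 'I_n) (fun i => g (tnth x i)).
have brs s : bm (rs s).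
  rewrite /rs; under eq_fun do rewrite rsumT.
  by apply: bm_sum => i; apply: bmM; [exact: bm_cst|exact: bm_tnth].
pose A s := [set x | l < `|rs s x|].
have mA s : measurable (A s).
  rewrite -[X in measurable X]setTI.
  have mn : measurable_fun setT (fun x => `|rs s x|) by apply: measurableT_comp => //; exact: (brs s).1.
  by have := mn measurableT `]l, +oo[%classic (measurable_itv _); rewrite set_itvE.
have sA : \sum_s fine (iid_law P n (A s)) <= 2 ^+ n * (\int[P]_x (g x ^+ 2) / t ^+ 2).
  rewrite -count_integral//.
  apply: (@le_trans _ _ (\int[iid_law P n]_x (2 ^+ n / l ^+ 2 * \sum_i g (tnth x i) ^+ 2))).
    have bS : bm (fun x : n.-tuple T => \sum_i g (tnth x i) ^+ 2).
      by apply: bm_sum => i; exact: (bm_tnth i bg2).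
    apply: bm_integral_le; [by apply: bm_sum => s; exact: bm_indic|by apply: bmM => //; exact: bm_cst|].
    move=> x; rewrite mulrAC ler_pdivlMr ?exprn_gt0// -sum_rsum_sq big_distrl /=.
    apply: ler_sum => s _; rewrite indicE; case: (boolP (x \in A s)) => /=; last by rewrite mul0r sqr_ge0.
    rewrite inE mul1r => h; rewrite -[leRHS]real_normK ?num_real// ler_sqr ?nnegrE//; last exact: ltW.
    exact: ltW.
  have bS i : bm (fun x : n.-tuple T => g (tnth x i) ^+ 2) by exact: (bm_tnth i bg2).
  rewrite bm_integralZ; last by exact: bm_sum.
  rewrite bm_integral_sum// (eq_bigr (fun=> \int[P]_x (g x ^+ 2))); last first.
    by move=> i _; rewrite (iid_integral_tnth P i bg2).
  rewrite sumr_const card_ord; set w := \int[P]_x _; rewrite -(mulr_natl w) /l exprMn sqr_sqrtr//.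
  by rewrite le_eqVlt; apply/orP; left; apply/eqP; field; rewrite !gt_eqF// ltr0n.
have b2 : 0 <= Num.max b 0 <= Num.sqrt n%:R * t by rewrite b0.
have sm := @weighted_process _ _ _ P n [set g] A W (Num.max b 0) t _ lam b2 lam0 hn2 n_gt0 _ _ mA _ sA mw.
apply: small_le (small_sub _ (sm _ _ _)).
- have -> : 2 * t / lam = q / 8 by rewrite /t; field; rewrite gt_eqF.
  have : \int[P]_x g x ^+ 2 / t ^+ 2 <= q / (8 * 64).
    rewrite ler_pdivrMr ?exprn_gt0// mulrAC ler_pdivlMr ?mulr_gt0//.
    by move: g3; rewrite -/t; lra.
  lra.
- by move=> s [v h]; exists g => //; exists v.
- by move=> _ ->; split=> // x; apply: (le_trans (gb x)); rewrite le_max lexx.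
- by move=> _ ->.
- by move=> s x nA _ ->; rewrite leNgt; apply/negP.
Unshelve. all: by end_near. Qed.

End l2.

(** * Medians, scores and influence functions *)

Section cond_cdf.
Context dX (X : measurableType dX) (R : realType) (pY : R.-pker (X * bool) ~> R).

Definition cond_prob (z : X * bool) : set R -> \bar R := pY z.
HB.instance Definition _ z := Measure.on (cond_prob z).
HB.instance Definition _ z :=
  Measure_isProbability.Build _ _ _ (cond_prob z) (prob_kernel z).

Let crv z : {RV (cond_prob z) >-> R} :=
  HB.pack (idfun : R -> R) (isMeasurableFun.Build _ _ R R idfun (@measurable_id _ R setT)).

Let cdfE m a x : (cond_cdf pY m a x)%:E = cdf (crv (x, a)) m.
Proof.
rewrite /cond_cdf fineK //.
exact: (@fin_num_measure _ _ _ (cond_prob (x, a))).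
Qed.

Lemma cond_cdf_01 m a x : 0 <= cond_cdf pY m a x <= 1.
Proof. by rewrite -!lee_fin cdfE cdf_ge0 cdf_le1. Qed.

Lemma cond_cdf_homo a x m m' : m <= m' -> cond_cdf pY m a x <= cond_cdf pY m' a x.
Proof. by move=> mm; rewrite -lee_fin !cdfE; exact: cdf_nondecreasing. Qed.

Lemma cond_cdf_right v a x e : 0 < e -> exists2 u, v < u &
  cond_cdf pY u a x < cond_cdf pY v a x + e.
Proof.
move=> e0; have h := @cdf_right_continuous _ _ _ _ (crv (x, a)) v.
have : \forall u \near v^'+, (cdf (crv (x, a)) u < (cond_cdf pY v a x + e)%:E)%E.
  apply: (h [set y | (y < (cond_cdf pY v a x + e)%:E)%E]).
  apply: open_nbhs_nbhs; split; first exact: open_ereal_lt_ereal.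
  have l : ((cond_cdf pY v a x)%:E < (cond_cdf pY v a x + e)%:E)%E by rewrite lte_fin ltrDl.
  by rewrite cdfE in l; exact: l.
move=> /(filterI (nbhs_right_gt v)) /filter_ex[u [vu hu]].
by exists u => //; rewrite -lte_fin cdfE; exact: hu.
Qed.

Lemma measurable_cond_cdf m : measurable_fun setT (fun z : X * bool => cond_cdf pY m z.2 z.1).
Proof.
apply: (measurableT_comp (fine_measurable measurableT)).
rewrite (_ : (fun z => _) = pY ^~ `]-oo, m]%classic).
  exact: measurable_kernel.
by apply/funext => -[].
Qed.

Lemma cond_cdf_cvgy a x : cond_cdf pY n%:R a x @[n --> \oo] --> (1 : R).
Proof.
have h := cvg_cdfy1 (crv (x, a)).
have {}h : cdf (crv (x, a)) n%:R @[n --> \oo] --> 1%E.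
  by apply: cvg_comp h; exact/cvgryPge/nbhs_infty_ger.
by apply: (fine_cvg h).
Qed.

Lemma cond_cdf_cvgNy a x : cond_cdf pY (- n%:R) a x @[n --> \oo] --> (0 : R).
Proof.
have h := cvg_cdfNy0 (crv (x, a)).
have {}h : cdf (crv (x, a)) (- n%:R) @[n --> \oo] --> 0%E.
  apply: cvg_comp h; apply/cvgrNyPle => A; near=> n.
  by rewrite lerNl; near: n; exact: nbhs_infty_ger.
by apply: (fine_cvg h).
Unshelve. all: by end_near. Qed.

Section policies.
Variable P : probability (X * bool * R)%type R.
Local Notation obs := (X * bool * R)%type.

Lemma measurable_covariate : measurable_fun setT (covariate : obs -> X).
Proof. exact: (measurableT_comp measurable_fst measurable_fst). Qed.

Lemma measurable_action : measurable_fun setT (action : obs -> bool).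
Proof. exact: (measurableT_comp measurable_snd measurable_fst). Qed.

Lemma measurable_reward : measurable_fun setT (reward : obs -> R).
Proof. exact: measurable_snd. Qed.

Lemma bm_cond_cdf m (a : obs -> bool) : measurable_fun setT a ->
  bm (fun o => cond_cdf pY m (a o) (covariate o)).
Proof.
move=> ma; apply: (@bm_comp _ _ _ _ _ (fun o => (covariate o, a o)) (fun z => cond_cdf pY m z.2 z.1)).
  by apply: measurable_fun_pair => //; exact: measurable_covariate.
split; first exact: measurable_cond_cdf.
by exists 1 => z; have /andP[h0 h1] := cond_cdf_01 m z.2 z.1; rewrite ger0_norm.
Qed.

Lemma measurable_policy (pi : policy X) : measurable_fun setT (fun o : obs => pi (covariate o)).
Proof. by apply: measurableT_comp => //; exact: measurable_covariate. Qed.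

Lemma bm_policy_cdf (pi : policy X) m : bm (fun o : obs => cond_cdf pY m (pi (covariate o)) (covariate o)).
Proof. by apply: bm_cond_cdf; exact: measurable_policy. Qed.

Lemma cdf_sum_cvg (u : nat -> R) (l : R) :
  (forall a x, cond_cdf pY (u n) a x @[n --> \oo] --> l) ->
  \int[P]_o (cond_cdf pY (u n) true (covariate o) + cond_cdf pY (u n) false (covariate o))
    @[n --> \oo] --> l + l.
Proof.
move=> ul; rewrite -[X in _ --> X](bm_integral_cst P).
have bs n : bm (fun o : obs => cond_cdf pY (u n) true (covariate o) + cond_cdf pY (u n) false (covariate o)).
  by apply: bmD; exact: bm_cond_cdf.
have [] := @dominated_convergence _ _ _ P setT measurableT
  (fun n o => (cond_cdf pY (u n) true (covariate o) + cond_cdf pY (u n) false (covariate o))%:E)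
  (fun=> (l + l)%:E) (fun=> 2%:E) _ _ _ _ _.
- by move=> n; apply/measurable_EFinP; case: (bs n).
- exact: measurable_cst.
- by apply: aeW => o _; apply: cvg_EFin; [exact: nearW|apply: cvgD; exact: ul].
- by have := bm_integrable P (bm_cst _ 2).
- apply: aeW => o n _; rewrite lee_fin.
  have /andP[h0 h1] := cond_cdf_01 (u n) true (covariate o).
  have /andP[h2 h3] := cond_cdf_01 (u n) false (covariate o).
  by rewrite ger0_norm; lra.
move=> _ _ h; apply: fine_cvg.
rewrite /Rintegral fineK//.
exact: (integrable_fin_num measurableT (bm_integrable P (bm_cst _ (l + l)))).
Qed.

Lemma policy_cdf_homo pi m m' : m <= m' -> policy_cdf P pY pi m <= policy_cdf P pY pi m'.
Proof.
move=> mm; apply: bm_integral_le; try exact: bm_policy_cdf.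
by move=> o; exact: cond_cdf_homo.
Qed.

(** Let s(m) be the mean of the sum of the conditional distribution functions of both actions. Then
    s(m) - 1 <= F_pi(m) <= s(m) for every policy, and s tends to 2 and to 0 at the two ends, so two
    thresholds with s > 3/2 and s < 1/2 bracket all medians. *)
Lemma median_bounded : exists M, forall pi : policy X, `|median_value P pY pi| <= M.
Proof.
pose s (m : R) := \int[P]_o (cond_cdf pY m true (covariate o) + cond_cdf pY m false (covariate o)).
have [n1 hn1] : exists n : nat, 3 / 2 < s n%:R.
  have /cvgrPdist_lt/(_ (1 / 2)) := cdf_sum_cvg cond_cdf_cvgy.
  rewrite divr_gt0// => /(_ isT)/filter_ex[n]; rewrite -/(s _) ltr_norml => /andP[? ?].
  by exists n; lra.
have [n2 hn2] : exists n : nat, s (- n%:R) < 1 / 2.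
  have /cvgrPdist_lt/(_ (1 / 2)) := cdf_sum_cvg cond_cdf_cvgNy.
  rewrite divr_gt0// => /(_ isT)/filter_ex[n]; rewrite -/(s _) ltr_norml => /andP[? ?].
  by exists n; lra.
have bs m : bm (fun o : obs => cond_cdf pY m true (covariate o) + cond_cdf pY m false (covariate o)).
  by apply: bmD; exact: bm_cond_cdf.
exists (n1%:R + n2%:R) => pi.
have h1 : 2^-1 <= policy_cdf P pY pi n1%:R.
  apply: (@le_trans _ _ (s n1%:R - 1)); first by lra.
  rewrite -[X in _ - X](bm_integral_cst P 1) -bm_integralB//; last exact: bm_cst.
  apply: bm_integral_le; [by apply: bmB => //; exact: bm_cst|exact: bm_policy_cdf|].
  move=> o; have /andP[? ?] := cond_cdf_01 n1%:R true (covariate o).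
  have /andP[? ?] := cond_cdf_01 n1%:R false (covariate o).
  by case: (pi _); lra.
have h2 m : 2^-1 <= policy_cdf P pY pi m -> - n2%:R <= m.
  move=> hm; rewrite leNgt; apply/negP => /ltW/(policy_cdf_homo pi) h.
  have : policy_cdf P pY pi (- n2%:R) <= s (- n2%:R).
    apply: bm_integral_le; [exact: bm_policy_cdf|exact: bs|].
    move=> o; have /andP[? ?] := cond_cdf_01 (- n2%:R) true (covariate o).
    have /andP[? ?] := cond_cdf_01 (- n2%:R) false (covariate o).
    by case: (pi _); lra.
  by move: hn2; lra.
have v1 : median_value P pY pi <= n1%:R.
  by apply: ge_inf => //; exists (- n2%:R) => m; exact: h2.
have v2 : - n2%:R <= median_value P pY pi.
  by apply: lb_le_inf; [exists n1%:R|move=> m; exact: h2].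
have n1_0 : 0 <= n1%:R :> R by [].
have n2_0 : 0 <= n2%:R :> R by [].
by rewrite ler_norml; apply/andP; split; lra.
Qed.

End policies.

End cond_cdf.

Section weights.
Context d (T : measurableType d) (R : realType).

Lemma mw_scale (w : T -> R) (V : R -> T -> R) : measurable_fun setT w ->
  (forall o, 0 <= w o <= 1) -> monotone_weight V -> monotone_weight (fun v o => w o * V v o).
Proof.
move=> mw w01 [V01 Vhomo Vmeas Vright]; split.
- move=> v o; have /andP[w0 w1] := w01 o; have /andP[v0 v1] := V01 v o.
  by rewrite mulr_ge0//= mulr_ile1.
- by move=> u v o uv; have /andP[w0 w1] := w01 o; apply: ler_wpM2l => //; exact: Vhomo.
- by move=> v; exact: measurable_funM.
- move=> v o e e0; have [u vu Vu] := Vright v o e e0; exists u => //.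
  have /andP[w0 w1] := w01 o; have h := Vhomo _ _ o (ltW vu).
  have : w o * (V u o - V v o) <= V u o - V v o.
    by rewrite ler_piMl// subr_ge0.
  by rewrite mulrBr; lra.
Qed.

(** The fraction of the increment of [F] over [u, w] that is reached at v, clipped so that it is a
    weight for all real v. Where the increment is 0 its inverse is 0, and so is the weight. *)
Lemma mw_clip (F : R -> T -> R) (u w : R) : u <= w ->
  (forall m m' o, m <= m' -> F m o <= F m' o) ->
  (forall m, measurable_fun setT (F m)) ->
  (forall v o e, 0 < e -> exists2 z, v < z & F z o < F v o + e) ->
  monotone_weight (fun v o => Num.min 1 (Num.max 0 ((F v o - F u o) * (F w o - F u o)^-1))).
Proof.
move=> uw Fhomo Fmeas Fright; have D0 o : 0 <= F w o - F u o by rewrite subr_ge0 Fhomo.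
have Di o : 0 <= (F w o - F u o)^-1 by rewrite invr_ge0.
split.
- by move=> v o; rewrite le_min ler01 le_max lexx /= ge_min lexx.
- move=> v v' o vv; apply: le_min2 => //; apply: le_max2 => //.
  by apply: ler_wpM2r => //; rewrite lerD2r Fhomo.
- move=> v; apply: measurable_minr => //; apply: measurable_maxr => //.
  apply: measurable_funM; first exact: measurable_funB.
  have -> : (fun o => (F w o - F u o)^-1) = fun o => powR (F w o - F u o) (-1).
    by apply/funext => o; rewrite powR_inv1.
  by apply: (measurableT_comp (measurable_powR _)); exact: measurable_funB.
- move=> v o e e0.
  have [D1|D1] := eqVneq (F w o - F u o) 0.
    by exists (v + 1); [rewrite ltrDl|rewrite D1 invr0 !mulr0 ltrDl].
  have Dpos : 0 < F w o - F u o by rewrite lt_def D1 D0.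
  have [z vz hz] := Fright v o _ (mulr_gt0 e0 Dpos); exists z => //.
  have h : (F z o - F u o) * (F w o - F u o)^-1 < (F v o - F u o) * (F w o - F u o)^-1 + e.
    rewrite -ltrBlDl -mulrBl ltr_pdivrMr//; lra.
  move: h; move: (_ * _) ((F v o - F u o) * _) => a b ab.
  have h2 : Num.max 0 a < Num.max 0 b + e.
    by case: (leP 0 a) => ?; case: (leP 0 b) => ?; lra.
  move: h2; move: (Num.max _ _) (Num.max _ _) => c f cf.
  by case: (leP 1 c) => ?; case: (leP 1 f) => ?; lra.
Qed.

Lemma clip_mul (x D : R) : 0 <= x <= D -> D * Num.min 1 (Num.max 0 (x * D^-1)) = x.
Proof.
move=> /andP[x0 xD]; have [D0|D0] := eqVneq D 0; first by rewrite D0 mul0r; lra.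
have Dpos : 0 < D by rewrite lt_def D0 (le_trans x0).
rewrite max_r ?divr_ge0 ?(ltW Dpos)// min_r; last by rewrite ler_pdivrMr// mul1r.
by rewrite mulrCA divff// mulr1.
Qed.

End weights.

Lemma mulr_1Ddiv (R : realType) (w c : R) : 0 < w -> w * (1 + c / w) = w + c.
Proof. by move=> w0; field; rewrite gt_eqF. Qed.

Section policies.
Context dX (X : measurableType dX) (R : realType).
Variables (P : probability (X * bool * R)%type R).
Variables (pA : R.-pker X ~> bool) (pY : R.-pker (X * bool) ~> R).
Variable delta : R.
Hypothesis delta01 : 0 < delta < 2^-1.
Local Notation obs := (X * bool * R)%type.
Implicit Types (pi : policy X) (o : obs).

Let delta0 : 0 < delta. Proof. by case/andP: delta01. Qed.
Let delta1 : delta <= 1. Proof. by have /andP[_ h] := delta01; lra. Qed.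

(** The inverse propensity weight, scaled by [delta] to lie in [0, 1] as a monotone weight must;
    [score] restores the factor. *)
Definition ipw (a : bool) o : R :=
  delta * ((action o == a)%:R * (Num.max delta (propensity pA a (covariate o)))^-1).

Lemma measurable_eqb (f : obs -> bool) a : measurable_fun setT f ->
  measurable_fun setT (fun o => (f o == a)%:R : R).
Proof.
move=> mf; apply: (measurableT_comp (f := fun b : bool => (b == a)%:R : R)) => //.
Qed.

Lemma measurable_propensity a : measurable_fun setT (fun o : obs => propensity pA a (covariate o)).
Proof.
apply: (measurableT_comp (f := propensity pA a)); last exact: measurable_covariate.
apply: (measurableT_comp (fine_measurable measurableT)).
exact: measurable_kernel.
Qed.

Lemma measurable_inv (f : obs -> R) : (forall o, 0 <= f o) -> measurable_fun setT f ->
  measurable_fun setT (fun o => (f o)^-1).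
Proof.
move=> f0 mf; have -> : (fun o => (f o)^-1) = fun o => powR (f o) (-1).
  by apply/funext => o; rewrite powR_inv1.
exact: (measurableT_comp (measurable_powR _)).
Qed.

Lemma ipw_01 a o : 0 <= ipw a o <= 1.
Proof.
have m : delta <= Num.max delta (propensity pA a (covariate o)) by rewrite le_max lexx.
have m0 := lt_le_trans delta0 m.
rewrite /ipw; apply/andP; split.
  by apply: mulr_ge0; [exact: ltW|apply: mulr_ge0 => //; rewrite invr_ge0 ltW].
rewrite mulrCA; case: (_ == a); rewrite ?mul0r ?mul1r//.
by rewrite ler_pdivrMr// mul1r.
Qed.

Lemma measurable_ipw a : measurable_fun setT (ipw a).
Proof.
apply: measurable_funM => //; apply: measurable_funM.
  by apply: measurable_eqb; exact: measurable_action.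
apply: measurable_inv.
  by move=> o; rewrite le_max ltW.
by apply: measurable_maxr => //; exact: measurable_propensity.
Qed.

Definition fam (a : bool) (j : nat) (v : R) o : R :=
  match j with
  | 0 => ipw a o * (reward o <= v)%R%:R
  | 1 => ipw a o * cond_cdf pY v a (covariate o)
  | _ => cond_cdf pY v a (covariate o)
  end.

Lemma mw_cond_cdf a : monotone_weight (fun v o => cond_cdf pY v a (covariate o)).
Proof.
split=> [v o|u v o|v|v o e].
- exact: cond_cdf_01.
- exact: cond_cdf_homo.
- by have [] := @bm_cond_cdf _ _ _ pY v (fun=> a) (measurable_cst _).
- exact: cond_cdf_right.
Qed.

Lemma mw_reward : monotone_weight (fun v o => (reward o <= v)%R%:R : R).
Proof.
split.
- by move=> v o; case: (reward o <= v); rewrite /= ?lexx ?ler01.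
- by move=> u v o uv; rewrite ler_nat; case: (leP (reward o) u) => //= h; rewrite (le_trans h uv).
- move=> v; apply: (measurableT_comp (f := fun b : bool => b%:R : R)) => //.
  by apply: measurable_fun_ler => //; exact: measurable_reward.
- move=> v o e e0; have [h|h] := leP (reward o) v.
    by exists (v + 1); rewrite ?ltrDl// (le_trans h) ?lerDl//= ltrDl.
  exists ((v + reward o) / 2); first by rewrite ltr_pdivlMr//; lra.
  have -> : (reward o <= (v + reward o) / 2) = false by apply/negbTE; rewrite -ltNge; lra.
  by rewrite /= add0r.
Qed.

Lemma mw_fam a j : monotone_weight (fam a j).
Proof.
case: j => [|[|j]].
- by apply: (mw_scale (measurable_ipw a) (ipw_01 a)); exact: mw_reward.
- by apply: (mw_scale (measurable_ipw a) (ipw_01 a)); exact: mw_cond_cdf.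
- exact: mw_cond_cdf.
Qed.

(** The augmented inverse propensity weighted score for the probability that the reward under action
    [a] is at most [v]. *)
Definition score (a : bool) (v : R) o : R :=
  delta^-1 * (fam a 0 v o - fam a 1 v o) + fam a 2 v o.

(* Almost surely, the influence function is - psi / Fdot at the median value;
   truncating the propensity at delta makes psi bounded everywhere. *)
Definition psi pi (v : R) o : R := score (pi (covariate o)) v o - 2^-1.

Lemma bm_fam a j v : bm (fam a j v).
Proof. exact: (mw_bm v (mw_fam a j)). Qed.

Lemma bm_score a v : bm (score a v).
Proof.
by apply: bmD; [apply: bmM; [exact: bm_cst|apply: bmB]|]; exact: bm_fam.
Qed.

Definition chooses pi (a : bool) o : R := (pi (covariate o) == a)%:R.

Lemma measurable_chooses pi a : measurable_fun setT (chooses pi a).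
Proof. by apply: measurable_eqb; exact: measurable_policy. Qed.

Lemma bm_chooses pi a : bm (chooses pi a).
Proof.
split; first exact: measurable_chooses.
by exists 1 => o; rewrite /chooses; case: (_ == a); rewrite ?normr1 ?normr0 ?ler01.
Qed.

Lemma psiE pi v o : psi pi v o =
  score true v o * chooses pi true o + score false v o * chooses pi false o - 2^-1.
Proof.
by rewrite /psi /chooses; case: (pi (covariate o)); rewrite /= ?mulr1 ?mulr0 ?addr0 ?add0r.
Qed.

Lemma bm_psi pi v : bm (psi pi v).
Proof.
have -> : psi pi v = fun o => score true v o * chooses pi true o + score false v o * chooses pi false o - 2^-1.
  by apply/funext => o; exact: psiE.
apply: bmB; last exact: bm_cst.
by apply: bmD; (apply: bmM; [exact: bm_score|exact: bm_chooses]).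
Qed.

Lemma bm_policy_fun pi : bm (policy_fun pi : obs -> R).
Proof.
split; last by exists 1 => o; rewrite /policy_fun /act; case: (pi _); rewrite ?normrN normr1.
apply: (measurableT_comp (f := @act R)) => //; exact: measurable_policy.
Qed.

Lemma policy_fun_le1 pi o : `|policy_fun pi o : R| <= 1.
Proof. by rewrite /policy_fun /act; case: (pi _); rewrite ?normrN normr1. Qed.

Let d1 : 1 <= delta^-1. Proof. by rewrite -[leLHS]invr1 lef_pV2 ?posrE. Qed.

Lemma emp_score n (s : n.-tuple obs) a v (g : obs -> R) B : bm g ->
  (forall j : 'I_3, `|emp_process P s (fun o => fam a j v o * g o)| <= B) ->
  `|emp_process P s (fun o => score a v o * g o)| <= 3 / delta * B.
Proof.
move=> bg hB.
have b j : bm (fun o => fam a j v o * g o) by apply: bmM => //; exact: bm_fam.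
have -> : (fun o => score a v o * g o) = (fun o =>
    delta^-1 * (fam a 0 v o * g o - fam a 1 v o * g o) + fam a 2 v o * g o).
  by apply/funext => o; rewrite /score; ring.
rewrite emp_processD//; last by apply: bmM; [exact: bm_cst|exact: bmB].
rewrite emp_processZ; last exact: bmB.
rewrite emp_processB//.
have := hB ord0; have := hB (inord 1); have := hB (inord 2); rewrite !inordK//= => h2 h1 h0.
apply: (le_trans (ler_normD _ _)); rewrite normrM gtr0_norm ?invr_gt0//.
have B0 : 0 <= B by apply: le_trans h2.
have h3 := ler_normB (emp_process P s (fun o => fam a 0 v o * g o)) (emp_process P s (fun o => fam a 1 v o * g o)).
apply: (@le_trans _ _ (delta^-1 * (2 * B) + delta^-1 * B)).
  apply: lerD; first by apply: ler_wpM2l; [rewrite invr_ge0 ltW|lra].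
  by apply: (le_trans h2); rewrite ler_peMl.
by rewrite le_eqVlt; apply/orP; left; apply/eqP; ring.
Qed.

(** With actions coded as 1 and -1, two policies differ by 0, 2 or -2. Increments of [psi] in the
    policy thus become weighted increments of the Donsker class. *)
Lemma psi_diff pi pi' v o : psi pi v o - psi pi' v o =
  2^-1 * (score true v o * (policy_fun pi o - policy_fun pi' o) -
          score false v o * (policy_fun pi o - policy_fun pi' o)).
Proof.
by rewrite /psi /policy_fun /act; case: (pi _); case: (pi' _) => /=; field.
Qed.

Lemma equicontinuous_psi (Pi : set (policy X)) (lam q : R) :
  donsker P [set policy_fun pi | pi in Pi] -> 0 < lam -> 0 < q ->
  exists (I : finType) (k : policy X -> I), \forall n \near \oo,
    small (iid_law P n) [set s | exists pi pi', [/\ Pi pi, Pi pi', k pi = k pi' & exists v,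
      lam < `|emp_process P s (psi pi v) - emp_process P s (psi pi' v)|]] q.
Proof.
move=> dPi lam0 q0.
(* 27 = 3 * 9, with 3 / delta from [emp_score] and 9 from [equicontinuity]; below, [q] is shared by
   two actions and three weights. *)
pose lam' := lam * delta / 27.
have lam'0 : 0 < lam' by rewrite divr_gt0// mulr_gt0.
have [|I [k hk]] := equicontinuity dPi _ lam'0 (divr_gt0 q0 (ltr0n R 6)).
  by move=> _ [pi _ <-]; split; [exact: bm_policy_fun|exact: policy_fun_le1].
pose F : set (obs -> R) := [set policy_fun pi | pi in Pi].
pose k' pi : option I := if pselect (F (policy_fun pi)) is left h
  then Some (k (SigSub (mem_set h))) else None.
exists (option I), k'; apply: filterS hk => n hn.
have sm := small_bigU (fun aj : bool * 'I_3 => hn _ (mw_fam aj.1 aj.2)).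
apply: small_le (small_sub _ sm).
  rewrite sumr_const card_prod card_bool card_ord -[_ *+ _]mulr_natl.
  by rewrite mulrC divfK.
move=> s [pi [pi' [Ppi Ppi' kk [v]]]]; apply: contraPP => no /=.
apply/negP; rewrite -leNgt.
move: kk; rewrite /k'; case: pselect => [h|]; last by move=> nF; exfalso; apply: nF; exists pi.
case: pselect => [h'|]; last by move=> nF; exfalso; apply: nF; exists pi'.
move=> [kk].
have bd : bm (fun o => policy_fun pi o - policy_fun pi' o : R) by apply: bmB; exact: bm_policy_fun.
have hB a (j : 'I_3) : `|emp_process P s (fun o => fam a j v o * (policy_fun pi o - policy_fun pi' o))| <= 9 * lam'.
  rewrite leNgt; apply/negP => hh; apply: no; exists (a, j) => /=.
  by exists (SigSub (mem_set h)), (SigSub (mem_set h')); split=> //; exists v.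
have h1 := emp_score bd (hB true); have h2 := emp_score bd (hB false).
rewrite -emp_processB; try exact: bm_psi.
under [fun x => _]funext do rewrite psi_diff.
have b a : bm (fun o => score a v o * (policy_fun pi o - policy_fun pi' o)).
  by apply: bmM => //; exact: bm_score.
rewrite emp_processZ; last exact: bmB.
rewrite emp_processB// normrM ger0_norm ?invr_ge0//.
have h3 := ler_normB (emp_process P s (fun o => score true v o * (policy_fun pi o - policy_fun pi' o)))
  (emp_process P s (fun o => score false v o * (policy_fun pi o - policy_fun pi' o))).
have e : 3 / delta * (9 * lam') = lam by rewrite /lam'; field; rewrite gt_eqF.
rewrite e in h1 h2; lra.
Qed.

Lemma bounded_psi pi (q : R) : 0 < q -> exists2 B : R, 0 < B & \forall n \near \oo,
  small (iid_law P n) [set s | exists v, B < `|emp_process P s (psi pi v)|] q.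
Proof.
move=> q0.
have q12 : 0 < q / 12 by rewrite divr_gt0.
(* [w * L ^+ 2] is the value that [single_function] compares with 64 * 8 times the second moment,
   here at most 1; [L] is large enough for w * L >= 64 * 8. The 12 counts two actions for the
   weight, two for the indicator and three weights. *)
pose w := (q / 12) ^+ 3 / 16 ^+ 2; have w0 : 0 < w by rewrite divr_gt0// exprn_gt0.
pose L := 1 + 64 * 8 / w.
have L1 : 1 <= L by rewrite lerDl divr_ge0 ?(ltW w0)// mulr_ge0.
have L0 : 0 < L by exact: lt_le_trans L1.
have LL : L <= L ^+ 2 by rewrite expr2 ler_peMl// ltW.
have c1 a : \int[P]_o (chooses pi a o ^+ 2) <= 1.
  rewrite -[leRHS](bm_integral_cst P); apply: bm_integral_le; [exact: bm_sqr (bm_chooses _ _)|exact: bm_cst|].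
  by move=> o; rewrite /chooses; case: (_ == a); rewrite /= ?expr1n ?expr0n ?ler01.
have c0 a : 0 <= \int[P]_o (chooses pi a o ^+ 2) by apply: Rintegral_ge0 => o _; exact: sqr_ge0.
exists (54 * L / delta); first by rewrite divr_gt0// mulr_gt0.
have hn (z : (bool * bool) * 'I_3) : \forall n \near \oo, small (iid_law P n) [set s | exists v,
     9 * L < `|emp_process P s (fun x => fam z.1.1 z.2 v x * chooses pi z.1.2 x)|] (q / 12).
  apply: single_function => //; first exact: bm_chooses.
  - exact: mw_fam.
  - by apply: (le_trans (c1 _)); apply: le_trans LL.
  - have e : 64 * 8 <= (q / 12) * (q / 12 * L / 16) ^+ 2.
      have -> : (q / 12) * (q / 12 * L / 16) ^+ 2 = w * L ^+ 2 by rewrite /w; field.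
      apply: (@le_trans _ _ (w * L)); last by apply: ler_wpM2l => //; exact: ltW.
      have -> : w * L = w + 64 * 8 by exact: mulr_1Ddiv.
      by rewrite lerDr ltW.
    by apply: le_trans e; have := c1 z.1.2; lra.
have {}hn : \forall n \near \oo, forall z : (bool * bool) * 'I_3, small (iid_law P n) [set s | exists v,
     9 * L < `|emp_process P s (fun x => fam z.1.1 z.2 v x * chooses pi z.1.2 x)|] (q / 12).
  exact: filter_forall.
apply: filterS hn => n hn; apply: small_le (small_sub _ (small_bigU hn)).
  rewrite sumr_const !card_prod card_bool card_ord -[_ *+ _]mulr_natl.
  by rewrite mulrC divfK.
move=> s [v]; apply: contraPP => no /=; apply/negP; rewrite -leNgt.
have hB a (j : 'I_3) : `|emp_process P s (fun o => fam a j v o * chooses pi a o)| <= 9 * L.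
  by rewrite leNgt; apply/negP => hh; apply: no; exists ((a, a), j) => /=; exists v.
have h1 := emp_score (bm_chooses pi true) (hB true).
have h2 := emp_score (bm_chooses pi false) (hB false).
have b a : bm (fun o => score a v o * chooses pi a o).
  by apply: bmM; [exact: bm_score|exact: bm_chooses].
have -> : psi pi v = fun o => score true v o * chooses pi true o + score false v o * chooses pi false o - 2^-1.
  by apply/funext => o; exact: psiE.
rewrite emp_processB; [|exact: bmD|exact: bm_cst].
rewrite emp_process_cst subr0 emp_processD//.
apply: (le_trans (ler_normD _ _)); apply: (le_trans (lerD h1 h2)).
by rewrite le_eqVlt; apply/orP; left; apply/eqP; ring.
Qed.

End policies.

(** A mean value inequality for this relative derivative. For a slope C' > C, the set of points up
    to w where the bound from u holds contains its supremum and cannot stop before w. The excess of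
    C' over C costs at most [e] over the interval. *)
Lemma derivative_on_le (R : realType) (f f' : R -> R) (a b C u w : R) :
  derivative_on f f' a b -> (forall m, a <= m <= b -> f' m <= C) ->
  a <= u -> u <= w -> w <= b -> f w - f u <= C * (w - u).
Proof.
move=> df f'C au uw wb; apply/ler_addgt0Pr => e e0.
pose C' := C + e / (w - u + 1).
have wu1 : 0 < w - u + 1 by lra.
have CC' : C < C' by rewrite ltrDl divr_gt0.
have C'e : C' * (w - u) <= C * (w - u) + e.
  rewrite mulrDl lerD2l mulrAC ler_pdivrMr//; apply: ler_wpM2l; lra.
apply: le_trans C'e.
pose S := [set x | u <= x <= w /\ f x - f u <= C' * (x - u)].
have Su : S u by split; rewrite ?lexx// !subrr mulr0.
have hS : has_sup S by split; [exists u|exists w => x [/andP[]]].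
pose s := sup S.
have us : u <= s by apply: sup_ubound => //; exact: hS.2.
have sw : s <= w by apply: ge_sup => [|x [/andP[]]//]; exists u.
have sab : s \in `[a, b] by rewrite in_itv /=; apply/andP; split; lra.
have C's : 0 < C' - f' s.
  by rewrite subr_gt0; apply: le_lt_trans CC'; apply: f'C; apply/andP; split; lra.
have [d d0 hd] : exists2 d : R, 0 < d & forall x, a <= x <= b -> x != s -> `|x - s| < d ->
    (f x - f s) / (x - s) < C'.
  have /cvgrPdist_lt/(_ _ C's) := df _ sab.
  rewrite !near_withinE => /nbhs_ballP[d d0 hd]; exists d => // x xab xs xd.
  have : `|f' s - (f x - f s) / (x - s)| < C' - f' s.
    apply: (hd x) => //; first by rewrite /ball /= distrC.
  by rewrite ltr_norml => /andP[h1 h2]; lra.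
have Ss : S s.
  split; first by rewrite us sw.
  have [x Sx sx] := sup_adherent d0 hS.
  have xs : x <= s by apply: sup_ubound => //; exact: hS.2.
  have [->|xns] := eqVneq s x; first by case: Sx.
  have [/andP[ux xw] fx] := Sx.
  have xs' : x < s by rewrite lt_neqAle eq_sym xns.
  have := hd x; rewrite eq_sym xns ltr_norml => /(_ _ isT) h.
  have {}h : (f x - f s) / (x - s) < C'.
    by apply: h; [apply/andP; split; lra|rewrite -/s in sx; apply/andP; split; lra].
  move: h; rewrite ltr_ndivrMr ?subr_lt0// => h; lra.
have [<-|sw'] := eqVneq s w; first by case: Ss.
exfalso; have {}sw' : s < w by rewrite lt_neqAle sw' sw.
pose x := Num.min w (s + d / 2).
have sx : s < x by rewrite lt_min sw' ltrDl divr_gt0.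
have xw : x <= w by rewrite ge_min lexx.
have xd : x <= s + d / 2 by rewrite ge_min lexx orbT.
have Sx : S x.
  split; first by apply/andP; split; lra.
  have h : (f x - f s) / (x - s) < C'.
    apply: hd; [by apply/andP; split; lra|by rewrite gt_eqF|].
    by rewrite gtr0_norm ?subr_gt0//; lra.
  move: h; rewrite ltr_pdivrMr ?subr_gt0// => h; have := Ss.2; lra.
have : x <= s by apply: sup_ubound => //; exact: hS.2.
by rewrite leNgt sx.
Qed.

(** * The score over a short window of thresholds *)

Section policies.
Context dX (X : measurableType dX) (R : realType).
Variables (P : probability (X * bool * R)%type R).
Variables (pA : R.-pker X ~> bool) (pY : R.-pker (X * bool) ~> R).
Variable delta : R.
Hypothesis delta01 : 0 < delta < 2^-1.
Local Notation obs := (X * bool * R)%type.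
Implicit Types (pi : policy X) (o : obs).
Local Notation psi := (psi pA pY delta).
Local Notation fam := (fam pA pY delta).
Local Notation ipw := (ipw pA delta).

Let delta0 : 0 < delta. Proof. by case/andP: delta01. Qed.
Let d1 : 1 <= delta^-1.
Proof. by have /andP[? ?] := delta01; rewrite -[leLHS]invr1 lef_pV2 ?posrE//; lra. Qed.

Lemma cond_prob_itv u w a x : u <= w ->
  pY (x, a) `]u, w]%classic = (cond_cdf pY w a x - cond_cdf pY u a x)%:E.
Proof.
move=> uw; have -> : `]u, w]%classic = `]-oo, w]%classic `\` `]-oo, u]%classic.
  apply/seteqP; split=> y /=; rewrite !in_itv /=.
    by move=> /andP[uy yw]; split=> //; apply/negP; rewrite -ltNge.
  by move=> [yw /negP]; rewrite -ltNge => ->.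
have fin m : (pY (x, a) `]-oo, m]%classic \is a fin_num).
  exact: (@fin_num_measure _ _ _ (cond_prob pY (x, a))).
rewrite measureD//; last by rewrite ltey_eq fin.
rewrite setIidr; last by move=> y /=; rewrite !in_itv /= => /le_trans; apply.
by rewrite EFinB /cond_cdf !fineK.
Qed.

Hypothesis hpY : cond_law P (fun o => (covariate o, action o)) reward pY.

Let inc pi u w o := cond_cdf pY w (pi (covariate o)) (covariate o) -
  cond_cdf pY u (pi (covariate o)) (covariate o).

Let bm_inc pi u w : bm (inc pi u w).
Proof. by apply: bmB; exact: bm_policy_cdf. Qed.

Let inc_integral pi u w : \int[P]_o inc pi u w o = policy_cdf P pY pi w - policy_cdf P pY pi u.
Proof. by rewrite bm_integralB//; exact: bm_policy_cdf. Qed.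

Let inc_ge0 pi u w o : u <= w -> 0 <= inc pi u w o.
Proof. by move=> uw; rewrite subr_ge0 cond_cdf_homo. Qed.

Definition win_reward pi u w a o : R :=
  (action o == a)%:R * chooses pi a o * ((u < reward o) && (reward o <= w))%:R.

Definition win_cdf pi u w a o : R :=
  chooses pi a o * (cond_cdf pY w a (covariate o) - cond_cdf pY u a (covariate o)).

Lemma bm_win_cdf pi u w a : bm (win_cdf pi u w a).
Proof.
apply: bmM; first exact: bm_chooses.
by apply: bmB; exact: (bm_fam pA pY delta01 a 2).
Qed.

Lemma bm_win_reward pi u w a : bm (win_reward pi u w a).
Proof.
split; last first.
  exists 1 => o; rewrite /win_reward /chooses -!natrM normr_nat.
  by rewrite (_ : 1 = 1%:R)// ler_nat; case: (_ == a); case: (_ == a); case: (_ && _).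
apply: measurable_funM; first apply: measurable_funM.
- by apply: measurable_eqb; exact: measurable_action.
- exact: measurable_chooses.
- apply: (measurableT_comp (f := fun b : bool => b%:R : R)) => //.
  by apply: measurable_and; [apply: measurable_fun_ltr|apply: measurable_fun_ler] => //; exact: measurable_reward.
Qed.

(** An indicator is its own square. By the conditional law of the reward its mean is the integral of
    the increment of the conditional distribution function over the event A = pi(X) = a, which is a
    part of F_pi(w) - F_pi(u). *)
Lemma win_reward_sq pi u w a : u <= w ->
  \int[P]_o (win_reward pi u w a o ^+ 2) <= policy_cdf P pY pi w - policy_cdf P pY pi u.
Proof.
move=> uw.
pose B := [set z : X * bool | (z.2 == a) && (pi z.1 == a)].
have mB : measurable B.
  have mf : measurable_fun setT (fun z : X * bool => (z.2 == a) && (pi z.1 == a)).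
    by apply: measurable_and; apply: (measurableT_comp (f := fun b => b == a)) => //;
      exact: (measurableT_comp (measurable_funPT pi) measurable_fst).
  by have := mf measurableT [set true] I; rewrite setTI.
have mC : measurable (`]u, w]%classic : set R) by exact: measurable_itv.
pose U o := (covariate o, action o).
have mU : measurable_fun setT U.
  by apply: measurable_fun_pair; [exact: measurable_covariate|exact: measurable_action].
have -> : \int[P]_o (win_reward pi u w a o ^+ 2) = fine (P (U @^-1` B `&` reward @^-1` `]u, w]%classic)).
  rewrite -bm_integral_indic; last first.
    apply: measurableI.
      by rewrite -[X in measurable X]setTI; exact: mU.
    by rewrite -[X in measurable X]setTI; exact: measurable_reward.
  apply: eq_Rintegral => o _; rewrite /win_reward /chooses indicE.
  have -> : (o \in U @^-1` B `&` reward @^-1` `]u, w]%classic) =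
     [&& action o == a, pi (covariate o) == a, u < reward o & reward o <= w].
    apply/idP/idP; rewrite inE /= in_itv /= /B /=.
      by move=> [/andP[-> ->]].
    by move=> /and3P[-> -> ->].
  by case: (action o == a); case: (pi (covariate o) == a); case: (u < _); case: (_ <= w);
    rewrite /= ?mulr0 ?mul0r ?mulr1 ?expr1n ?expr0n.
rewrite (hpY mB mC) -inc_integral -lee_fin.
have iB : measurable (U @^-1` B) by rewrite -[X in measurable X]setTI; exact: mU.
have fI : (\int[P]_o (inc pi u w o)%:E)%E = (\int[P]_o inc pi u w o)%:E.
  by rewrite /Rintegral fineK//; apply: integrable_fin_num => //; exact: bm_integrable.
have le : (\int[P]_(o in U @^-1` B) pY (U o) `]u, w]%classic <= \int[P]_o (inc pi u w o)%:E)%E.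
  rewrite (eq_integral (fun o => (inc pi u w o)%:E)); last first.
    move=> o; rewrite inE => /andP[/= /eqP aE /eqP piE].
    by rewrite /U cond_prob_itv// /inc piE aE.
  apply: ge0_subset_integral => //.
    by apply/measurable_EFinP; case: (bm_inc pi u w).
  by move=> o _; rewrite lee_fin inc_ge0.
rewrite -fI fineK//; rewrite ge0_fin_numE.
  by apply: (le_lt_trans le); rewrite fI ltry.
by apply: integral_ge0 => o _.
Qed.

Lemma win_cdf_sq pi u w a : u <= w ->
  \int[P]_o (win_cdf pi u w a o ^+ 2) <= policy_cdf P pY pi w - policy_cdf P pY pi u.
Proof.
move=> uw; rewrite -inc_integral; apply: bm_integral_le => //.
  exact: bm_sqr (bm_win_cdf _ _ _ _).
move=> o; rewrite /win_cdf /chooses; case: eqP => [<-|_]; last first.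
  by rewrite mul0r expr0n /= inc_ge0.
have /andP[? ?] := cond_cdf_01 pY w (pi (covariate o)) (covariate o).
have /andP[? ?] := cond_cdf_01 pY u (pi (covariate o)) (covariate o).
have := inc_ge0 pi o uw; rewrite mul1r /inc => h0.
by rewrite expr2 ler_piMl//; lra.
Qed.

Definition clip_cdf u w a v o : R :=
  Num.min 1 (Num.max 0 ((cond_cdf pY v a (covariate o) - cond_cdf pY u a (covariate o)) *
    (cond_cdf pY w a (covariate o) - cond_cdf pY u a (covariate o))^-1)).

Lemma mw_clip_cdf u w a : u <= w -> monotone_weight (clip_cdf u w a : R -> obs -> R).
Proof.
move=> uw; have [_ h1 h2 h3] := mw_fam pA pY delta01 a 2.
exact: (mw_clip uw h1 h2 h3).
Qed.

(** The reward indicator keeps its weight and is localized by the function it multiplies. A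
    conditional distribution function is split instead into its total increment over [u, w] and the
    fraction of it reached at v. *)
Definition win_weight u w a (j : nat) : R -> obs -> R :=
  match j with
  | 0 => fam a 0
  | 1 => fun v o => ipw a o * clip_cdf u w a v o
  | _ => clip_cdf u w a
  end.

Definition win_fun pi u w a (j : nat) : obs -> R :=
  if j is 0 then win_reward pi u w a else win_cdf pi u w a.

Lemma mw_win_weight u w a j : u <= w -> monotone_weight (win_weight u w a j).
Proof.
move=> uw; case: j => [|[|j]]; first exact: mw_fam.
- by apply: (mw_scale (measurable_ipw pA delta01 a) (ipw_01 pA delta01 a)); exact: mw_clip_cdf.
- exact: mw_clip_cdf.
Qed.

(* On [u, w], the increments of v -> psi pi v are those of products of a
   monotone weight in v and a function whose second moment is at most
   F_pi(w) - F_pi(u). *)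
Lemma psi_window pi u w v o : u <= v <= w -> psi pi w o - psi pi v o =
  \sum_a (delta^-1 * (win_weight u w a 0 w o * win_fun pi u w a 0 o - win_weight u w a 0 v o * win_fun pi u w a 0 o)
    - delta^-1 * (win_weight u w a 1 w o * win_fun pi u w a 1 o - win_weight u w a 1 v o * win_fun pi u w a 1 o)
    + (win_weight u w a 2 w o * win_fun pi u w a 2 o - win_weight u w a 2 v o * win_fun pi u w a 2 o)).
Proof.
move=> /andP[uv vw]; have uw := le_trans uv vw.
rewrite (bigD1 (pi (covariate o)))//= [X in _ = _ + X]big1 ?addr0; last first.
  move=> a na; have {}na : (pi (covariate o) == a) = false by rewrite eq_sym (negbTE na).
  rewrite /win_fun /win_reward /win_cdf /chooses na /=.
  by rewrite !(mulr0, mul0r, subr0, addr0).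
rewrite /win_fun /win_reward /win_cdf /chooses eqxx /psi /score /fam /=.
set a := pi _; set x := covariate o; set Fw := cond_cdf pY w a x; set Fv := cond_cdf pY v a x.
set Fu := cond_cdf pY u a x.
have Fuv : Fu <= Fv by exact: cond_cdf_homo.
have Fvw : Fv <= Fw by exact: cond_cdf_homo.
have cl z : u <= z <= w -> clip_cdf u w a z o * (Fw - Fu) = cond_cdf pY z a x - Fu.
  move=> /andP[uz zw]; rewrite mulrC /clip_cdf clip_mul//.
  by rewrite subr_ge0 lerD2r !cond_cdf_homo.
have clv := cl v; rewrite uv vw in clv; have {}clv := clv isT.
have clw := cl w; rewrite uw lexx in clw; have {cl}clw := clw isT.
have ipwA z : ipw a o * z * ((action o == a)%:R * 1) = ipw a o * z.
  by rewrite /ipw; case: (action o == a); rewrite /= ?mulr1// !(mul0r, mulr0).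
rewrite !mul1r -!(mulrA (ipw a o) (clip_cdf _ _ _ _ _)) clv clw -/Fw -/Fv.
have rw : ipw a o * (reward o <= w)%R%:R - ipw a o * (reward o <= v)%R%:R =
    ipw a o * (reward o <= w)%R%:R * ((action o == a)%:R * 1 * ((u < reward o) && (reward o <= w))%:R) -
    ipw a o * (reward o <= v)%R%:R * ((action o == a)%:R * 1 * ((u < reward o) && (reward o <= w))%:R).
  have [yw|yw] := leP (reward o) w; last first.
    have -> : (reward o <= v) = false by apply/negbTE; rewrite -ltNge; exact: le_lt_trans yw.
    by rewrite /= !(mul0r, mulr0, subrr).
  have [yu|yu] := leP (reward o) u; rewrite /=.
    by rewrite (le_trans yu uv) /= !(mulr0, subrr).
  by rewrite !(mulr1 (_ * 1)) !ipwA.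
by rewrite -rw; ring.
Qed.

(** [rho] comes before [pi], [u] and [w]: only the second moments of the window functions enter, and
    these are at most the increment of F_pi. *)
Lemma window_psi (lam q : R) : 0 < lam -> 0 < q -> exists2 rho : R, 0 < rho &
  forall pi u w, u <= w -> policy_cdf P pY pi w - policy_cdf P pY pi u <= rho ->
  \forall n \near \oo, small (iid_law P n) [set s | exists v, u <= v <= w /\
    lam < `|emp_process P s (psi pi w) - emp_process P s (psi pi v)|] q.
Proof.
move=> lam0 q0.
(* 12 counts two actions, three terms and two end points; each contributes at most 9 * l / delta. *)
pose l := lam * delta / (12 * 9); have l0 : 0 < l by rewrite divr_gt0// mulr_gt0.
pose q' := q / 6; have q'0 : 0 < q' by rewrite divr_gt0.
pose z := q' * (q' * l / 16) ^+ 2 / (8 * 64).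
have z0 : 0 < z by rewrite divr_gt0 ?mulr_gt0// exprn_gt0// divr_gt0// mulr_gt0.
exists (Num.min (l ^+ 2) z); first by rewrite lt_min z0 exprn_gt0.
move=> pi u w uw; rewrite le_min => /andP[r1 r2].
have bg a j : bm (win_fun pi u w a j).
  by case: j => [|j]; [exact: bm_win_reward|exact: bm_win_cdf].
have gsq a j : \int[P]_o (win_fun pi u w a j o ^+ 2) <= policy_cdf P pY pi w - policy_cdf P pY pi u.
  by case: j => [|j]; [exact: win_reward_sq|exact: win_cdf_sq].
have hn (aj : bool * 'I_3) : \forall n \near \oo, small (iid_law P n) [set s | exists v,
    9 * l < `|emp_process P s (fun x => win_weight u w aj.1 aj.2 v x * win_fun pi u w aj.1 aj.2 x)|] q'.
  apply: single_function => //; first exact: mw_win_weight.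
    exact: le_trans (gsq _ _) r1.
  have := le_trans (gsq aj.1 aj.2) r2; rewrite /z ler_pdivlMr ?mulr_gt0//.
  by rewrite mulrA mulrC [64 * 8]mulrC.
have {}hn : \forall n \near \oo, forall aj : bool * 'I_3, small (iid_law P n) [set s | exists v,
    9 * l < `|emp_process P s (fun x => win_weight u w aj.1 aj.2 v x * win_fun pi u w aj.1 aj.2 x)|] q'.
  exact: filter_forall.
apply: filterS hn => n hn; apply: small_le (small_sub _ (small_bigU hn)).
  rewrite sumr_const card_prod card_bool card_ord -[_ *+ _]mulr_natl.
  by rewrite /q' mulrC divfK.
move=> s [v [uvw]]; apply: contraPP => no /=; apply/negP; rewrite -leNgt.
pose G a j v' := emp_process P s (fun x => win_weight u w a j v' x * win_fun pi u w a j x).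
have hG a (j : 'I_3) v' : `|G a j v'| <= 9 * l.
  by rewrite leNgt; apply/negP => hh; apply: no; exists (a, j); exists v'.
have b a j v' : bm (fun x => win_weight u w a j v' x * win_fun pi u w a j x).
  by apply: bmM => //; apply: mw_bm; exact: mw_win_weight.
have bz a j : bm (fun o => delta^-1 * (win_weight u w a j w o * win_fun pi u w a j o - win_weight u w a j v o * win_fun pi u w a j o)).
  by apply: bmM; [exact: bm_cst|exact: bmB].
pose H a o := delta^-1 * (win_weight u w a 0 w o * win_fun pi u w a 0 o - win_weight u w a 0 v o * win_fun pi u w a 0 o)
    - delta^-1 * (win_weight u w a 1 w o * win_fun pi u w a 1 o - win_weight u w a 1 v o * win_fun pi u w a 1 o)
    + (win_weight u w a 2 w o * win_fun pi u w a 2 o - win_weight u w a 2 v o * win_fun pi u w a 2 o).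
have bH a : bm (H a) by apply: bmD; [exact: bmB|exact: bmB].
have eH a : emp_process P s (H a) = delta^-1 * (G a 0 w - G a 0 v) - delta^-1 * (G a 1 w - G a 1 v) + (G a 2 w - G a 2 v).
  rewrite /H emp_processD; [|exact: bmB|exact: bmB].
  rewrite emp_processB// !emp_processZ; [|exact: bmB|exact: bmB].
  by rewrite !emp_processB.
have nH a : `|emp_process P s (H a)| <= lam / 2.
  have := hG a ord0 w; have := hG a ord0 v; have := hG a (inord 1) w; have := hG a (inord 1) v.
  have := hG a (inord 2) w; have := hG a (inord 2) v; rewrite !inordK//= => k1 k2 k3 k4 k5 k6.
  have i0 : 0 <= delta^-1 by rewrite invr_ge0 ltW.
  have B (x y : R) : `|x| <= 9 * l -> `|y| <= 9 * l -> `|x - y| <= 18 * l.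
    by move=> hx hy; apply: (le_trans (ler_normB _ _)); lra.
  have Bd (x y : R) : `|x| <= 9 * l -> `|y| <= 9 * l -> `|delta^-1 * (x - y)| <= delta^-1 * (18 * l).
    by move=> hx hy; rewrite normrM ger0_norm//; apply: ler_wpM2l => //; exact: B.
  rewrite eH; apply: (le_trans (ler_normD _ _)).
  apply: (@le_trans _ _ (delta^-1 * (18 * l) + delta^-1 * (18 * l) + delta^-1 * (18 * l))).
    apply: lerD; first by apply: (le_trans (ler_normB _ _)); apply: lerD; exact: Bd.
    apply: (le_trans (B _ _ k2 k1)).
    by rewrite ler_peMl// mulr_ge0// ltW.
  by rewrite le_eqVlt /l; apply/orP; left; apply/eqP; field; rewrite gt_eqF.
rewrite -emp_processB; try exact: bm_psi.
have -> : (fun x => psi pi w x - psi pi v x) = fun x => H true x + H false x.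
  by apply/funext => o; rewrite (psi_window _ _ uvw) big_bool.
rewrite emp_processD//; apply: (le_trans (ler_normD _ _)).
have := nH true; have := nH false; lra.
Qed.

Variable Fdot : policy X -> R -> R.

Lemma propensityD x : propensity pA true x + propensity pA false x = 1.
Proof.
rewrite /propensity; have p1 : pA x setT = 1%E := prob_kernel x.
have fin (A : set bool) : pA x A \is a fin_num.
  rewrite ge0_fin_numE//; apply: (@le_lt_trans _ _ (pA x setT)); last by rewrite p1 ltry.
  by apply: le_measure; rewrite ?inE.
rewrite -fineD// -measureU//; last by apply/seteqP; split=> // -[] [].
rewrite -[RHS]/(fine 1%E) -p1; congr (fine (pA x _)).
by apply/seteqP; split=> // -[] _; [left|right].
Qed.

Lemma measurable_influence pi : measurable_fun setT (influence P pA pY Fdot pi).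
Proof.
pose v := median_value P pY pi; pose F := (Fdot pi v)^-1.
have mp a : measurable_fun setT (fun o => (propensity pA a (covariate o))^-1 : R).
  apply: measurable_inv; last exact: measurable_propensity.
  by move=> o; rewrite /propensity fine_ge0.
have mF : measurable_fun setT (fun o => cond_cdf pY v (pi (covariate o)) (covariate o)).
  by have [] := bm_policy_cdf pY pi v.
have mFA : measurable_fun setT (fun o => cond_cdf pY v (action o) (covariate o)).
  by have [] := bm_cond_cdf pY v (@measurable_action _ X R).
have [_ _ mR _] := mw_reward X R.
have me a : measurable_fun setT (fun o => (action o == a)%:R : R).
  by apply: measurable_eqb; exact: measurable_action.
have -> : influence P pA pY Fdot pi = fun o =>
    (- F) * (\sum_a (action o == a)%:R * chooses pi a o * (propensity pA a (covariate o))^-1 *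
      ((reward o <= v)%R%:R - cond_cdf pY v (action o) (covariate o))) -
    F * (cond_cdf pY v (pi (covariate o)) (covariate o) - 2^-1).
  apply/funext => o; rewrite /influence /= -/v invfM -/F (bigD1 (action o))//= big1 ?addr0; last first.
    by move=> a; rewrite eq_sym => /negbTE ->; rewrite !mul0r.
  rewrite eqxx /chooses [pi _ == _]eq_sym mul1r.
  set w : R := (_ <= _)%R%:R; set u : R := (_ == _)%:R; ring.
apply: measurable_funB; apply: measurable_funM => //; last exact: measurable_funB.
apply: measurable_sum => a; apply: measurable_funM; last exact: measurable_funB.
by apply: measurable_funM => //; apply: measurable_funM => //; exact: measurable_chooses.
Qed.

Lemma influence_psi pi o : delta <= propensity pA true (covariate o) <= 1 - delta ->
  influence P pA pY Fdot pi o =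
    - (Fdot pi (median_value P pY pi))^-1 * psi pi (median_value P pY pi) o.
Proof.
move=> /andP[p1 p2]; have p a : delta <= propensity pA a (covariate o).
  by case: a => //; have := propensityD (covariate o); lra.
rewrite /influence /psi /score /fam /ipw !max_r// invfM.
set v := median_value _ _ _; set F := (Fdot _ _)^-1.
case: eqP => [->|_]; last by rewrite !mul0r oppr0 mul0r; ring.
by field; rewrite !gt_eqF// (lt_le_trans delta0).
Qed.

(** The two functions agree outside the null set where positivity of the propensity fails. This set
    is common to all policies, so one null event serves all of them. *)
Lemma emp_influence (n : nat) :
  {ae P, forall o, delta <= propensity pA true (covariate o) <= 1 - delta} ->
  small (iid_law P n) [set s | exists pi, emp_process P s (influence P pA pY Fdot pi) <>
    - (Fdot pi (median_value P pY pi))^-1 * emp_process P s (psi pi (median_value P pY pi))] 0.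
Proof.
move=> hpos; have [N [mN PN hN]] := hpos.
pose D := [set s : n.-tuple obs | exists i : 'I_n, N (tnth s i)].
have : small (iid_law P n) [set s : n.-tuple obs | exists i : 'I_n, N (tnth s i)] 0.
  have h (i : 'I_n) : small (iid_law P n) [set s : n.-tuple obs | N (tnth s i)] 0.
    exists [set s : n.-tuple obs | N (tnth s i)]; split=> //.
      by rewrite -[X in measurable X]setTI; exact: measurable_tnth.
    by rewrite iid_law_tnth// PN.
  by have := small_bigU h; rewrite big1.
apply: small_sub => s [pi]; apply: contra_notP => hs.
have good i : influence P pA pY Fdot pi (tnth s i) =
    - (Fdot pi (median_value P pY pi))^-1 * psi pi (median_value P pY pi) (tnth s i).
  apply: influence_psi; apply: contra_notP hs => nh; exists i.
  by apply: hN => /= h; apply: nh.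
rewrite -emp_processZ; last exact: bm_psi.
rewrite /emp_process; congr (_ * (_ * _ - _)); first by apply: eq_bigr => i _; exact: good.
rewrite /Rintegral; congr fine; apply: ae_eq_integral => //.
- by apply/measurable_EFinP; exact: measurable_influence.
- by apply/measurable_EFinP; apply: measurable_funM => //; case: (bm_psi pA pY delta01 pi (median_value P pY pi)).
- apply: filterS hpos => o ho _; by rewrite influence_psi.
Qed.

End policies.

(** * Regret of the learned policy *)

Section littleo.
Context d (T : measurableType d) (R : realType) (P : probability T R).
Variables (rate : nat -> R) (Z : forall n, n.-tuple T -> \bar R).

Lemma littleo_small e q : littleo_P P rate Z -> 0 < e -> 0 < q ->
  \forall n \near \oo, small (iid_law P n) [set s | ((e * rate n)%:E < `|Z s|)%E] q.
Proof.
move=> hZ e0 q0.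
have : \forall n \near \oo, ((iid_law P n)^*%mu [set s | ((e * rate n)%:E < `|Z s|)%E] < q%:E)%E.
  apply: (hZ e e0 [set y | (y < q%:E)%E]).
  by apply: open_nbhs_nbhs; split; [exact: open_ereal_lt_ereal|rewrite /= lte_fin].
by apply: filterS => n; exact: small_outer.
Qed.

Lemma small_littleo :
  (forall e q, 0 < e -> 0 < q -> \forall n \near \oo,
    small (iid_law P n) [set s | ((e * rate n)%:E < `|Z s|)%E] q) ->
  littleo_P P rate Z.
Proof.
move=> h e e0; apply/fine_cvgP; split.
  have := h e 1 e0 ltr01; apply: filterS => n /outer_small h1.
  rewrite ge0_fin_numE ?outer_measure_ge0//; exact: le_lt_trans h1 (ltry _).
apply/cvgrPdist_le => q q0; have := h e q e0 q0; apply: filterS => n /outer_small h1.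
rewrite sub0r normrN ger0_norm ?fine_ge0 ?outer_measure_ge0//.
by rewrite -lee_fin fineK// ge0_fin_numE ?outer_measure_ge0//; exact: le_lt_trans h1 (ltry _).
Qed.

End littleo.

(** The deterministic argument on the event where all bounds hold, with [a] the inverse derivative
    at the median and [G] the empirical process of [psi]. A first comparison, using only the bound
    [K] on [G], places [phat] within [eta] of the supremum and so makes its cell active. The second
    is with a nearly optimal policy of the same cell: [G] moves by at most 4 * l, namely two
    passages to the representative and two changes of threshold. The 9 * e consists of 4 * e for
    [G], [e] for [a], 2 * e for the two expansions, [e] for near maximality and [e] for the gap of
    the competitor. *)
Lemma argmax_regret (R : realType) (Pol : Type) (I : Type) (Pi : set Pol)
    (V Vh a : Pol -> R) (G : Pol -> R -> R) (k : Pol -> I) (p : I -> Pol)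
    (phat : Pol) (N e l K A eta vs : R) :
  0 < N -> 0 < e -> 0 < eta -> A * l <= e -> Pi phat ->
  (forall pi, Pi pi -> 0 <= a pi <= A) ->
  (forall pi, Pi pi -> V pi <= vs) ->
  (forall t, 0 < t -> exists2 pi, Pi pi & vs - t < V pi) ->
  (forall pi, Pi pi -> `|N * (Vh pi - V pi) + a pi * G pi (V pi)| <= e) ->
  (forall pi, Pi pi -> Vh pi - e / N <= Vh phat) ->
  (forall pi v, Pi pi -> `|G pi v| <= K) ->
  (forall pi pi' v, Pi pi -> Pi pi' -> k pi = k pi' -> `|G pi v - G pi' v| <= l) ->
  (forall pi pi', Pi pi -> Pi pi' -> k pi = k pi' -> `|a pi - a pi'| * K <= e) ->
  (forall pi t, Pi pi -> vs - eta < V pi -> 0 < t ->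
     exists pi', [/\ Pi pi', k pi' = k pi & vs - t < V pi']) ->
  (forall pi v, Pi pi -> vs - eta < V pi -> vs - eta <= v <= vs ->
     [/\ Pi (p (k pi)), k (p (k pi)) = k pi & `|G (p (k pi)) vs - G (p (k pi)) v| <= l]) ->
  2 * A * K + 4 * e <= N * eta ->
  vs - V phat <= 9 * e / N.
Proof.
move=> N0 e0 eta0 Al hphat ha Vvs near_sup hlin hmax hK hG haK hact hp hN.
have bd pi : Pi pi -> `|a pi * G pi (V pi)| <= A * K.
  move=> hpi; have /andP[a0 aA] := ha _ hpi.
  by rewrite normrM ger0_norm//; apply: ler_pM => //; exact: hK.
have lb pi : Pi pi -> - a pi * G pi (V pi) - e <= N * (Vh pi - V pi) <= - a pi * G pi (V pi) + e.
  by move=> /hlin; rewrite ler_norml => /andP[? ?]; apply/andP; split; lra.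
have mx pi : Pi pi -> N * Vh pi - e <= N * Vh phat.
  move=> /hmax h; have : N * (Vh pi - e / N) <= N * Vh phat by apply: ler_wpM2l => //; exact: ltW.
  by rewrite mulrBr [e / N]mulrC mulrA mulfV ?gt_eqF// mul1r.
have eN0 : 0 < e / N by rewrite divr_gt0.
have eNE : N * (e / N) = e by rewrite mulrC divfK ?gt_eqF.
have vhat : vs - eta < V phat.
  have [p0 hp0 Vp0] := near_sup _ eN0.
  have /andP[l1 _] := lb _ hp0; have /andP[_ l2] := lb _ hphat.
  have := bd _ hp0; have := bd _ hphat; rewrite !ler_norml => /andP[b1 b2] /andP[b3 b4].
  have m0 := mx _ hp0.
  have h : N * (vs - e / N) < N * V p0 by rewrite ltr_pM2l.
  rewrite -(ltr_pM2l N0); move: l1 l2 h; rewrite !mulrBr eNE => *; lra.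
have t0 : 0 < Num.min eta (e / N) by rewrite lt_min eta0.
have [q [hq kq]] := hact _ _ hphat vhat t0.
rewrite ltrBlDr => Vq.
have Vq1 : vs - eta < V q by rewrite ltrBlDr (lt_le_trans Vq)// lerD2l ge_min lexx.
have Vq2 : vs - e / N < V q by rewrite ltrBlDr (lt_le_trans Vq)// lerD2l ge_min lexx orbT.
have vsI pi : Pi pi -> vs - eta < V pi -> vs - eta <= V pi <= vs.
  by move=> hpi h; rewrite ltW//= Vvs.
have [Pp kp w1] := hp _ _ hphat vhat (vsI _ hphat vhat).
have [_ _ w2] := hp _ _ hphat vhat (vsI _ hq Vq1).
have g1 := hG _ _ (V phat) hphat Pp (esym kp).
have g2 := hG _ _ (V q) hq Pp (etrans kq (esym kp)).
have dG : `|G q (V q) - G phat (V phat)| <= 4 * l.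
  move: w1 w2 g1 g2; rewrite !ler_norml.
  by move=> /andP[? ?] /andP[? ?] /andP[? ?] /andP[? ?]; apply/andP; split; lra.
have /andP[a0 aA] := ha _ hphat.
have A1 : `|a phat * (G q (V q) - G phat (V phat))| <= 4 * e.
  rewrite normrM ger0_norm//; apply: (@le_trans _ _ (A * (4 * l))).
    by apply: ler_pM.
  lra.
have A2 : `|(a q - a phat) * G q (V q)| <= e.
  rewrite normrM; apply: le_trans (haK _ _ hq hphat kq).
  by apply: ler_wpM2l => //; exact: hK.
have /andP[l1 _] := lb _ hq; have /andP[_ l2] := lb _ hphat; have m := mx _ hq.
have h : N * (vs - e / N) < N * V q by rewrite ltr_pM2l.
rewrite ler_pdivlMr// mulrC.
move: A1 A2 l1 l2 h; rewrite !ler_norml !mulrBr eNE mulrBl => /andP[? ?] /andP[? ?] *; lra.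
Qed.

Section policies.
Context dX (X : measurableType dX) (R : realType).
Variables (P : probability (X * bool * R)%type R).
Variables (pA : R.-pker X ~> bool) (pY : R.-pker (X * bool) ~> R).
Variable Pi : set (policy X).
Local Notation obs := (X * bool * R)%type.
Implicit Types (pi : policy X) (o : obs).
Local Notation V := (median_value P pY).

Lemma sub_policy_closure : Pi `<=` policy_closure P Pi.
Proof.
move=> pi Pipi e e0; exists pi => //; rewrite /L2dist.
have -> : EFin \o (policy_fun pi \- policy_fun pi)%R = cst 0%E :> (obs -> \bar R).
  by apply/funext => o; rewrite /= subrr.
by rewrite Lnorm0 ?lte_fin// eqe pnatr_eq0.
Qed.

Lemma derivative_bounds c (Fdot : policy X -> R -> R) :
  let lo := ereal_inf [set ereal_inf [set (Fdot pi m)%:E |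
                m in [set m | `|m - V pi| <= c]] | pi in policy_closure P Pi] in
  let hi := ereal_sup [set ereal_sup [set (Fdot pi m)%:E |
                m in [set m | `|m - V pi| <= c]] | pi in policy_closure P Pi] in
  [/\ (0 < lo)%E, (lo <= hi)%E & (hi < +oo)%E] ->
  exists2 l, 0 < l & exists h, forall pi m, Pi pi -> `|m - V pi| <= c -> l <= Fdot pi m <= h.
Proof.
move=> lo hi [lo0 lohi hioo].
have lof : lo \is a fin_num.
  by rewrite fin_numE gt_eqF ?(lt_trans _ lo0) ?ltNyr// lt_eqF// (le_lt_trans lohi).
have hif : hi \is a fin_num.
  by rewrite fin_numE gt_eqF ?(lt_le_trans _ lohi) ?(lt_trans _ lo0) ?ltNyr// lt_eqF.
exists (fine lo); first by rewrite -lte_fin fineK.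
exists (fine hi) => pi m hpi hm; rewrite -!lee_fin !fineK//.
have hcl := sub_policy_closure hpi; apply/andP; split.
  apply: (@le_trans _ _ (ereal_inf [set (Fdot pi m)%:E | m in [set m | `|m - V pi| <= c]])).
    by apply: ereal_inf_lbound; exists pi.
  by apply: ereal_inf_lbound; exists m.
apply: (@le_trans _ _ (ereal_sup [set (Fdot pi m)%:E | m in [set m | `|m - V pi| <= c]])).
  by apply: ereal_sup_ubound; exists m.
by apply: ereal_sup_ubound; exists pi.
Qed.

Variable delta : R.
Hypothesis delta01 : 0 < delta < 2^-1.
Hypothesis dPi : donsker P [set policy_fun pi | pi in Pi].
Local Notation psi := (psi pA pY delta).

(** Within each of finitely many cells the process stays within 1 of that of a representative, and
    each representative is bounded in probability uniformly in the threshold. *)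
Lemma tight_psi (q : R) : 0 < q -> exists2 K : R, 0 < K & \forall n \near \oo,
  small (iid_law P n) [set s | exists pi v, Pi pi /\ K < `|emp_process P s (psi pi v)|] q.
Proof.
move=> q0; have q2 : 0 < q / 2 by rewrite divr_gt0.
have [I [k hk]] := equicontinuous_psi pA pY delta01 dPi ltr01 q2.
pose q' := q / 2 / (#|I|%:R + 1).
have q'0 : 0 < q' by rewrite divr_gt0// ltr_wpDl.
have /boolp.choice[B hB] : forall i : I, exists B : R, 0 < B /\
    exists p : policy X, (forall pi, Pi pi -> k pi = i -> Pi p /\ k p = i) /\ \forall n \near \oo,
      small (iid_law P n) [set s | exists v, B < `|emp_process P s (psi p v)|] q'.
  move=> i; have [[pi [hpi kpi]]|nopi] := pselect (exists pi, Pi pi /\ k pi = i).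
    have [B B0 hB] := bounded_psi P pA pY delta01 pi q'0.
    by exists B; split=> //; exists pi; split.
  (* A cell that misses [Pi] receives an arbitrary policy. *)
  have p0 : policy X by exact: (cst true).
  have [B B0 hB] := bounded_psi P pA pY delta01 p0 q'0.
  by exists B; split=> //; exists p0; split=> // pi hpi kpi; case: nopi; exists pi.
have B0 i : 0 < B i by case: (hB i).
have {hB}/boolp.choice[p hp] := fun i => (hB i).2.
have hn : \forall n \near \oo, forall i,
    small (iid_law P n) [set s | exists v, B i < `|emp_process P s (psi (p i) v)|] q'.
  by apply: filter_forall => i; case: (hp i).
exists (1 + \sum_i B i); first by rewrite ltr_pwDl// sumr_ge0// => i _; exact: ltW.
near=> n.
have h1 : small (iid_law P n) [set s | exists pi pi', [/\ Pi pi, Pi pi', k pi = k pi' & exists v,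
      1 < `|emp_process P s (psi pi v) - emp_process P s (psi pi' v)|]] (q / 2) by near: n.
have hn' : forall i, small (iid_law P n) [set s | exists v, B i < `|emp_process P s (psi (p i) v)|] q'.
  by near: n.
apply: small_le (small_sub _ (smallU h1 (small_bigU hn'))).
  rewrite sumr_const -[q' *+ _]mulr_natr {2}[q]splitr lerD2l /q' mulrAC ler_pdivrMr ?ltr_wpDl//.
  by rewrite mulrDr mulr1 lerDl ltW.
move=> s [pi [v [hpi]]]; apply: contraPP => /= no; apply/negP; rewrite -leNgt.
have [Pp kp] := (hp (k pi)).1 pi hpi erefl.
have b1 : `|emp_process P s (psi (p (k pi)) v)| <= B (k pi).
  by rewrite leNgt; apply/negP => h; apply: no; right; exists (k pi), v.
have b2 : `|emp_process P s (psi pi v) - emp_process P s (psi (p (k pi)) v)| <= 1.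
  by rewrite leNgt; apply/negP => h; apply: no; left; exists pi, (p (k pi)); split=> //; exists v.
have b3 : B (k pi) <= \sum_i B i.
  by rewrite (bigD1 (k pi))//= lerDl sumr_ge0// => i _; exact: ltW.
apply: le_trans (lerD b2 (le_trans b1 b3)).
by rewrite -[X in `|X| <= _](subrK (emp_process P s (psi (p (k pi)) v))) ler_normD.
Unshelve. all: by end_near. Qed.
End policies.

Theorem corollary10 (R : realType) (dX : measure_display)
  (X : measurableType dX) (P : probability (X * bool * R)%type R)
  (pA : R.-pker X ~> bool) (pY : R.-pker (X * bool) ~> R)
  (hpA : cond_law P covariate action pA)
  (hpY : cond_law P (fun o => (covariate o, action o)) reward pY)
  (M : R) (hM : {ae P, forall o, `|reward o| <= M})
  (delta : R) (hdelta : 0 < delta < 2^-1)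
  (hpos : {ae P, forall o,
     delta <= propensity pA true (covariate o) <= 1 - delta})
  (Pi : set (policy X))
  (c : R) (hc : 0 < c) (Fdot : policy X -> R -> R)
  (hFdot : forall pi, policy_closure P Pi pi ->
     derivative_on (policy_cdf P pY pi) (Fdot pi)
       (median_value P pY pi - c) (median_value P pY pi + c) /\
     {within `[median_value P pY pi - c, median_value P pY pi + c]%classic,
       continuous (Fdot pi)})
  (hbounds :
     let lo := ereal_inf [set ereal_inf [set (Fdot pi m)%:E |
                   m in [set m | `|m - median_value P pY pi| <= c]] |
                 pi in policy_closure P Pi] in
     let hi := ereal_sup [set ereal_sup [set (Fdot pi m)%:E |
                   m in [set m | `|m - median_value P pY pi| <= c]] |
                 pi in policy_closure P Pi] in
     [/\ (0 < lo)%E, (lo <= hi)%E & (hi < +oo)%E])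
  (omega : R -> R) (homega_ge0 : forall m : R, 0 <= m -> 0 <= omega m)
  (homega0 : omega 0 = 0) (homega_lim : omega m @[m --> 0^'+] --> 0)
  (homega : (ereal_sup [set ereal_sup [set
       (`|Fdot pi (median_value P pY pi + k) - Fdot pi (median_value P pY pi)|
          - omega `|k|)%:E | k in [set k : R | (`|k| <= c)%R]] |
       pi in policy_closure P Pi] <= 0)%E)
  (Vhat : forall n, n.-tuple (X * bool * R)%type -> policy X -> R)
  (hVhat : littleo_P P (fun=> 1) (fun n s => ereal_sup [set
       `|Num.sqrt n%:R * (Vhat n s pi - median_value P pY pi)
           - emp_process P s (influence P pA pY Fdot pi)|%:E | pi in Pi]))
  (pihat : forall n, n.-tuple (X * bool * R)%type -> policy X)
  (hpihat_in : forall n s, Pi (pihat n s))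
  (rem : forall n, n.-tuple (X * bool * R)%type -> \bar R)
  (hrem : littleo_P P (fun n => (Num.sqrt n%:R)^-1) rem)
  (hpihat : forall n s,
     (ereal_sup [set (Vhat n s pi)%:E | pi in Pi] - rem n s
        <= (Vhat n s (pihat n s))%:E)%E)
  (hdonsker : donsker P [set policy_fun pi | pi in Pi])
  (hunif : forall e : R, 0 < e -> exists2 eta : R, 0 < eta &
     forall pi pi', policy_closure P Pi pi -> policy_closure P Pi pi' ->
       (L2dist P (policy_fun pi) (policy_fun pi') < eta%:E)%E ->
       (L2dist P (influence P pA pY Fdot pi) (influence P pA pY Fdot pi')
          < e%:E)%E) :
  littleo_P P (fun n => (Num.sqrt n%:R)^-1)
    (fun n s => (regret P pY Pi (pihat n s))%:E).
Proof.
have Pi0 : Pi (pihat 0 [tuple]) by exact: hpihat_in.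
pose V := median_value P pY; pose vs := sup [set V pi | pi in Pi].
have [MV hMV] := median_bounded pY P.
have hsV : has_sup [set V pi | pi in Pi].
  split; first by exists (V (pihat 0 [tuple])), (pihat 0 [tuple]).
  by exists MV => _ [pi _ <-]; have := hMV pi; rewrite ler_norml => /andP[].
have Vvs pi : Pi pi -> V pi <= vs.
  by move=> hpi; apply: sup_ubound; [case: hsV|exists pi].
have near_sup t : 0 < t -> exists2 pi, Pi pi & vs - t < V pi.
  by move=> t0; have [_ [pi hpi <-] h] := sup_adherent t0 hsV; exists pi.
have [lo lo0 [hi hlohi]] := derivative_bounds hbounds.
pose a pi := (Fdot pi (V pi))^-1.
have a01 pi : Pi pi -> 0 <= a pi <= lo^-1.
  move=> hpi; have /andP[h _] : lo <= Fdot pi (V pi) <= hi.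
    by apply: hlohi => //; rewrite subrr normr0 ltW.
  by rewrite invr_ge0 (le_trans (ltW lo0) h)/= lef_pV2// posrE (lt_le_trans lo0).
apply: small_littleo => e q e0 q0.
(* The 9 is that of [argmax_regret], and [l] is such that the bound [lo^-1] on the inverse
   derivative times [l] is [e1]. *)
pose e1 := e / 9; have e10 : 0 < e1 by rewrite divr_gt0.
pose l := e1 * lo; have l0 : 0 < l by rewrite mulr_gt0.
pose q6 := q / 6; have q60 : 0 < q6 by rewrite divr_gt0.
have [K K0 hK] := tight_psi pA pY hdelta hdonsker q60.
have [I1 [k1 hk1]] := equicontinuous_psi pA pY hdelta hdonsker l0 q60.
(* On [Pi] the inverse derivative is bounded, so finitely many cells make it vary by at most e1 / K;
   the value 0 outside [Pi] is a placeholder. *)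
have [I2 [k2 hk2]] : exists (I : finType) (k : policy X -> I), forall pi pi', k pi = k pi' ->
    `|(if `[< Pi pi >] then a pi else 0) - (if `[< Pi pi' >] then a pi' else 0)| <= e1 / K.
  apply: (@finite_partition _ _ _ lo^-1); first by rewrite divr_gt0.
  move=> pi; case: asboolP => [/a01/andP[h1 h2]|_]; first by rewrite ger0_norm.
  by rewrite normr0 invr_ge0 ltW.
pose k pi := (k1 pi, k2 pi); pose I := (I1 * I2)%type.
pose active (i : I) := forall t, 0 < t -> exists pi, [/\ Pi pi, k pi = i & vs - t < V pi].
(* Each of the finitely many inactive cells stays a positive distance below [vs], which leaves a
   common gap. *)
have [gam gam0 hgam] : exists2 gam, 0 < gam &
    forall i, ~ active i -> forall pi, Pi pi -> k pi = i -> V pi <= vs - gam.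
  have : \forall t \near 0^'+, forall i, ~ active i -> forall pi, Pi pi -> k pi = i -> V pi <= vs - t.
    apply: filter_forall => i; have [hi'|/existsNP[t /not_implyP[t0 ht]]] := pselect (active i).
      by apply: nearW => t /(_ hi').
    near=> t' => _ pi hpi kpi; apply: (@le_trans _ _ (vs - t)); last first.
      by rewrite lerD2l lerN2; near: t'; exact: nbhs_right_le.
    by rewrite leNgt; apply/negP => h; apply: ht; exists pi.
  move=> h; have [t [t0 ht]] := @filter_ex _ (0^'+) _ _ (filterI (nbhs_right_gt 0) h).
  by exists t.
pose q' := q6 / (#|{: I}|%:R + 1).
have q'0 : 0 < q' by rewrite divr_gt0// ltr_wpDl.
have [rho rho0 hrho] := window_psi pA hdelta hpY l0 q'0.
(* A representative has median within c / 2 of [vs], so a window of length at most c / 2 below [vs]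
   lies where its derivative is at most [hi]. The second bound keeps the increment of F over the
   window below [rho]. *)
pose eta1 := Num.min (c / 2) (rho / (`|hi| + 1)).
have h10 : 0 < `|hi| + 1 by rewrite ltr_wpDl.
have eta10 : 0 < eta1 by rewrite lt_min !divr_gt0.
have /boolp.choice[p hp] : forall i, exists p, active i -> [/\ Pi p, k p = i & vs - c / 2 < V p].
  move=> i; have [ai|nai] := pselect (active i); last by exists (pihat 0 [tuple]).
  by have [|p hp] := ai (c / 2); [rewrite divr_gt0|exists p].
have hw i : \forall n \near \oo, small (iid_law P n) [set s | active i /\ exists v,
    vs - eta1 <= v <= vs /\ l < `|emp_process P s (psi pA pY delta (p i) vs) -
      emp_process P s (psi pA pY delta (p i) v)|] q'.
  have [ai|nai] := pselect (active i); last first.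
    by apply: nearW => n; apply: small_sub (small0 _ (ltW q'0)) => s [].
  have [Pp _ Vp] := hp i ai.
  have inc : policy_cdf P pY (p i) vs - policy_cdf P pY (p i) (vs - eta1) <= rho.
    have [dF _] := hFdot _ (@sub_policy_closure _ _ _ P Pi _ Pp).
    have ec : eta1 <= c / 2 by rewrite ge_min lexx.
    have Vp' := Vvs _ Pp.
    apply: (@le_trans _ _ (hi * (vs - (vs - eta1)))).
      apply: (derivative_on_le dF); rewrite -/(V (p i)); [|lra..].
      move=> m /andP[m1 m2].
      have /andP[//] : lo <= Fdot (p i) m <= hi.
      by apply: hlohi => //; rewrite -/(V (p i)) ler_norml; apply/andP; split; lra.
    rewrite opprB addrCA subrr addr0.
    apply: (@le_trans _ _ ((`|hi| + 1) * eta1)).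
      by apply: ler_wpM2r; [exact: ltW|rewrite (le_trans (ler_norm _))// lerDl].
    by rewrite mulrC -ler_pdivlMr// ge_min lexx orbT.
  have : vs - eta1 <= vs by rewrite gerBl ltW.
  move=> /(hrho (p i)) /(_ inc); apply: filterS => n; apply: small_sub => s [_ [v [hv1 hv2]]].
  by exists v.
have {}hw : \forall n \near \oo, forall i, small (iid_law P n) [set s | active i /\ exists v,
    vs - eta1 <= v <= vs /\ l < `|emp_process P s (psi pA pY delta (p i) vs) -
      emp_process P s (psi pA pY delta (p i) v)|] q'.
  exact: filter_forall.
have hV := littleo_small hVhat e10 q60; have hR := littleo_small hrem e10 q60.
(* Within [gam] of [vs] the cell is active; within [eta1] the medians lie in the window of the
   representative. *)
pose eta := Num.min gam eta1; have eta0 : 0 < eta by rewrite lt_min gam0.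
near=> n.
have n0 : (0 < n)%N by near: n; exact: nbhs_infty_gt.
have N0 : 0 < Num.sqrt n%:R :> R by rewrite sqrtr_gt0 ltr0n.
have Nbig : 2 * lo^-1 * K + 4 * e1 <= Num.sqrt n%:R * eta.
  rewrite -ler_pdivrMr//; set B := _ / eta.
  have B0 : 0 <= B.
    by rewrite divr_ge0 ?(ltW eta0)// addr_ge0 ?mulr_ge0// ?invr_ge0 ltW.
  rewrite -[leLHS]ger0_norm// -sqrtr_sqr ler_wsqrtr//.
  by near: n; exact: nbhs_infty_ger.
have sI := emp_influence pY hdelta Fdot n hpos.
have sK : small (iid_law P n) [set s | exists pi v, Pi pi /\
   K < `|emp_process P s (psi pA pY delta pi v)|] q6 by near: n.
have s1 : small (iid_law P n) [set s | exists pi pi', [/\ Pi pi, Pi pi', k1 pi = k1 pi' & exists v,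
    l < `|emp_process P s (psi pA pY delta pi v) - emp_process P s (psi pA pY delta pi' v)|]] q6.
  by near: n.
have sw : forall i, small (iid_law P n) [set s | active i /\ exists v,
    vs - eta1 <= v <= vs /\ l < `|emp_process P s (psi pA pY delta (p i) vs) -
      emp_process P s (psi pA pY delta (p i) v)|] q'.
  by near: n.
have sV : small (iid_law P n) [set s | ((e1 * 1)%:E < `|ereal_sup [set
       `|Num.sqrt n%:R * (Vhat n s pi - V pi)
           - emp_process P s (influence P pA pY Fdot pi)|%:E | pi in Pi]|)%E] q6.
  by near: n.
have sR : small (iid_law P n) [set s | ((e1 * (Num.sqrt n%:R)^-1)%:E < `|rem n s|)%E] q6.
  by near: n.
(* Besides the null event there are five events of probability at most q / 6, the windows of all
   cells together counting as one. *)
apply: small_le (small_sub _ (smallU (smallU (smallU (smallU (smallU sI sK) s1) (small_bigU sw)) sV) sR)).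
  have : \sum_(i : I) q' <= q6.
    rewrite sumr_const -[q' *+ _]mulr_natr /q' mulrAC ler_pdivrMr ?ltr_wpDl//.
    by rewrite mulrDr mulr1 lerDl ltW.
  by rewrite /q6; lra.
move=> s; apply: contraPP => /not_orP[/not_orP[/not_orP[/not_orP[/not_orP[gI gK] g1] gw] gV] gR].
apply/negP; rewrite -leNgt.
have hphat := hpihat_in n s; have hreg : 0 <= regret P pY Pi (pihat n s).
  by rewrite subr_ge0; exact: Vvs.
rewrite gee0_abs ?lee_fin// /regret -/vs -/(V _).
have -> : e * (Num.sqrt n%:R)^-1 = 9 * e1 / Num.sqrt n%:R by rewrite /e1 mulrCA mulfV// mulr1.
pose G pi v := emp_process P s (psi pA pY delta pi v).
have hG pi pi' v : Pi pi -> Pi pi' -> k pi = k pi' -> `|G pi v - G pi' v| <= l.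
  move=> h h' [kk _]; rewrite leNgt; apply/negP => hh; apply: g1.
  by exists pi, pi'; split=> //; exists v.
have hact pi : Pi pi -> vs - eta < V pi -> active (k pi).
  move=> hpi hV'; apply: contrapT => na; have := hgam _ na _ hpi erefl.
  have : eta <= gam by rewrite ge_min lexx.
  by move: hV' => /[swap]; lra.
apply: (@argmax_regret _ _ _ Pi V (Vhat n s) a G k p _ _ e1 l K lo^-1 eta) => //.
- by rewrite /l mulrCA mulVf ?mulr1// gt_eqF.
- move=> pi hpi; rewrite leNgt; apply/negP => h; apply: gV => /=.
  rewrite mulr1; apply: (@lt_le_trans _ _ (`|Num.sqrt n%:R * (Vhat n s pi - V pi)
           - emp_process P s (influence P pA pY Fdot pi)|%:E)).
    have -> : emp_process P s (influence P pA pY Fdot pi) = - a pi * G pi (V pi).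
      by apply: contrapT => h'; apply: gI; exists pi.
    by rewrite lte_fin mulNr (opprK (a pi * _)).
  apply: (le_trans _ (lee_abs _)); apply: ereal_sup_ubound; by exists pi.
- move=> pi hpi; rewrite -lee_fin; apply: le_trans (hpihat n s).
  rewrite EFinB; apply: leeB; first by apply: ereal_sup_ubound; exists pi.
  by apply: (le_trans (lee_abs _)); rewrite leNgt; apply/negP.
- by move=> pi v hpi; rewrite leNgt; apply/negP => h; apply: gK; exists pi, v.
- move=> pi pi' hpi hpi' [_ /hk2]; rewrite !asboolT// ler_pdivlMr//.
- by move=> pi t hpi hV' t0; have [pi' hpi'] := hact _ hpi hV' t t0; exists pi'.
- move=> pi v hpi hV' /andP[v1 v2]; have act' := hact _ hpi hV'; have [? ? _] := hp _ act'.
  split=> //; rewrite leNgt; apply/negP => h; apply: gw; exists (k pi); split=> //.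
  exists v; split=> //; rewrite v2 andbT; apply: le_trans v1.
  by rewrite lerD2l lerN2 ge_min lexx orbT.
Unshelve. all: by end_near. Qed.
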